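(* Let $T\in(0,\infty)$, $\varrho\in(\frac16,\frac14)$, $\chi\in(0,\frac\varrho3-\frac1{18}]$, $H=L^2((0,1);\mathbb R)$, let $A\colon D(A)\subseteq H\to H$ be the Laplace operator with Dirichlet boundary conditions on $H$, let $(H_r,\langle\cdot,\cdot\rangle_{H_r},\|\cdot\|_{H_r})$, $r\in\mathbb R$, be a family of interpolation spaces associated to $-A$, let $\xi\in H_{1/2}$, let $F\colon H_{1/6}\to H$, $(e_n)_{n\in\mathbb N}\colon\mathbb N\to H$, $(P_n)_{n\in\mathbb N}\colon\mathbb N\to L(H)$, and $(h_n)_{n\in\mathbb N}\colon\mathbb N\to(0,T]$ be functions with $F(v)=v-v^3$ for all $v\in H_{1/6}$, $e_n=(\sqrt2\sin(n\pi x))_{x\in(0,1)}$ and $P_n(v)=\sum_{k=1}^n\langle e_k,v\rangle_He_k$ for all $n\in\mathbb N$, $v\in H$, and $\limsup_{m\to\infty}h_m=0$. Let $(\Omega,\mathcal F,\mathbb P)$ be a probability space, let $(W_t)_{t\in[0,T]}$ be an $\mathrm{Id}_H$-cylindrical $(\Omega,\mathcal F,\mathbb P)$-Wiener process, let $\mathcal X^n,\mathcal O^n\colon[0,T]\times\Omega\to P_n(H)$, $n\in\mathbb N$, be stochastic processes, let $X\colon[0,T]\times\Omega\to H_\varrho$ be a stochastic process with continuous sample paths, and assume for all $n\in\mathbb N$, $t\in[0,T]$ that $[X_t]_{\mathbb P,\mathcal B(H)}=\big[e^{tA}\xi+\int_0^te^{(t-s)A}F(X_s)\,ds\big]_{\mathbb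 P,\mathcal B(H)}+\int_0^te^{(t-s)A}\,dW_s$, $[\mathcal O^n_t]_{\mathbb P,\mathcal B(H)}=\int_0^tP_ne^{(t-s)A}\,dW_s$, and $$\mathbb P\Big(\mathcal X^n_t=P_ne^{tA}\xi+\int_0^tP_ne^{(t-s)A}\,\mathbf 1_{\{\|\mathcal X^n_{\lfloor s\rfloor_{h_n}}\|_{H_\varrho}+\|\mathcal O^n_{\lfloor s\rfloor_{h_n}}+P_ne^{\lfloor s\rfloor_{h_n}A}\xi\|_{H_\varrho}\le|h_n|^{-\chi}\}}F(\mathcal X^n_{\lfloor s\rfloor_{h_n}})\,ds+\mathcal O^n_t\Big)=1.$$ Then it holds for all $p\in(0,\infty)$ that $\limsup_{n\to\infty}\sup_{t\in[0,T]}\mathbb E\big[\|X_t-\mathcal X^n_t\|_H^p\big]=0$.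
   Context: $\lfloor t\rfloor_h=\max((-\infty,t]\cap\{0,h,-h,2h,-2h,\dots\})$ for $h>0$, $t\in\mathbb R$. $[f]_{\mathbb P,\mathcal B(H)}$ is the class of all $\mathcal F/\mathcal B(H)$-measurable functions agreeing with $f$ outside a $\mathbb P$-null set; stochastic integrals are such classes. Interpolation spaces associated to $-A$: for $r\ge0$, $H_r=D((-A)^r)$ with $\|v\|_{H_r}=\|(-A)^rv\|_H$; for $r<0$, $H_r$ is the completion of $H$ with respect to $\|(-A)^r\cdot\|_H$. By the Sobolev embedding $H_{1/6}\subseteq L^6((0,1);\mathbb R)$, so $v^3\in H$ for $v\in H_{1/6}$. *)

(* Defs.v *)
From HB Require Import structures.
From mathcomp Require Export all_boot all_order all_algebra.
From mathcomp Require Export all_classical all_reals all_analysis measurable_realfun.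
From mathcomp Require Import generic_quotient ring_quotient.
Set Implicit Arguments.
Unset Strict Implicit.
Unset Printing Implicit Defensive.
Export Order.TTheory GRing.Theory Num.Theory.
Export numFieldNormedType.Exports.
Local Open Scope classical_set_scope.
Local Open Scope ring_scope.

Section L2_space.
Context d (T : measurableType d) (R : realType).
Variable mu : {measure set T -> \bar R}.

Local Notation L2fun := (LfunType mu (lee1n 2)).

Definition L2null : {pred L2fun} :=
  fun f => `[< (f : T -> R) = cst 0 %[ae mu] >].

Lemma L2null_zmod_closed : zmod_closed L2null.
Proof.
split; first by apply/asboolP; exact: filterE.
move=> f g /asboolP f0 /asboolP g0; apply/asboolP.
apply: filterS2 f0 g0 => x /= f0 g0 Dx.
transitivity (f x - g x); first by [].
by rewrite f0// g0// subrr.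
Qed.

HB.instance Definition _ := GRing.isZmodClosed.Build L2fun L2null
  L2null_zmod_closed.

(* LspaceType2 of the library carries no algebraic structure, hence this
   quotient of the square-integrable functions by the a.e. null ones. *)
Definition L2 : Type := Quotient.quot L2null.
HB.instance Definition _ := GRing.Zmodule.on L2.
HB.instance Definition _ := Choice.on L2.

Definition L2class (f : L2fun) : L2 := \pi_(Quotient.quot L2null)%qT f.
Definition L2repr (v : L2) : L2fun := repr (v : Quotient.quot L2null).
Definition L2val (v : L2) : T -> R := L2repr v.
Coercion L2val : L2 >-> Funclass.

Lemma L2reprK v : L2class (L2repr v) = v.
Proof. exact: (@reprK _ (Quotient.quot L2null)). Qed.

Lemma L2classP (f g : L2fun) :
  L2class f = L2class g <-> (f : T -> R) = g %[ae mu].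
Proof.
have -> : (L2class f = L2class g) <-> (f - g \in L2null).
  rewrite Quotient.idealrBE; split => [|/eqP]//.
  by move=> h; apply/eqP.
split=> [/asboolP h|h].
  apply: filterS h => x /= h Dx; apply/eqP; rewrite -subr_eq0; apply/eqP.
  exact: h.
apply/asboolP; apply: filterS h => x /= h Dx.
transitivity (f x - g x); first by [].
by rewrite h// subrr.
Qed.

Lemma L2valK (f : L2fun) : L2val (L2class f) = f %[ae mu].
Proof. by apply/L2classP; exact: L2reprK. Qed.

Lemma L2classD f g : L2class (f + g) = L2class f + L2class g.
Proof. exact: (@Quotient.pi_add _ L2null). Qed.

Definition L2scale (a : R) (v : L2) : L2 := L2class (a *: L2repr v).

Lemma L2classZ a f : L2class (a *: f) = L2scale a (L2class f).
Proof.
apply/L2classP; apply: filterS (L2valK f) => x /= h Dx.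
transitivity (a * f x); first by [].
by rewrite -h.
Qed.

Let L2scalerA a b v : L2scale a (L2scale b v) = L2scale (a * b) v.
Proof. by rewrite -(L2reprK v) -!L2classZ scalerA. Qed.
Let L2scale1r : left_id 1 L2scale.
Proof. by move=> v; rewrite -(L2reprK v) -!L2classZ scale1r. Qed.
Let L2scalerDr : right_distributive L2scale +%R.
Proof.
move=> a u v; rewrite -(L2reprK u) -(L2reprK v).
by rewrite -L2classD -!L2classZ -L2classD scalerDr.
Qed.
Let L2scalerDl v : {morph L2scale^~ v : a b / a + b}.
Proof. by move=> a b /=; rewrite -(L2reprK v) -!L2classZ -L2classD scalerDl. Qed.

HB.instance Definition _ := GRing.Zmodule_isLmodule.Build R L2
  L2scalerA L2scale1r L2scalerDr L2scalerDl.

Definition L2norm (v : L2) : R := fine 'N[mu]_2%:E[EFin \o v]%E.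

Let measurable_sqr (g : L2fun) :
  measurable_fun setT (fun x => (`|(g x)%:E| `^ 2)%E).
Proof.
apply/measurable_EFinP.
apply: (@measurableT_comp _ _ _ _ _ _ (fun x : R => x `^ 2)) => //.
exact: measurableT_comp.
Qed.

Lemma L2norm_class (f : L2fun) :
  L2norm (L2class f) = fine 'N[mu]_2%:E[EFin \o f]%E.
Proof.
rewrite /L2norm unlock; congr (fine (_ `^ _)%E).
apply: ae_eq_integral => //; [exact: measurable_sqr..|].
by apply: filterS (L2valK f) => x /= h Dx; rewrite h.
Qed.

Let L2norm_ler_normD u v : L2norm (u + v) <= L2norm u + L2norm v.
Proof.
rewrite -(L2reprK u) -(L2reprK v) -L2classD !L2norm_class.
exact: ler_LnormD.
Qed.

Let L2norm_normrZ a v : L2norm (a *: v) = `|a| * L2norm v.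
Proof.
rewrite -(L2reprK v) -[_ *: _]L2classZ !L2norm_class.
apply: EFin_inj; rewrite finite_norm_fine.
by rewrite LnormZ EFinM finite_norm_fine.
Qed.

Let L2norm_eq0 v : L2norm v = 0 -> v = 0.
Proof.
rewrite -(L2reprK v) L2norm_class => /fine_Lnormr_eq0 h.
have -> : 0 = L2class 0 by apply: (addrI (L2class 0)); rewrite addr0 -L2classD addr0.
by apply/L2classP.
Qed.

HB.instance Definition _ := @Lmodule_isNormed.Build R L2
  L2norm L2norm_ler_normD L2norm_normrZ L2norm_eq0.

Definition L2dot (u v : L2) : R := \int[mu]_x (u x * v x).

End L2_space.
Definition leb01 (R : realType) : {measure set (measurableTypeR R) -> \bar R} :=
  mrestr (@lebesgue_measure R) (measurable_itv `]0%R, 1%R[).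

Definition H (R : realType) : Type := L2 (leb01 R).
HB.instance Definition _ (R : realType) := NormedModule.on (H R).
Definition Hval (R : realType) (v : H R) : R -> R := L2val v.
Coercion Hval : H >-> Funclass.

Section dirichlet_laplacian.
Context {R : realType}.
Implicit Types (u v w : H R) (phi : R -> R) (r t : R).
Local Notation leb := (@lebesgue_measure R).

(* The graph of A: v belongs to D(A) and w = A v.  The domain is
   H^2(0,1) \cap H^1_0(0,1), that is, v has a representative f which vanishes
   at 0 and at 1 and which has an absolutely continuous derivative g with
   g' = w a.e.; absolute continuity is stated as being the indefinite integral
   of an integrable function. *)
Definition dirichlet_laplacian v w : Prop :=
  exists f g : R -> R, [/\ (v : R -> R) = f %[ae leb01 R],
    forall x, x \in `[0, 1] -> f x = f 0 + \int[leb]_(y in `[0, x]) g y,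
    forall x, x \in `[0, 1] -> g x = g 0 + \int[leb]_(y in `[0, x]) w y &
    f 0 = 0 /\ f 1 = 0].

(* Functional calculus of A, a self-adjoint operator whose eigenvectors span
   H: the graph of phi(A) consists of the (v, w) for which the component of w
   along every eigenvector for the eigenvalue m is phi(m) times that of v. *)
Definition fcalc_graph phi v w : Prop :=
  forall (m : R) u, dirichlet_laplacian u (m *: u) ->
    L2dot u w = phi m * L2dot u v.

Definition fcalc_dom phi : set (H R) :=
  [set v | exists w, fcalc_graph phi v w].

(* phi(A) v, with the junk value 0 if v is not in the domain of phi(A) *)
Definition fcalc phi v : H R := xget 0 (fcalc_graph phi v).

(* e^{tA} *)
Definition heat t : H R -> H R := fcalc (fun m => expR (t * m)).

(* The interpolation spaces H_r = D((-A)^r), as subsets of H, hence for r >= 0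
   only *)
Definition Hr r : set (H R) := fcalc_dom (fun m => (- m) `^ r).

Definition Hr_norm r v : R := `|fcalc (fun m => (- m) `^ r) v|.

Definition Hr_open r (U : set (H R)) : Prop :=
  U `<=` Hr r /\ forall v, U v -> exists2 eps, 0 < eps &
    forall u, Hr r u -> Hr_norm r (u - v) < eps -> U u.

Definition Hr_continuous_on (D : set R) r (Y : R -> H R) : Prop :=
  (forall t, D t -> Hr r (Y t)) /\
  forall t, D t -> forall eps, 0 < eps -> exists2 delta, 0 < delta &
    forall s, D s -> `|s - t| < delta -> Hr_norm r (Y s - Y t) < eps.

End dirichlet_laplacian.

Section bochner_integral.
Context d (T : measurableType d) (R : realType) (V : normedModType R).
Variables (mu : {measure set T -> \bar R}) (D : set T).

(* A list of pairs (B, a) stands for the simple function \sum \1_B a. *)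
Definition simple_fun (s : seq (set T * V)) (x : T) : V :=
  \sum_(p <- s) (\1_(p.1) x : R) *: p.2.

Definition simple_int (s : seq (set T * V)) : V :=
  \sum_(p <- s) fine (mu (p.1 `&` D)) *: p.2.

Definition is_bochner_integral (f : T -> V) (I : V) : Prop :=
  exists s : nat -> seq (set T * V),
  [/\ forall n p, p \in s n ->
        measurable p.1 /\ (mu (p.1 `&` D) < +oo)%E,
      \forall x \ae mu, D x -> simple_fun (s n) x @[n --> \oo] --> f x,
      forall n, measurable_fun D (fun x => `|f x - simple_fun (s n) x|),
      (\int[mu]_(x in D) (`|f x - simple_fun (s n) x|)%:E)%E
        @[n --> \oo] --> 0%E &
      simple_int (s n) @[n --> \oo] --> I].

(* 0 if f is not Bochner integrable *)
Definition bochner_integral (f : T -> V) : V := xget 0 (is_bochner_integral f).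

End bochner_integral.

Section random_elements.
Context d (Omega : measurableType d) (R : realType).
Variable P : probability Omega R.

Definition borel_measurable (V : normedModType R) (Y : Omega -> V) : Prop :=
  forall U : set V, open U -> measurable (Y @^-1` U).

Definition Hr_borel_measurable (r : R) (Y : Omega -> H R) : Prop :=
  (forall w, Hr r (Y w)) /\
  forall U, Hr_open r U -> measurable (Y @^-1` U).

Definition rv_class (V : normedModType R) (f : Omega -> V) :
    set (Omega -> V) :=
  [set g | borel_measurable g /\ \forall w \ae P, g w = f w].

Definition add_class (V : normedModType R) (A B : set (Omega -> V)) :
    set (Omega -> V) :=
  [set f \+ g | f in A & g in B].

End random_elements.

Section wiener.
Context d (Omega : measurableType d) (R : realType).
Variables (P : probability Omega R).
Implicit Types (T t : R) (W : R -> H R -> Omega -> R) (u v : H R).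

(* The sigma-algebra generated by the W_r(u), 0 <= r <= t, u in H *)
Definition wiener_past W t : set (set Omega) :=
  <<s [set A | exists r u (B : set R),
         [/\ 0 <= r <= t, measurable B & A = W r u @^-1` B]] >>.

Definition increment W s t v (w : Omega) : R := W t v w - W s v w.

(* W t v stands for the real random variable <v, W_t>, so that (W_t(v))_t is a
   Brownian motion of variance |v|^2 t with respect to the filtration generated
   by W.  The case v = 0 follows from cw_linear; it is excluded in cw_gaussian
   because normal_prob m 0 is not the Dirac measure at m. *)
Record cylindrical_wiener T W : Prop := CylindricalWiener {
  cw_measurable : forall t v, t \in `[0, T] -> measurable_fun setT (W t v) ;
  cw_linear : forall t a u v, t \in `[0, T] ->
    \forall w \ae P, W t (a *: u + v) w = a * W t u w + W t v w ;
  cw_start : forall v, \forall w \ae P, W 0 v w = 0 ;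
  cw_continuous : forall v, \forall w \ae P,
    {within `[0, T], continuous (fun t => W t v w)} ;
  cw_gaussian : forall (s t : R) v (B : set R),
    0 <= s -> s < t -> t <= T -> v != 0 -> measurable B ->
    P (increment W s t v @^-1` B) =
      normal_prob 0 (Num.sqrt (t - s) * `|v|) B ;
  cw_independent : forall (s t : R) v (B : set R) (A : set Omega),
    0 <= s -> s < t -> t <= T -> measurable B -> wiener_past W s A ->
    P (A `&` increment W s t v @^-1` B) =
      (P A * P (increment W s t v @^-1` B))%E }.

(* Elementary integrands: a quadruple ((a, b), (u, v)) stands for the
   operator-valued step function s |-> \1_]a,b](s) <u, .> v. *)
Definition elem_integrand := seq ((R * R) * (H R * H R)).

Definition elem_op (Phi : elem_integrand) (s : R) (x : H R) : H R :=
  \sum_(p <- Phi) (\1_(`]p.1.1, p.1.2]) s * L2dot p.2.1 x) *: p.2.2.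

Definition elem_integral W (Phi : elem_integrand) (w : Omega) : H R :=
  \sum_(p <- Phi) increment W p.1.1 p.1.2 p.2.1 w *: p.2.2.

(* Squared Hilbert-Schmidt norm, (e_n)_{n >= 1} being an orthonormal basis *)
Definition HS_norm2 (e : nat -> H R) (B : H R -> H R) : \bar R :=
  (\sum_(1 <= k <oo) (`|B (e k)| ^+ 2)%:E)%E.

(* The class of \int_0^t Phi_s dW_s for a deterministic Phi: the L^2(P)-limit of
   the integrals of elementary integrands approximating Phi in
   L^2((0,t); HS(H)) *)
Definition stoch_integral W (e : nat -> H R) t (Phi : R -> H R -> H R) :
    set (Omega -> H R) :=
  [set I | borel_measurable I /\ exists Phin : nat -> elem_integrand,
    [/\ forall n p, p \in Phin n -> 0 <= p.1.1 <= p.1.2 /\ p.1.2 <= t,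
        (\int[lebesgue_measure]_(s in `[0%R, t])
           HS_norm2 e (fun x => Phi s x - elem_op (Phin n) s x)%R)%E
          @[n --> \oo] --> 0%E &
        (\int[P]_w (`|I w - elem_integral W (Phin n) w| ^+ 2)%:E)%E
          @[n --> \oo] --> 0%E]].

End wiener.

(* max of (-oo, t] \cap {0, h, -h, 2h, -2h, ...} *)
Definition round_down (R : realType) (h t : R) : R :=
  sup [set x | x <= t /\ exists k : int, x = k%:~R * h].

(* Main.v *)
(** Everything is done in the coordinates of the sine basis, in which the heat
    semigroup, the projections and the interpolation norms are diagonal.

    Pathwise convergence: the noise is eliminated by writing OO n t as the
    projection of X t - e^(tA) xi - int_0^t e^((t-s)A) F(X s) ds, so that the
    difference of solution and scheme satisfies an integral inequality in H_rho
    without noise.  By the Sobolev embedding F is locally Lipschitz from H_rho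
    to H, and the smoothing of the semigroup together with a Gronwall argument
    along the grid shows that the error tends to 0; as long as the error is at
    most 1 the truncation is inactive for small step sizes.

    Moments: the one-sided bound <z - o, F(z)> <= 3 + 3 |o|_4^4 and the
    truncation give |XX n t - OO n t|^2 <= C (1 + step averages of |OO n|_4^4),
    and OO n t evaluated at a point of (0,1) has Gaussian exponential moments
    bounded uniformly in n, t and the point, as the squares of its coordinates
    are summable.  Thus all moments of XX n t, and by Fatou those of X t, are
    bounded, and almost sure convergence along an arbitrary sequence of times
    improves to convergence in L^p, uniformly in time. *)
From HB Require Import structures.
Require Import Defs.
From mathcomp Require Import all_boot all_order all_algebra.
From mathcomp Require Import all_classical all_reals all_analysis.
From mathcomp Require Import ring lra zify.
Set Implicit Arguments.
Unset Strict Implicit.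
Unset Printing Implicit Defensive.
Local Open Scope classical_set_scope.
Local Open Scope ring_scope.

(** No path regularity of [XX] or [OO] is assumed, and their equations hold for each time only
    outside a null set depending on that time. Everything pathwise is therefore arranged to use
    countably many times: all grid points and one free time [tau n] for each [n]. The supremum over
    time is recovered by letting [tau n] be a time at which the p-th moment of the error exceeds a
    given level, if there is one. As [X] has continuous paths in H_rho, the noise read off from its
    equation inherits bounds in H_rho from [X].

    The condition on [chi] enters as 4 chi <= rho and 6 chi <= 1. In one step of size h with
    threshold eta = h^(-chi), relative to the step length, the error of freezing the drift is of
    order h^rho eta^4 and its quadratic term of order h eta^6; both stay bounded. The condition rho
    > 1/6 makes the dyadic blocks of an element of H_rho summable in L^6, and rho <= 1/2 lets the
    time integral of the squared heat kernel, at most 1/(2 lam), absorb the weight lam^(2 rho). *)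

Section L2_inner_product.
Context d (T : measurableType d) (R : realType).
Variable mu : {measure set T -> \bar R}.
Implicit Types u v w : L2 mu.

(** * Inner product and norm of L^2 *)

Lemma measurable_L2 v : measurable_fun setT (v : T -> R).
Proof. by rewrite /L2val. Qed.

Lemma L2_Lfun v : (v : T -> R) \in Lfun mu 2%:E.
Proof. exact: LfunP. Qed.

Lemma integrable_L2M u v : mu.-integrable setT (fun x => (u x * v x)%:E).
Proof. exact/Lfun1_integrable/Lfun2_mul_Lfun1/L2_Lfun/L2_Lfun. Qed.

Lemma integrable_L2sqr v : mu.-integrable setT (fun x => (v x ^+ 2)%:E).
Proof. exact/Lfun2_integrable_sqr/L2_Lfun. Qed.

Lemma L2_eqP u v : u = v <-> (u : T -> R) = v %[ae mu].
Proof. by rewrite -L2classP !L2reprK. Qed.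

Lemma L2_addE u v : ((u + v : L2 mu) : T -> R) = (fun x => u x + v x) %[ae mu].
Proof. have -> : u + v = L2class (L2repr u + L2repr v) by rewrite L2classD !L2reprK.
exact: L2valK. Qed.

Lemma L2_scaleE a v : ((a *: v : L2 mu) : T -> R) = (fun x => a * v x) %[ae mu].
Proof. exact: L2valK. Qed.

Lemma L2_exists (f : T -> R) : measurable_fun setT f ->
  (\int[mu]_x (f x ^+ 2)%:E < +oo)%E -> exists v, (v : T -> R) = f %[ae mu].
Proof.
move=> mf if2.
have lf : f \in Lfun mu 2%:E.
  rewrite inE; apply/andP; split; rewrite inE//= /finite_norm unlock/=.
  rewrite poweR_lty//.
  apply: le_lt_trans if2; rewrite le_eqVlt; apply/orP; left; apply/eqP.
  by apply: eq_integral => x _ /=; rewrite powR_mulrn// real_normK ?num_real.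
exists (L2class (Lfun_Sub (lee1n 2) lf)); exact: L2valK.
Qed.

Lemma L2_zeroE : ((0 : L2 mu) : T -> R) = cst 0 %[ae mu].
Proof. by have := L2_scaleE 0 0; rewrite scale0r; apply: filterS => x h /h ->; rewrite mul0r. Qed.

Lemma eq_L2dot u v (f g : T -> R) : measurable_fun setT f -> measurable_fun setT g ->
  (u : T -> R) = f %[ae mu] -> (v : T -> R) = g %[ae mu] ->
  L2dot u v = \int[mu]_x (f x * g x).
Proof.
move=> mf mg uf vg; congr fine; apply: ae_eq_integral => //.
- by apply/measurable_EFinP/measurable_funM; exact: measurable_L2.
- by apply/measurable_EFinP/measurable_funM.
- by apply: filterS2 uf vg => x /= ux vx xT; rewrite ux// vx.
Qed.

Lemma L2dotC u v : L2dot u v = L2dot v u.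
Proof. by apply: eq_Rintegral => x _; rewrite mulrC. Qed.

Lemma L2dotDr u v w : L2dot u (v + w) = L2dot u v + L2dot u w.
Proof.
rewrite -RintegralD//; [|exact: integrable_L2M..].
rewrite (eq_L2dot (f := u) (g := fun x => v x + w x)) ?measurable_L2//.
- by apply: eq_Rintegral => x _; rewrite mulrDr.
- by apply: measurable_funD; exact: measurable_L2.
- exact: ae_eq_refl.
- exact: L2_addE.
Qed.

Lemma L2dotZr a u v : L2dot u (a *: v) = a * L2dot u v.
Proof.
rewrite -RintegralZl//; [|exact: integrable_L2M].
rewrite (eq_L2dot (f := u) (g := fun x => a * v x)) ?measurable_L2//.
- by apply: eq_Rintegral => x _; rewrite mulrCA.
- by apply: measurable_funM => //; exact: measurable_L2.
- exact: ae_eq_refl.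
- exact: L2_scaleE.
Qed.

Lemma L2dotDl u v w : L2dot (u + v) w = L2dot u w + L2dot v w.
Proof. by rewrite L2dotC L2dotDr !(L2dotC w). Qed.

Lemma L2dot0r u : L2dot u 0 = 0.
Proof. by rewrite -(scale0r 0) L2dotZr mul0r. Qed.

Lemma L2dot0l u : L2dot 0 u = 0.
Proof. by rewrite L2dotC L2dot0r. Qed.

Lemma L2dotNr u v : L2dot u (- v) = - L2dot u v.
Proof. by rewrite -scaleN1r L2dotZr mulN1r. Qed.

Lemma L2dotBr u v w : L2dot u (v - w) = L2dot u v - L2dot u w.
Proof. by rewrite L2dotDr L2dotNr. Qed.

Lemma L2dotBl u v w : L2dot (u - v) w = L2dot u w - L2dot v w.
Proof. by rewrite L2dotC L2dotBr !(L2dotC w). Qed.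

Lemma L2dot_sumr I (s : seq I) (Q : pred I) (f : I -> L2 mu) u :
  L2dot u (\sum_(i <- s | Q i) f i) = \sum_(i <- s | Q i) L2dot u (f i).
Proof.
exact: (big_morph (L2dot u) (L2dotDr u) (L2dot0r u)).
Qed.

Lemma L2norm2E v : (`|v| ^+ 2)%:E = (\int[mu]_x (v x ^+ 2)%:E)%E.
Proof.
have nE : (`|v|%:E = 'N[mu]_2%:E[EFin \o v])%E by exact: finite_norm_fine.
rewrite -powR_mulrn// -[LHS]poweR_EFin nE poweR_Lnorm//; apply: eq_integral => x _.
by rewrite poweR_EFin powR_mulrn// real_normK ?num_real.
Qed.

Lemma L2dotvv v : L2dot v v = `|v| ^+ 2.
Proof. by apply: EFin_inj; rewrite L2norm2E fineK// ?integrable_fin_num//; exact: integrable_L2M. Qed.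

Lemma L2norm2D u v : `|u + v| ^+ 2 = `|u| ^+ 2 + 2 * L2dot u v + `|v| ^+ 2.
Proof.
rewrite -!L2dotvv L2dotDr !L2dotDl (L2dotC v u); ring.
Qed.

Lemma L2_CauchySchwarz u v : `|L2dot u v| <= `|u| * `|v|.
Proof.
have [->|u0] := eqVneq u 0; first by rewrite L2dot0l normr0 mulr_ge0.
have u0' : 0 < `|u| ^+ 2 by rewrite exprn_gt0// normr_gt0.
rewrite -(@ler_sqr _ `|_| _) ?nnegrE ?mulr_ge0// real_normK ?num_real//.
(* This [c] minimises the norm of v + c u. *)
pose c := - (L2dot u v / `|u| ^+ 2).
have := sqr_ge0 `|v + c *: u|; rewrite L2norm2D L2dotZr normrZ exprMn real_normK ?num_real//.
rewrite (L2dotC v u) /c exprMn.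
move: (L2dot u v) => z h.
rewrite -subr_ge0.
have -> : `|u| ^+ 2 * `|v| ^+ 2 - z ^+ 2 = `|u| ^+ 2 * (`|v| ^+ 2 + 2 * (- (z / `|u| ^+ 2) * z) +
     (- (z / `|u| ^+ 2)) ^+ 2 * `|u| ^+ 2).
  by field; rewrite gt_eqF // normr_gt0.
by rewrite mulr_ge0// ltW.
Qed.

End L2_inner_product.

(** * Limit theorems for integrals *)

Section measure_tools.
Context d (T : measurableType d) (R : realType).
Variable mu : {measure set T -> \bar R}.

(** The integral of a nonnegative function is a supremum over the simple functions below it, and
    that family grows with the function. *)
Lemma ge0_le_integral_nomeas (D : set T) (f g : T -> \bar R) :
  (forall x, D x -> 0 <= f x)%E -> (forall x, D x -> f x <= g x)%E ->
  (\int[mu]_(x in D) f x <= \int[mu]_(x in D) g x)%E.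
Proof.
move=> f0 fg; rewrite integral_mkcond [leRHS]integral_mkcond.
have fD x : (0 <= (f \_ D) x)%E by rewrite patchE; case: ifPn => // /set_mem/f0.
have fgD x : ((f \_ D) x <= (g \_ D) x)%E.
  by rewrite !patchE; case: ifPn => // /set_mem/fg.
rewrite !ge0_integralTE//; last by move=> x; exact: le_trans (fD x) (fgD x).
apply: le_ereal_sup => _ [h hf <-]; exists h => // x.
exact: le_trans (hf x) (fgD x).
Qed.

Lemma limn_einf_le (u : (\bar R)^nat) (C : \bar R) :
  (\forall n \near \oo, (u n <= C)%E) -> (limn_einf u <= C)%E.
Proof.
move=> uC; rewrite limn_einf_lim; apply: lime_le; first exact: is_cvg_einfs.
near=> n; apply: (@le_trans _ _ (u n)); last by near: n.
by apply: ereal_inf_lbound; exists n => /=.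
Unshelve. all: by end_near. Qed.

(** Fatou for an a.e. limit and a bound valid from some index on: the form in which norm and moment
    bounds pass from approximations to limits. *)
Lemma fatou_le (D : set T) (f : nat -> T -> R) (g : T -> R) (C : \bar R) :
  measurable D ->
  (forall n, measurable_fun D (f n)) -> (forall n x, D x -> 0 <= f n x) ->
  measurable_fun D g -> (forall x, D x -> 0 <= g x) ->
  (\forall x \ae mu, D x -> f n x @[n --> \oo] --> g x) ->
  (\forall n \near \oo, (\int[mu]_(x in D) (f n x)%:E <= C)%E) ->
  (\int[mu]_(x in D) (g x)%:E <= C)%E.
Proof.
move=> mD mf f0 mg g0 fg fC.
have mF n : measurable_fun D (fun x => (f n x)%:E) by exact/measurable_EFinP.
have -> : (\int[mu]_(x in D) (g x)%:E =
    \int[mu]_(x in D) limn_einf (fun n => (f n x)%:E))%E.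
  apply: ge0_ae_eq_integral => //.
  - exact/measurable_EFinP.
  - have -> : (fun x => limn_einf (fun n => (f n x)%:E)) =
        (fun x => - limn_esup (fun n => (- f n x)%:E))%E by [].
    apply: measurableT_comp => //; apply: measurable_fun_limn_esup => n.
    exact/measurable_EFinP/measurableT_comp.
  - move=> x Dx; rewrite limn_einf_lim; apply: lime_ge; first exact: is_cvg_einfs.
    by near=> n; apply: le_ereal_inf_tmp => _ [m _ <-]; rewrite lee_fin f0.
  - apply: filterS fg => x h Dx; rewrite is_cvg_limn_einfE.
      apply/esym/cvg_lim => //; apply/fine_cvgP; split; first exact: nearW.
      exact: h.
    by apply/cvg_ex; exists (g x)%:E; apply/fine_cvgP; split; [exact: nearW|exact: h].
apply: le_trans (fatou _ _ _ _) _ => //.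
  exact: limn_einf_le.
Unshelve. all: by end_near. Qed.

(** The series of the functions is integrable, hence a.e. finite, hence its terms tend to 0: the
    Borel-Cantelli argument in terms of integrals. *)
Lemma ae_cvg0_summable (D : set T) (f : nat -> T -> R) : measurable D ->
  (forall n, measurable_fun D (f n)) -> (forall n x, D x -> 0 <= f n x) ->
  (\sum_(n <oo) \int[mu]_(x in D) (f n x)%:E < +oo)%E ->
  \forall x \ae mu, D x -> f n x @[n --> \oo] --> (0 : R).
Proof.
move=> mD mf f0 fs.
have mF n : measurable_fun D (fun x => (f n x)%:E) by exact/measurable_EFinP.
have f0' n x : D x -> (0 <= (f n x)%:E)%E by move=> Dx; rewrite lee_fin f0.
have : mu.-integrable D (fun x => \sum_(n <oo) (f n x)%:E)%E.
  apply/integrableP; split; first by apply: (@ge0_emeasurable_sum _ _ _ D _ predT) => // n x Dx _; exact: f0'.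
  rewrite (eq_integral (fun x => \sum_(n <oo) (f n x)%:E)%E); last first.
    by move=> x /set_mem Dx; rewrite gee0_abs// nneseries_ge0// => n _ _; exact: f0'.
  by rewrite integral_nneseries.
move/(integrable_ae mD); apply: filterS => x h Dx.
apply: cvg_series_cvg_0.
have /fine_cvgP : (\sum_(0 <= n < k) (f n x)%:E)%E @[k --> \oo] --> (fine (\sum_(n <oo) (f n x)%:E))%:E.
  by rewrite fineK ?h//; apply: is_cvg_nneseries => n _ _; exact: f0'.
case=> _ /cvgP; rewrite (_ : _ \o _ = series (f^~ x))//; apply/funext => k /=.
by rewrite sumEFin /series /=.
Qed.

End measure_tools.

Lemma sqr_cvg0 (R : realType) (a : nat -> R) :
  a n ^+ 2 @[n --> \oo] --> (0 : R) -> a n @[n --> \oo] --> (0 : R).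
Proof.
move=> /cvgr0Pnorm_lt h; apply/cvgr0Pnorm_lt => e e0.
have := h (e ^+ 2) (exprn_gt0 _ e0); apply: filterS => n.
by rewrite normrX ltr_pXn2r// nnegrE// ltW.
Qed.

(** A convergent sequence is bounded, so the increments are dominated by a multiple of q^n and their
    telescoping series converges. *)
Lemma geometric_bound_cvg (R : realType) (u : nat -> R) (q : R) :
  0 <= q < 1 -> ((u n.+1 - u n) / q ^+ n @[n --> \oo] --> (0 : R)) ->
  0 < q -> cvgn u.
Proof.
move=> /andP[q0 q1] /cvgP/cvg_seq_bounded[M0 [_ hM0]] qp.
have {hM0}hM := hM0 (M0 + 1) (ltr_pwDr ltr01 (lexx _)).
have [M' M'0 hM'] : exists2 M', 0 <= M' & forall n, `|u n.+1 - u n| <= M' * q ^+ n.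
  exists `|M0 + 1| => // n; rewrite -ler_pdivrMr ?exprn_gt0//; apply: le_trans (ler_norm _).
  by apply: le_trans (hM n I); rewrite normrM normfV (ger0_norm (exprn_ge0 _ q0)).
have : cvgn (series (telescope u)).
  apply: normed_cvg; apply: (series_le_cvg _ _ hM') => //.
  - by move=> n; apply: mulr_ge0; rewrite ?exprn_ge0.
  - by apply: is_cvg_geometric_series; rewrite ger0_norm.
rewrite /telescope /series/= => h.
suff -> : u = (fun n => (\sum_(0 <= k < n) (u k.+1 - u k)) + u 0%N).
  by apply: is_cvgD => //; exact: is_cvg_cst.
by apply/funext => n; rewrite telescope_sumr// subrK.
Qed.

(** * Completeness of L^2 *)

Section L2_complete.
Context d (T : measurableType d) (R : realType).
Variable mu : {measure set T -> \bar R}.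
Implicit Types u v w : L2 mu.

Lemma L2_subE u v : ((u - v : L2 mu) : T -> R) = (fun x => u x - v x) %[ae mu].
Proof.
have := L2_addE u (- v); have := L2_scaleE (-1) v.
by rewrite scaleN1r; apply: filterS2 => x h1 h2 xT; rewrite h2// h1// mulN1r.
Qed.

Lemma L2dist2E u v : (`|u - v| ^+ 2)%:E = (\int[mu]_x ((u x - v x) ^+ 2)%:E)%E.
Proof.
rewrite L2norm2E; apply: ge0_ae_eq_integral => //.
- by apply/measurable_EFinP/measurable_funX; exact: measurable_L2.
- apply/measurable_EFinP/measurable_funX/measurable_funB; exact: measurable_L2.
- by move=> x _; rewrite lee_fin sqr_ge0.
- by move=> x _; rewrite lee_fin sqr_ge0.
- by apply: filterS (L2_subE u v) => x h xT; rewrite h.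
Qed.

(** The rate 1/4 leaves room: 4^n times the squared increment integrates to at most 4^n 16^(-n) =
    4^(-n), which is summable. So the increments are o(2^(-n)) a.e. and the sequence converges a.e.;
    Fatou turns this into the norm estimate. *)
Lemma L2_fast_cauchy (u : nat -> L2 mu) :
  (forall n, `|u n.+1 - u n| <= (1 / 4) ^+ n) ->
  exists v, forall n, `|v - u n| <= 2 * (1 / 4) ^+ n.
Proof.
move=> hu.
have dist m n : `|u (n + m)%N - u n| <= 2 * (1 / 4) ^+ n.
  (* The subtracted term 2 (1/4)^m is what lets the induction on [m] close. *)
  suff : `|u (n + m)%N - u n| <= (2 - 2 * (1 / 4) ^+ m) * (1 / 4) ^+ n.
    move=> /le_trans; apply; rewrite ler_wpM2r ?exprn_ge0// gerBl mulr_ge0 ?exprn_ge0//.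
  elim: m => [|m IH]; first by rewrite addn0 subrr normr0 expr0 mulr1 subrr mul0r.
  have -> : u (n + m.+1)%N - u n = (u (n + m).+1 - u (n + m)%N) + (u (n + m)%N - u n).
    by rewrite addrA subrK addnS.
  apply: le_trans (ler_normD _ _) _; apply: le_trans (lerD (hu _) IH) _.
  rewrite exprD exprS.
  have p0 : 0 <= (1 / 4 : R) ^+ n by rewrite exprn_ge0.
  have q0 : 0 <= (1 / 4 : R) ^+ m by rewrite exprn_ge0.
  have := mulr_ge0 p0 q0; move: (_ ^+ m) (_ ^+ n) => a b; lra.
pose A n x := 4 ^+ n * (u n.+1 x - u n x) ^+ 2.
have mA n : measurable_fun setT (A n).
  apply: measurable_funM => //; apply: measurable_funX; apply: measurable_funB; exact: measurable_L2.
have A0 n x : setT x -> 0 <= A n x by move=> _; rewrite /A mulr_ge0 ?sqr_ge0 ?exprn_ge0.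
have Aint n : (\int[mu]_x (A n x)%:E <= ((1 / 4) ^+ n)%:E)%E.
  under eq_integral => x _ do rewrite EFinM.
  rewrite ge0_integralZl_EFin ?exprn_ge0//; last 2 first.
  - by move=> x _; rewrite lee_fin sqr_ge0.
  - apply/measurable_EFinP/measurable_funX/measurable_funB; exact: measurable_L2.
  rewrite -L2dist2E -EFinM lee_fin.
  have /(ler_pM (normr_ge0 _) (normr_ge0 _) (hu n)) := hu n.
  rewrite -expr2 => /(ler_wpM2l (exprn_ge0 n (ler0n R 4))) /le_trans; apply.
  by rewrite mulrA -exprMn div1r divff// expr1n mul1r.
have : \forall x \ae mu, setT x -> A n x @[n --> \oo] --> (0 : R).
  apply: ae_cvg0_summable => //.
  apply: (@le_lt_trans _ _ (\sum_(n <oo) ((1 / 4) ^+ n)%:E)%E).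
    by apply: lee_nneseries => // n _ _; rewrite integral_ge0// => x xT; rewrite lee_fin A0.
  have q1 : `|1 / 4 : R| < 1 by rewrite ger0_norm; lra.
  have := @cvg_geometric_series _ (1 : R) _ q1.
  have -> : series (geometric (1 : R) (1 / 4)) = (fun k => \sum_(0 <= n < k) (1 / 4) ^+ n).
    by apply/funext => k; rewrite /series/=; apply: eq_bigr => i _; rewrite [LHS]mul1r.
  move=> h.
  have /cvg_lim -> // : (\sum_(0 <= n < k) ((1 / 4) ^+ n)%:E)%E @[k --> \oo] --> (1 / (1 - 1 / 4) : R)%:E.
    under eq_fun => k do rewrite sumEFin.
    by apply/fine_cvgP; split; [exact: nearW|exact: h].
  exact: ltry.
(* An upper limit is defined and measurable everywhere; a.e. it is the limit. *)
pose f x := fine (limn_esup (fun n => (u n x)%:E)).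
have mf : measurable_fun setT f.
  apply: measurableT_comp => //; apply: measurable_fun_limn_esup => n.
  by apply/measurable_EFinP; exact: measurable_L2.
move=> hA.
have uf : \forall x \ae mu, setT x -> u n x @[n --> \oo] --> f x.
  apply: filterS hA => x h xT.
  have cu : cvgn (fun n => u n x).
    apply: (@geometric_bound_cvg _ _ (1 / 2)); [lra| |lra].
    apply: sqr_cvg0; rewrite (_ : (fun n => _) = (fun n => A n x)); first exact: h.
    apply/funext => n; rewrite /A expr_div_n mulrC -exprM mulnC exprM.
    by rewrite -exprVn; congr (_ ^+ _ * _); rewrite div1r exprVn invrK; ring.
  rewrite /f is_cvg_limn_esupE.
    have /cvg_lim -> // : (u n x)%:E @[n --> \oo] --> (limn (fun n => u n x))%:E.
    by apply/fine_cvgP; split; [exact: nearW|exact: cu].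
  by apply/cvg_ex; exists (limn (fun n => u n x))%:E; apply/fine_cvgP; split; [exact: nearW|exact: cu].
(* Stated for every version [g] of [f]: it serves for [f] itself, to obtain square integrability,
   and then for the class [v]. *)
have key n (g : T -> R) : measurable_fun setT g -> g = f %[ae mu] ->
    (\int[mu]_x ((g x - u n x) ^+ 2)%:E <= ((2 * (1 / 4) ^+ n) ^+ 2)%:E)%E.
  move=> mg gf; apply: (@fatou_le _ _ _ mu setT (fun m x => (u m x - u n x) ^+ 2)) => //.
  - move=> m; apply/measurable_funX/measurable_funB; exact: measurable_L2.
  - by move=> *; rewrite sqr_ge0.
  - by apply/measurable_funX/measurable_funB => //; exact: measurable_L2.
  - by move=> *; rewrite sqr_ge0.
  - apply: filterS2 gf uf => x h1 h2 xT; rewrite h1//.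
    by rewrite expr2; under eq_fun do rewrite expr2; apply: cvgM; apply: cvgB; [exact: h2|exact: cvg_cst|exact: h2|exact: cvg_cst].
  - exists n => // m /= nm; rewrite -L2dist2E lee_fin lerXn2r ?nnegrE ?mulr_ge0 ?exprn_ge0//.
    by rewrite -(subnKC nm); exact: dist.
have [v vf] : exists v, (v : T -> R) = f %[ae mu].
  (* Square integrability is known for the difference of [f] and [u 0], by [key] at n = 0; [u 0] is
     added back afterwards. *)
  have [w wE] : exists w, (w : T -> R) = (fun x => f x - u 0%N x) %[ae mu].
    apply: L2_exists; first by apply: measurable_funB => //; exact: measurable_L2.
    by apply: le_lt_trans (key 0%N f mf (ae_eq_refl _ _ _)) _; rewrite ltry.
  exists (w + u 0%N); apply: filterS2 wE (L2_addE w (u 0%N)) => x h1 h2 xT.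
  by rewrite h2// h1// subrK.
exists v => n; rewrite -(@ler_pXn2r _ 2)// ?nnegrE ?mulr_ge0 ?exprn_ge0//.
by rewrite -lee_fin L2dist2E key//; exact: measurable_L2.
Qed.

End L2_complete.

(** * Dominated convergence and integrals over intervals *)

Section more_integration.
Context d (T : measurableType d) (R : realType).
Variable mu : {measure set T -> \bar R}.

Lemma Rdominated_cvg (D : set T) (f : nat -> T -> R) (g h : T -> R) :
  measurable D -> (forall n, measurable_fun D (f n)) -> measurable_fun D g ->
  (\forall x \ae mu, D x -> f n x @[n --> \oo] --> g x) ->
  mu.-integrable D (EFin \o h) ->
  (forall n x, D x -> `|f n x| <= h x) ->
  \int[mu]_(x in D) f n x @[n --> \oo] --> \int[mu]_(x in D) g x.
Proof.
move=> mD mf mg fg ih fh.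
have [] := @dominated_convergence _ _ _ mu D mD (fun n x => (f n x)%:E)
    (fun x => (g x)%:E) (fun x => (h x)%:E).
- by move=> n; exact/measurable_EFinP.
- exact/measurable_EFinP.
- by apply: filterS fg => x h1 Dx; apply/fine_cvgP; split; [exact: nearW|exact: h1].
- exact: ih.
- by apply: filterE => x n Dx; rewrite lee_fin fh.
move=> ig _ cv; apply: fine_cvg.
by rewrite /Rintegral fineK ?integrable_fin_num.
Qed.

End more_integration.

Section interval_integrals.
Context {R : realType}.
Local Notation leb := (@lebesgue_measure R).

Lemma continuous_integrable_itv (f : R -> R) (a b : R) : continuous f ->
  leb.-integrable `[a, b] (EFin \o f).
Proof.
move=> cf; apply: continuous_compact_integrable; first exact: segment_compact.
exact: continuous_subspaceT.
Qed.

Lemma Rintegral_FTC2 (f F : R -> R) (a b : R) : a <= b -> continuous f ->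
  (forall x : R, is_derive x 1 F (f x)) -> \int[leb]_(x in `[a, b]) f x = F b - F a.
Proof.
rewrite le_eqVlt => /predU1P[<-|ab] cf dF.
  by rewrite set_itv1 Rintegral_set1 subrr.
have cF : continuous F.
  by move=> x; apply/differentiable_continuous/derivable1_diffP; have [] := dF x.
rewrite /Rintegral (@continuous_FTC2 _ f F)//.
- exact: continuous_subspaceT.
- split; first by move=> x _; have [] := dF x.
    by apply: cvg_at_right_filter; exact: cF.
  by apply: cvg_at_left_filter; exact: cF.
- by move=> x _; rewrite derive1E; apply: derive_val.
Qed.

End interval_integrals.

(** * Lebesgue measure on (0,1) and orthonormality of the sines *)

Section unit_interval.
Context {R : realType}.
Local Notation leb := (@lebesgue_measure R).

Lemma leb01_setT : leb01 R setT = 1%E.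
Proof. by rewrite /leb01/= /mrestr setTI lebesgue_measure_itv/= lte_fin ltr01 sube0. Qed.

Lemma leb01_lty (A : set R) : measurable A -> (leb01 R A < +oo)%E.
Proof.
move=> mA; apply: (@le_lt_trans _ _ (leb01 R setT)); last by rewrite leb01_setT ltry.
by apply: le_measure; rewrite ?inE.
Qed.

Lemma leb01_setC : leb01 R (~` `]0, 1[) = 0%E.
Proof. by rewrite /leb01/= /mrestr setICl measure0. Qed.

Lemma integral_leb01 (f : R -> \bar R) : measurable_fun setT f ->
  (\int[leb01 R]_x f x = \int[leb]_(x in `]0%R, 1%R[) f x)%E.
Proof.
move=> mf.
have key (g : R -> \bar R) : measurable_fun setT g -> (forall x, 0 <= g x)%E ->
    (\int[leb01 R]_x g x = \int[leb]_(x in `]0%R, 1%R[) g x)%E.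
  pose I01 : set (measurableTypeR R) := `]0, 1[%classic.
  move=> mg g0; rewrite (@ge0_negligible_integral _ _ _ _ _ (~` I01))//.
  - rewrite setTD setCK; apply: eq_measure_integral => A mA A01.
    by rewrite /leb01/= /mrestr (setIidl A01).
  - by apply: measurableC; exact: measurable_itv.
  - exact: leb01_setC.
by rewrite integralE [RHS]integralE; congr (_ - _)%E; apply: key => //;
  [exact: measurable_funepos|exact: measurable_funeneg].
Qed.

Lemma ae_leb01P (Q : R -> Prop) :
  (\forall x \ae leb01 R, Q x) <-> (\forall x \ae leb, x \in `]0%R, 1%R[ -> Q x).
Proof.
split=> [[A [mA A0 QA]]|[A [mA A0 QA]]].
  exists (A `&` `]0, 1[); split => //; first exact: measurableI.
  by move=> x /= /not_implyP[x01 nQ]; split => //; apply: QA.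
exists (A `|` ~` `]0, 1[); split => //.
- by apply: measurableU => //; exact: measurableC.
- rewrite /leb01/= /mrestr setIUl setICl setU0.
  by apply: (subset_measure0 _ _ _ A0) => //; exact: measurableI.
- move=> x /= nQ; have [x01|x01] := boolP (x \in `]0%R, 1%R[).
    by left; apply: QA => /= h; apply: nQ; exact: h.
  by right => /=; move/negP: x01.
Qed.

Lemma bounded_integrable_leb01 (f : R -> R) (M : R) : measurable_fun setT f ->
  (forall x, `|f x| <= M) -> (leb01 R).-integrable setT (EFin \o f).
Proof.
move=> mf fM; apply: measurable_bounded_integrable => //; first exact: leb01_lty.
exists M; split; first exact: num_real.
by move=> y My x _; apply: le_trans (fM x) (ltW My).
Qed.

Definition sine (k : nat) (x : R) : R := Num.sqrt 2 * sin (k%:R * pi * x).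

Lemma continuous_sin_scale (c : R) : continuous (fun x : R => sin (c * x)).
Proof.
move=> x; apply: (@continuous_comp _ _ _ (fun x : R => c * x)); last exact: continuous_sin.
by apply: cvgM; [exact: cvg_cst|exact: cvg_id].
Qed.

Lemma continuous_cos_scale (c : R) : continuous (fun x : R => cos (c * x)).
Proof.
move=> x; apply: (@continuous_comp _ _ _ (fun x : R => c * x)); last exact: continuous_cos.
by apply: cvgM; [exact: cvg_cst|exact: cvg_id].
Qed.

Lemma continuous_sine k : continuous (sine k).
Proof. by move=> x; apply: cvgM; [exact: cvg_cst|exact: continuous_sin_scale]. Qed.

Lemma measurable_sine k : measurable_fun setT (sine k).
Proof. by apply: continuous_measurable_fun; exact: continuous_sine. Qed.

Lemma sine_le k x : `|sine k x| <= Num.sqrt 2.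
Proof.
by rewrite normrM ger0_norm ?sqrtr_ge0// ler_piMr ?sqrtr_ge0// sin_max.
Qed.

Lemma is_derive_scale (c x : R) : is_derive x 1 (fun x : R => c * x) c.
Proof.
have : is_derive x 1 (c \*: (@id R)) (c *: (1 : R)) by exact: is_deriveZ.
by rewrite /GRing.scale /= mulr1.
Qed.

Lemma is_derive_sin_scale (c x : R) :
  is_derive x 1 (fun x : R => sin (c * x)) (c * cos (c * x)).
Proof.
rewrite mulrC.
exact: (@is_derive1_comp _ sin (fun x => c * x) x _ _ (is_derive_sin _) (is_derive_scale c x)).
Qed.

Lemma is_derive_cos_scale (c x : R) :
  is_derive x 1 (fun x : R => cos (c * x)) (- (c * sin (c * x))).
Proof.
rewrite -mulNr (_ : - c * sin (c * x) = - sin (c * x) * c); last by ring.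
exact: (@is_derive1_comp _ cos (fun x => c * x) x _ _ (is_derive_cos _) (is_derive_scale c x)).
Qed.

Lemma sin_natpi (k : nat) : sin (k%:R * pi : R) = 0.
Proof.
elim: k => [|k IH]; first by rewrite mul0r sin0.
by rewrite -natr1 mulrDl mul1r sinD sinpi IH mul0r mulr0 addr0.
Qed.

Lemma Rintegral_cos (k : nat) : (0 < k)%N ->
  \int[leb]_(x in `[0, 1]) cos (k%:R * pi * x) = 0.
Proof.
move=> k0; have kp : (k%:R * pi : R) != 0.
  by rewrite mulf_neq0 ?pnatr_eq0 ?gt_eqF ?pi_gt0// lt0n.
have dF (x : R) : is_derive x 1 (fun x => (k%:R * pi)^-1 * sin (k%:R * pi * x)) (cos (k%:R * pi * x)).
  have := @is_deriveZ _ _ _ _ (k%:R * pi)^-1 x 1 _ (is_derive_sin_scale (k%:R * pi) x).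
  by rewrite /GRing.scale/= mulrA mulVf ?mul1r.
rewrite (Rintegral_FTC2 ler01 (@continuous_cos_scale _) dF).
by rewrite mulr1 sin_natpi !mulr0 sin0 mulr0 subrr.
Qed.

Lemma Rintegral_leb01 (f : R -> R) : continuous f ->
  \int[leb01 R]_x f x = \int[leb]_(x in `[0, 1]) f x.
Proof.
move=> cf; have mf : measurable_fun setT f by exact: continuous_measurable_fun.
rewrite /Rintegral integral_leb01; last exact/measurable_EFinP.
rewrite integral_itv_obnd_cbnd; last exact/measurable_EFinP/measurable_funTS.
rewrite integral_itv_bndo_bndc//; exact/measurable_EFinP/measurable_funTS.
Qed.

Lemma sineM i j x : sine i x * sine j x =
  cos ((i%:R - j%:R) * pi * x) - cos ((i + j)%:R * pi * x).
Proof.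
have -> : (i%:R - j%:R) * pi * x = i%:R * pi * x - j%:R * pi * x by ring.
have -> : (i + j)%:R * pi * x = i%:R * pi * x + j%:R * pi * x by rewrite natrD; ring.
rewrite cosB cosD /sine.
have : Num.sqrt 2 ^+ 2 = 2 :> R by rewrite sqr_sqrtr.
move: (Num.sqrt 2 : R) (sin _) (sin _) (cos _) (cos _) => c a b e f c2.
transitivity (c ^+ 2 * a * b); first by ring.
by rewrite c2; ring.
Qed.

Lemma sine_orthonormal i j : (0 < i)%N ->
  \int[leb01 R]_x (sine i x * sine j x) = (i == j)%:R.
Proof.
move=> i0; rewrite Rintegral_leb01; last first.
  by move=> x; apply: cvgM; exact: continuous_sine.
under eq_Rintegral do rewrite sineM.
rewrite RintegralB//; last 2 first.
  by apply: continuous_integrable_itv; exact: continuous_cos_scale.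
  by apply: continuous_integrable_itv; exact: continuous_cos_scale.
rewrite [X in _ - X]Rintegral_cos ?subr0 ?addn_gt0 ?i0//.
have [->|ij] := eqVneq i j.
  under eq_Rintegral do rewrite subrr !mul0r cos0.
  rewrite Rintegral_cst//.
  by rewrite /= lebesgue_measure_itv/= lte_fin ltr01 sube0 mulr1.
wlog ji : i j i0 ij / (j < i)%N.
  move=> H; have [/H->//|] := ltnP j i.
  rewrite leq_eqVlt (negbTE ij)/= => ij'.
  under eq_Rintegral => x _ do rewrite -opprB !mulNr cosN.
  by apply: H; rewrite // 1?eq_sym// (leq_ltn_trans _ ij').
under eq_Rintegral do rewrite -natrB ?(ltnW ji)//.
by rewrite Rintegral_cos// subn_gt0.
Qed.

End unit_interval.

(** * Completeness of the sine system *)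

Section sine_completeness.
Context {R : realType}.
Local Notation leb := (@lebesgue_measure R).

(* With an affine function of cos (pi x) for y, these polynomials converge
   boundedly to the indicator function of an interval. *)
Lemma step_powers_cvg1 (y : R) : 0 <= y < 1 / 2 ->
  (1 - y ^+ n) ^+ (2 ^ n) @[n --> \oo] --> (1 : R).
Proof.
move=> /andP[y0 y1]; have y2 : 0 <= 2 * y < 1 by apply/andP; split; lra.
have bern (z : R) k : 0 <= z <= 1 -> 1 - k%:R * z <= (1 - z) ^+ k.
  move=> /andP[z0 z1]; elim: k => [|k IH]; first by rewrite mul0r subr0 expr0.
  rewrite exprSr; apply: (@le_trans _ _ ((1 - k%:R * z) * (1 - z))); last first.
    by rewrite ler_wpM2r// subr_ge0.
  rewrite -natr1; have : 0 <= k%:R * z * z by rewrite !mulr_ge0.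
  move: (k%:R : R) => c; nra.
apply: (@squeeze_cvgr _ _ _ _ (fun n : nat => 1 - (2 * y) ^+ n) (fun=> 1)).
- near=> n; apply/andP; split; last first.
    by rewrite exprn_ile1 ?subr_ge0 ?exprn_ile1 ?gerBl ?exprn_ge0//; lra.
  rewrite exprMn -natrX; apply: bern.
  by rewrite exprn_ge0//= exprn_ile1//; lra.
- rewrite -[X in _ --> X]subr0; apply: cvgB; first exact: cvg_cst.
  by apply: cvg_expr; rewrite ger0_norm; case/andP: y2.
- exact: cvg_cst.
Unshelve. all: by end_near. Qed.

(** With z = y^n one has (1 - z)(1 + z) <= 1, and Bernoulli gives (1 + z)^(2^n) >= 2^n y^n. Hence
    the power is at most (2y)^(-n), where 2y > 1. *)
Lemma step_powers_cvg0 (y : R) : 1 / 2 < y <= 1 ->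
  (1 - y ^+ n) ^+ (2 ^ n) @[n --> \oo] --> (0 : R).
Proof.
move=> /andP[y0 y1].
have bern (z : R) k : 0 <= z -> 1 + k%:R * z <= (1 + z) ^+ k.
  move=> z0; elim: k => [|k IH]; first by rewrite mul0r addr0 expr0.
  rewrite exprSr; apply: (@le_trans _ _ ((1 + k%:R * z) * (1 + z))); last first.
    by rewrite ler_wpM2r// addr_ge0.
  rewrite -natr1; have : 0 <= k%:R * z * z by rewrite !mulr_ge0.
  move: (k%:R : R) => c; nra.
have yn0 n : 0 < y ^+ n by rewrite exprn_gt0//; lra.
have yn1 n : y ^+ n <= 1 by rewrite exprn_ile1//; lra.
have le_inv n : (1 - y ^+ n) ^+ (2 ^ n) <= (1 / (2 * y)) ^+ n.
  have p0 : 0 < (1 + y ^+ n) ^+ (2 ^ n) by rewrite exprn_gt0// addr_gt0.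
  have : (1 - y ^+ n) ^+ (2 ^ n) * (1 + y ^+ n) ^+ (2 ^ n) <= 1.
    by rewrite -exprMn exprn_ile1//; move: (y ^+ n) (yn0 n) (yn1 n) => z; nra.
  rewrite -ler_pdivlMr// div1r => /le_trans; apply.
  rewrite div1r exprVn lef_pV2 ?posrE ?exprn_gt0//; [|by have := yn0 n; lra|lra].
  apply: (le_trans _ (bern _ _ (ltW (yn0 n)))).
  by rewrite exprMn -natrX lerDr.
apply: (@squeeze_cvgr _ _ _ _ (fun=> 0) (fun n : nat => (1 / (2 * y)) ^+ n)).
- by near=> n; rewrite le_inv andbT exprn_ge0// subr_ge0.
- exact: cvg_cst.
- apply: cvg_expr; rewrite ger0_norm ?divr_ge0//; last by lra.
  by rewrite ltr_pdivrMr; lra.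
Unshelve. all: by end_near. Qed.

(** For t and a in [0,1] the base (t - a + 1)/2 lies in [0,1] and crosses 1/2 at t = a, so the
    values at t tend to 1 for t < a and to 0 for t > a. *)
Definition step_poly (a : R) (n : nat) : {poly R} :=
  (1 - ((2^-1)%:P * ('X - a%:P + 1)) ^+ n) ^+ (2 ^ n).

Lemma step_polyE a n t : (step_poly a n).[t] = (1 - ((t - a + 1) / 2) ^+ n) ^+ (2 ^ n).
Proof. by rewrite /step_poly !hornerE (mulrC 2^-1). Qed.

Definition half_cos (x : R) : R := (cos (pi * x) + 1) / 2.

Lemma half_cos01 x : 0 <= half_cos x <= 1.
Proof.
by have := cos_geN1 (pi * x); have := cos_le1 (pi * x); rewrite /half_cos; lra.
Qed.

Lemma half_cos_lt x y : x \in `]0%R, 1%R[ -> y \in `]0%R, 1%R[ ->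
  (half_cos x < half_cos y) = (y < x).
Proof.
rewrite !in_itv/= => /andP[x0 x1] /andP[y0 y1].
have pi0 : 0 < pi :> R := pi_gt0 R.
rewrite /half_cos ltr_pM2r// ltrD2r ltr_cos ?ltr_pM2l//.
  by rewrite in_itv/= mulr_ge0 ?ler_piMr// ltW.
by rewrite in_itv/= mulr_ge0 ?ler_piMr// ltW.
Qed.

Lemma continuous_half_cos : continuous half_cos.
Proof.
move=> x; apply: cvgM; last exact: cvg_cst.
by apply: cvgD; [exact: continuous_cos_scale|exact: cvg_cst].
Qed.

Lemma measurable_H (v : H R) : measurable_fun setT (v : R -> R).
Proof. exact: (measurable_L2 (v : L2 (leb01 R))). Qed.

Lemma integrable_mul_bounded (v : H R) (f : R -> R) (M : R) : measurable_fun setT f ->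
  (forall x, `|f x| <= M) -> (leb01 R).-integrable setT (fun x => (v x * f x)%:E).
Proof.
move=> mf fM.
have mv : measurable_fun setT (v : R -> R) by exact: measurable_H.
have : (leb01 R).-integrable setT (fun x => ((v x ^+ 2)%:E + (M ^+ 2)%:E)%E).
  apply: integrableD => //; first exact: integrable_L2sqr.
  by apply: (@bounded_integrable_leb01 _ (cst (M ^+ 2)) (M ^+ 2)) => // x; rewrite ger0_norm ?sqr_ge0.
apply: le_integrable => //.
  by apply/measurable_EFinP/measurable_funM.
move=> x _ /=; rewrite lee_fin (ger0_norm (addr_ge0 (sqr_ge0 _) (sqr_ge0 _))) normrM.
have := fM x; have := normr_ge0 (f x); have := normr_ge0 (v x).
rewrite -(real_normK (num_real (v x))); move: `|v x| `|f x| => a b a0 b0 bM.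
by have := sqr_ge0 (a - M); have := sqr_ge0 (a - b); nra.
Qed.

(** Multiplying sin (k pi x) by [half_cos] gives a combination of the sines of frequencies k - 1, k
    and k + 1. By induction on the power, orthogonality to all sines extends to their products with
    polynomials in cos (pi x). *)
Lemma sine_moments (v : H R) :
  (forall k, \int[leb01 R]_x (v x * sine k.+1 x) = 0) ->
  forall (p : {poly R}), \int[leb01 R]_x (v x * (sin (pi * x) * p.[half_cos x])) = 0.
Proof.
move=> v0.
pose S (k m : nat) x := sin (k%:R * pi * x) * half_cos x ^+ m.
have mS k m : measurable_fun setT (S k m).
  apply: continuous_measurable_fun => x; apply: cvgM; first exact: continuous_sin_scale.
  elim: m => [|m IH]; first exact: cvg_cst.
  rewrite exprS; under eq_fun do rewrite exprS.
  by apply: cvgM => //; exact: continuous_half_cos.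
have S1 k m x : `|S k m x| <= 1.
  rewrite normrM; apply: mulr_ile1 => //; first exact: sin_max.
  by have /andP[h0 h1] := half_cos01 x; rewrite normrX exprn_ile1// ger0_norm.
have iS k m : (leb01 R).-integrable setT (fun x => (v x * S k m x)%:E).
  exact: (integrable_mul_bounded _ (mS k m) (S1 k m)).
have recS k m x : S k.+1 m.+1 x = 4^-1 * S k.+2 m x + (4^-1 * S k m x + 2^-1 * S k.+1 m x).
  rewrite /S exprSr {2}/half_cos.
  have -> : k.+2%:R * pi * x = k.+1%:R * pi * x + pi * x by rewrite -[k.+2]addn1 natrD; ring.
  have -> : k%:R * pi * x = k.+1%:R * pi * x - pi * x by rewrite -[k.+1]addn1 natrD; ring.
  by rewrite sinD sinB; field.
have Sint m k : \int[leb01 R]_x (v x * S k m x) = 0.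
  elim: m k => [|m IH] [|k].
  - under eq_Rintegral do rewrite /S mul0r mul0r sin0 mul0r mulr0.
    by rewrite Rintegral_cst// mul0r.
  - under eq_Rintegral do rewrite /S expr0 mulr1.
    have s2 : Num.sqrt 2 != 0 :> R by rewrite gt_eqF// sqrtr_gt0.
    rewrite -(mulKf s2 (\int[_]_x _)) -RintegralZl//; last first.
      by have := iS k.+1 0%N; rewrite /S; under eq_fun do rewrite expr0 mulr1.
    under eq_Rintegral do rewrite mulrCA.
    by rewrite v0 mulr0.
  - under eq_Rintegral do rewrite /S mul0r mul0r sin0 mul0r mulr0.
    by rewrite Rintegral_cst// mul0r.
  under eq_Rintegral => x _ do rewrite recS !mulrDr !(mulrCA (v x) _^-1).
  have iSc c k' : (leb01 R).-integrable setT (EFin \o (fun x => c * (v x * S k' m x))).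
    exact: (integrableZl measurableT c (iS k' m)).
  rewrite RintegralD//; last exact: (integrableD measurableT (iSc 4^-1 k) (iSc 2^-1 k.+1)).
  have Sc c k' : \int[leb01 R]_x (c * (v x * S k' m x)) = 0.
    by rewrite (RintegralZl c measurableT (iS k' m)) IH mulr0.
  by rewrite RintegralD// !Sc !addr0.
move=> p.
have E x : v x * (sin (pi * x) * p.[half_cos x]) = \sum_(i < size p) p`_i * (v x * S 1%N i x).
  rewrite horner_coef mulr_sumr mulr_sumr; apply: eq_bigr => i _.
  by rewrite /S mul1r; ring.
under eq_Rintegral do rewrite E.
rewrite /Rintegral; under eq_integral do rewrite -sumEFin.
rewrite integral_sum//; last by move=> i; under eq_fun do rewrite EFinM; exact: integrableZl.
rewrite big1// => i _; under eq_integral do rewrite EFinM.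
rewrite integralZl//; have := Sint i 1%N; rewrite /Rintegral => h.
by rewrite -(fineK (integrable_fin_num _ (iS _ _)))// h mule0.
Qed.

(** The product g of v with sin (pi x) is orthogonal to all polynomials in cos (pi x), hence by
    bounded convergence of [step_poly] to the indicator of every interval (x0, 1). So the primitive
    of g vanishes on (0,1), Lebesgue differentiation gives g = 0 a.e., and sin (pi x) > 0 there. *)
Lemma sine_complete (v : H R) :
  (forall k, \int[leb01 R]_x (v x * sine k.+1 x) = 0) -> v = 0.
Proof.
move=> v0.
have mv : measurable_fun setT (v : R -> R) by exact: measurable_H.
pose g x := v x * sin (pi * x).
have ms : measurable_fun setT (fun x : R => sin (pi * x)).
  by apply: continuous_measurable_fun; exact: continuous_sin_scale.
have mg : measurable_fun setT g by exact: measurable_funM.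
have ig : (leb01 R).-integrable setT (EFin \o g).
  by apply: (integrable_mul_bounded _ ms) => x; exact: sin_max.
have tail (x0 : R) : x0 \in `]0%R, 1%R[ -> \int[leb01 R]_x (g x * (x0 < x)%R%:R) = 0.
  move=> x01.
  have mi : measurable_fun setT (fun x : R => (x0 < x)%R%:R : R).
    rewrite (_ : (fun _ => _) = \1_(`]x0, +oo[ : set R)); first exact: measurable_indic.
    by apply/funext => x; rewrite indicE mem_setE in_itv/= andbT.
  pose q n x := (step_poly (half_cos x0) n).[half_cos x].
  have q01 n x : 0 <= q n x <= 1.
    rewrite /q step_polyE; have := half_cos01 x; have := half_cos01 x0.
    move: (half_cos x) (half_cos x0) => a b ha hb.
    have h1 : 0 <= ((a - b + 1) / 2) ^+ n <= 1.
      by rewrite exprn_ge0 ?exprn_ile1//; lra.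
    by rewrite exprn_ge0 ?exprn_ile1//; lra.
  have mq n : measurable_fun setT (q n).
    apply: continuous_measurable_fun => x.
    apply: (@continuous_comp _ _ _ half_cos (horner (step_poly (half_cos x0) n))).
      exact: continuous_half_cos.
    exact: continuous_horner.
  have : \int[leb01 R]_x (g x * q n x) @[n --> \oo] --> \int[leb01 R]_x (g x * (x0 < x)%R%:R).
    apply: (@Rdominated_cvg _ _ _ (leb01 R) setT (fun n x => g x * q n x) (fun x => g x * (x0 < x)%R%:R) (fun x => `|g x|)) => //.
    - by move=> n; exact: (measurable_funM mg (mq n)).
    - exact: (measurable_funM mg mi).
    - apply/ae_leb01P.
      exists [set x0]; split; [exact: measurable_set1|exact: lebesgue_measure_set1|].
      move=> x /= /not_implyP[xI /not_implyP[_ h]]; apply: contrapT => /eqP xx0; apply: h.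
      apply: cvgM; first exact: cvg_cst.
      rewrite /q; under eq_fun do rewrite step_polyE.
      have := half_cos01 x; have := half_cos01 x0.
      have [xlt|xgt|/eqP] := ltgtP x x0; last by rewrite (negbTE xx0).
      + have := half_cos_lt x01 xI; rewrite xlt => lt1 ha hb.
        by apply: step_powers_cvg0; lra.
      + have := half_cos_lt xI x01; rewrite xgt => lt1 ha hb.
        by apply: step_powers_cvg1; lra.
    - by apply: integrable_norm.
    - by move=> n x _; rewrite normrM ler_piMr// ger0_norm; case/andP: (q01 n x).
  have -> : (fun n => \int[leb01 R]_x (g x * q n x)) = (fun=> 0).
    apply/funext => n; rewrite -[RHS](sine_moments v0 (step_poly (half_cos x0) n)).
    by apply: eq_Rintegral => x _; rewrite /g mulrA.
  by move=> h; apply/esym/(cvg_unique (@Rhausdorff R) (cvg_cst 0) h).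
have tot : \int[leb01 R]_x g x = 0.
  rewrite -[RHS](sine_moments v0 1).
  by apply: eq_Rintegral => x _; rewrite hornerC mulr1.
have half x0 : x0 \in `]0%R, 1%R[ -> \int[leb]_(x in `]-oo, x0]) (g \_ `]0, 1[) x = 0.
  move=> x01; rewrite -Rintegral_mkcondr setIC Rintegral_mkcondr.
  rewrite /Rintegral -integral_leb01; last first.
    by apply/measurable_EFinP; apply/measurable_restrict => //; rewrite setTI; exact: measurable_funTS.
  transitivity (\int[leb01 R]_x (g x - g x * (x0 < x)%R%:R)).
    apply: eq_Rintegral => x _; rewrite patchE mem_setE in_itv/= leNgt.
    by case: (x0 < x); rewrite /= ?mulr1 ?mulr0 ?subrr ?subr0.
  rewrite RintegralB//; first by rewrite tot (tail _ x01) subrr.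
  apply: le_integrable ig => //.
    apply/measurable_EFinP; apply: measurable_funM => //.
    rewrite (_ : (fun _ => _) = \1_(`]x0, +oo[ : set R)); first exact: measurable_indic.
    by apply/funext => x; rewrite indicE mem_setE in_itv/= andbT.
  by move=> x _ /=; rewrite lee_fin normrM ler_piMr//; case: (x0 < x); rewrite ?normr1 ?normr0.
have igR : leb.-integrable setT (EFin \o (g \_ `]0, 1[)).
  rewrite -restrict_EFin; apply/integrable_restrict => //; rewrite setTI.
  apply/integrableP; split; first exact/measurable_EFinP/measurable_funTS.
  move/integrableP: ig => [_]; rewrite integral_leb01//.
  by apply/measurable_EFinP; apply: measurableT_comp.
have aef := ae_filter_ringOfSetsType leb.
have gae : \forall x \ae leb, x \in `]0%R, 1%R[ -> g x = 0.
  have iy (y : R) : leb.-integrable `]-oo, y] (EFin \o (g \_ `]0, 1[)) by exact: integrableS igR.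
  apply: filterS (FTC1Ny iy (open_integrable_locally openT igR)) => x [_ dx] xI; have := dx; rewrite patchE mem_setE xI => <-.
  rewrite derive1E (near_eq_derive (g := cst 0)) ?derive_cst//.
  near=> y; apply: half; near: y; exact: near_in_itvoo.
have gae' : \forall x \ae leb01 R, (x \in `]0%R, 1%R[) /\ g x = 0.
  by apply/ae_leb01P; apply: filterS gae => x h xI; split => //; exact: h.
apply/L2_eqP; apply: filterS2 (L2_zeroE (leb01 R)) gae' => x z0 [xI gx] xT.
rewrite z0//=; move: xI gx; rewrite in_itv/= /g => /andP[x0 x1] /eqP.
rewrite mulf_eq0 => /orP[/eqP//|]; rewrite gt_eqF// sin_gt0_pi// mulr_gt0 ?pi_gt0//=.
by rewrite gtr_pMr ?pi_gt0.
Unshelve. all: by end_near. Qed.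

End sine_completeness.

(** * Coordinates in the sine basis *)

Section sine_basis.
Context {R : realType}.
Local Notation leb := (@lebesgue_measure R).
Implicit Types (u v w : H R) (c : nat -> R) (k m n : nat).

(** Counted from 0: [basis k] is the vector e_(k+1) of the theorem. *)
Definition basis k : H R :=
  xget 0 [set v : H R | (v : R -> R) = sine k.+1 %[ae leb01 R]].

Lemma basisE k : (basis k : R -> R) = sine k.+1 %[ae leb01 R].
Proof.
rewrite /basis; case: xgetP => [v _ //|].
have [v vE] : exists v : L2 (leb01 R), (v : R -> R) = sine k.+1 %[ae leb01 R].
  apply: L2_exists; first exact: measurable_sine.
  apply: integrable_lty => //.
  apply: (@bounded_integrable_leb01 _ (fun x => sine k.+1 x ^+ 2) 2).
    by apply: measurable_funX; exact: measurable_sine.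
  move=> x; rewrite normrX; have := sine_le k.+1 x.
  have : Num.sqrt 2 ^+ 2 = 2 :> R by rewrite sqr_sqrtr.
  by move: (Num.sqrt 2 : R) `|_| (normr_ge0 (sine k.+1 x)) => a b b0 <- ba; nra.
by move=> /(_ v vE).
Qed.

Definition coord v k : R := L2dot (basis k) v.

Lemma coordE v k : coord v k = \int[leb01 R]_x (v x * sine k.+1 x).
Proof.
rewrite /coord L2dotC; apply: (@eq_L2dot _ _ _ (leb01 R) v (basis k) (v : R -> R)).
- exact: measurable_H.
- exact: measurable_sine.
- exact: ae_eq_refl.
- exact: basisE.
Qed.

Lemma basis_orthonormal i j : L2dot (basis i) (basis j) = (i == j)%:R.
Proof.
transitivity (\int[leb01 R]_x (sine i.+1 x * sine j.+1 x)); last exact: sine_orthonormal.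
apply: (@eq_L2dot _ _ _ (leb01 R) (basis i) (basis j)).
- exact: measurable_sine.
- exact: measurable_sine.
- exact: basisE.
- exact: basisE.
Qed.

Lemma coordD u v k : coord (u + v) k = coord u k + coord v k.
Proof. exact: L2dotDr. Qed.

Lemma coordB u v k : coord (u - v) k = coord u k - coord v k.
Proof. exact: L2dotBr. Qed.

Lemma coordZ a v k : coord (a *: v) k = a * coord v k.
Proof. exact: L2dotZr. Qed.

Lemma coord0 k : coord 0 k = 0.
Proof. exact: L2dot0r. Qed.

Lemma coord_sum I (s : seq I) (Q : pred I) (f : I -> H R) k :
  coord (\sum_(i <- s | Q i) f i) k = \sum_(i <- s | Q i) coord (f i) k.
Proof. exact: L2dot_sumr. Qed.

Lemma coord_basis i k : coord (basis i) k = (i == k)%:R.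
Proof. by rewrite /coord basis_orthonormal eq_sym. Qed.

Lemma coord_inj u v : coord u =1 coord v -> u = v.
Proof.
move=> uv; apply/eqP; rewrite -subr_eq0; apply/eqP; apply: sine_complete => k.
by rewrite -coordE coordB uv subrr.
Qed.

Lemma coord_le v k : `|coord v k| <= `|v|.
Proof.
have := L2_CauchySchwarz (basis k : L2 (leb01 R)) v.
suff -> : `|basis k : L2 (leb01 R)| = 1 by rewrite mul1r.
apply/eqP; rewrite -(@eqrXn2 _ 2)// expr1n -L2dotvv.
by rewrite (basis_orthonormal k k) eqxx.
Qed.

Definition synth n c : H R := \sum_(k < n) c k *: basis k.

Lemma coord_synth n c k : coord (synth n c) k = if (k < n)%N then c k else 0.
Proof.
rewrite /synth coord_sum; under eq_bigr do rewrite coordZ coord_basis.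
case: ltnP => [kn|nk].
  rewrite (bigD1 (Ordinal kn))//= eqxx mulr1 big1 ?addr0// => i /eqP ik.
  by case: eqP => [ik'|_]; [case: ik; exact: val_inj|rewrite mulr0].
by rewrite big1// => i _; case: eqP => [ik'|_]; rewrite ?mulr0//; have := ltn_ord i; lia.
Qed.

Lemma dot_synth n c v : L2dot (synth n c) v = \sum_(k < n) c k * coord v k.
Proof.
rewrite L2dotC /synth (L2dot_sumr (index_enum 'I_n) xpredT (fun k : 'I_n => c k *: basis k) v).
by apply: eq_bigr => k _; rewrite L2dotZr /coord L2dotC.
Qed.

Lemma norm_synth n c : `|synth n c| ^+ 2 = \sum_(k < n) c k ^+ 2.
Proof.
have -> : `|synth n c| ^+ 2 = L2dot (synth n c) (synth n c) by rewrite L2dotvv.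
rewrite dot_synth; apply: eq_bigr => k _.
by rewrite coord_synth ltn_ord expr2.
Qed.

Lemma synthB n m c : (m <= n)%N ->
  synth n c - synth m c = synth n (fun k => if (k < m)%N then 0 else c k).
Proof.
move=> mn; apply: coord_inj => k; rewrite coordB !coord_synth.
case: ltnP => kn; case: ltnP => km; rewrite ?subrr ?subr0//.
by have := leq_trans km mn; lia.
Qed.

Lemma H_complete (u : nat -> H R) :
  (forall n, `|u n.+1 - u n| <= (1 / 4) ^+ n) ->
  exists v : H R, forall n, `|v - u n| <= 2 * (1 / 4) ^+ n.
Proof. exact: (@L2_fast_cauchy _ _ _ (leb01 R)). Qed.

(** Along indices [N j] beyond which the tails are at most 16^(-j), the partial sums satisfy the
    hypothesis of [H_complete]. *)
Lemma riesz_fischer c : (\sum_(k <oo) (c k ^+ 2)%:E < +oo)%E ->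
  exists v, coord v =1 c /\ `|v - synth n c| @[n --> \oo] --> (0 : R).
Proof.
move=> cs.
have c0 k : xpredT k -> (0 <= (c k ^+ 2)%:E)%E by rewrite lee_fin sqr_ge0.
have tail := nneseries_tail_cvg cs c0.
have dist m n (e : R) : (\sum_(m <= k <oo) (c k ^+ 2)%:E <= (e ^+ 2)%:E)%E -> 0 <= e ->
    (m <= n)%N -> `|synth n c - synth m c| <= e.
  move=> te e0 mn; rewrite -(@ler_pXn2r _ 2)// ?nnegrE// synthB// norm_synth.
  rewrite -lee_fin (le_trans _ te)//.
  apply: le_trans (@nneseries_lim_ge R (fun k => (c k ^+ 2)%:E) xpredT m n _); last by move=> *; exact: c0.
  rewrite -(big_mkord xpredT (fun k => (if (k < m)%N then 0 else c k) ^+ 2)).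
  rewrite (big_cat_nat _ mn)//= big_nat big1 ?add0r; last by move=> i /andP[_ ->]; rewrite expr0n.
  rewrite sumEFin lee_fin le_eqVlt; apply/orP; left; apply/eqP.
  by apply: eq_big_nat => i /andP[mi _]; rewrite ltnNge mi.
have exN j : exists N, (\sum_(N <= k <oo) (c k ^+ 2)%:E <= (((1 / 4) ^+ j) ^+ 2)%:E)%E.
  have : (0 < (((1 / 4 : R) ^+ j) ^+ 2)%:E)%E by rewrite lte_fin !exprn_gt0.
  move=> e0; have /fine_cvgP[fn] := tail; move=> /cvgr0_norm_le /(_ _ (e0 : 0 < ((1 / 4 : R) ^+ j) ^+ 2)) h.
  near \oo => N; exists N; rewrite -[leLHS]fineK; last by near: N.
  rewrite lee_fin; apply: le_trans (ler_norm _) _.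
  by near: N.
pose N j := projT1 (cid (exN j)).
have NP j : (\sum_(N j <= k <oo) (c k ^+ 2)%:E <= (((1 / 4) ^+ j) ^+ 2)%:E)%E.
  by rewrite /N; case: cid.
have q0 j : 0 <= (1 / 4 : R) ^+ j by rewrite exprn_ge0.
have [v vP] : exists v, forall j, `|v - synth (N j) c| <= 2 * (1 / 4) ^+ j.
  (* [N] may decrease from j to j + 1; then the smaller tail bound of j + 1 is used instead. *)
  apply: H_complete => j; have [le|/ltnW le] := leqP (N j) (N j.+1).
    exact: dist (NP j) _ le.
  rewrite distrC; apply: le_trans (dist _ _ _ (NP j.+1) (q0 _) le) _.
  by rewrite exprS ler_piMl//; lra.
have cv : `|v - synth n c| @[n --> \oo] --> (0 : R).
  apply/cvgr0Pnorm_le => e e0.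
  have : (1 / 4) ^+ j @[j --> \oo] --> (0 : R) by apply: cvg_expr; rewrite ger0_norm; lra.
  move=> /cvgr0_norm_le /(_ (e / 3) (divr_gt0 e0 (ltr0n _ 3)))[j _ /(_ j (leqnn j))].
  rewrite ger0_norm// => je.
  exists (N j) => // n /= jn; rewrite normr_id.
  have := ler_distD (synth (N j) c) v (synth n c).
  have := vP j; have := dist _ _ _ (NP j) (q0 j) jn; rewrite (distrC (synth n c)).
  by move: (`|_|) (`|_|) (`|_|) => a b f; lra.
exists v; split => // k.
apply: (@cvg_unique _ (@Rhausdorff R) (coord v k @[n --> \oo])); first exact: cvg_cst.
have : coord v k - coord (synth n c) k @[n --> \oo] --> (0 : R).
  apply: norm_cvg0; apply: squeeze_cvgr (cvg_cst 0) cv.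
  by near=> n; rewrite normr_ge0/= -coordB coord_le.
move=> h; have : c k + (coord v k - coord (synth n c) k) @[n --> \oo] --> c k + 0.
  by apply: cvgD => //; exact: cvg_cst.
rewrite addr0; apply: cvg_trans.
apply: near_eq_cvg; near=> n => /=; rewrite coord_synth ifT; first by ring.
by near: n; exists k.+1.
Unshelve. all: by end_near. Qed.

(** Pythagoras gives Bessel's inequality. Riesz-Fischer then yields a vector with the coordinates of
    [v] to which the partial sums converge, and completeness of the sines identifies it with [v]. *)
Lemma parseval v : (\sum_(k <oo) (coord v k ^+ 2)%:E)%E = (`|v| ^+ 2)%:E.
Proof.
have pyth n : `|v| ^+ 2 = `|v - synth n (coord v)| ^+ 2 + \sum_(k < n) coord v k ^+ 2.
  rewrite -norm_synth -{1}(subrK (synth n (coord v)) v).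
  rewrite (L2norm2D (v - synth n (coord v) : L2 (leb01 R))).
  rewrite (_ : L2dot _ _ = 0) ?mulr0 ?addr0//.
  rewrite L2dotC dot_synth big1// => k _.
  by rewrite coordB coord_synth ltn_ord subrr mulr0.
have fin : (\sum_(k <oo) (coord v k ^+ 2)%:E <= (`|v| ^+ 2)%:E)%E.
  apply: lime_le; first by apply: is_cvg_nneseries => k _ _; rewrite lee_fin sqr_ge0.
  near=> n; rewrite sumEFin lee_fin big_mkord (pyth n) lerDr sqr_ge0//.
have [w [wv cv]] := riesz_fischer (le_lt_trans fin (ltry _)).
have vw : v = w by exact/esym/coord_inj.
rewrite -vw in cv.
have : \sum_(k < n) coord v k ^+ 2 @[n --> \oo] --> `|v| ^+ 2.
  have -> : (fun n => \sum_(k < n) coord v k ^+ 2) =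
      (fun n => `|v| ^+ 2 - `|v - synth n (coord v)| ^+ 2).
    by apply/funext => n; rewrite (pyth n) addrAC subrr add0r.
  rewrite -[X in _ --> X]subr0; apply: cvgB; first exact: cvg_cst.
  rewrite -(mulr0 (0 : R)); under eq_fun do rewrite expr2.
  by apply: cvgM.
move=> h; apply/cvg_lim => //; under eq_fun do rewrite sumEFin big_mkord.
by apply/fine_cvgP; split; [exact: nearW|exact: h].
Unshelve. all: by end_near. Qed.

End sine_basis.

(** * The Dirichlet Laplacian, its functional calculus and the interpolation spaces *)

Section functional_calculus.
Context {R : realType}.
Local Notation leb := (@lebesgue_measure R).
Implicit Types (u v w : H R) (phi : R -> R) (k n : nat) (r t : R).

(** The eigenvalue of -A at [basis k], with the same shift of index. *)
Definition lam k : R := (k.+1%:R * pi) ^+ 2.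

Lemma lam_ge1 k : 1 <= lam k.
Proof.
rewrite -(expr1n _ 2); apply: lerXn2r; rewrite ?nnegrE ?mulr_ge0 ?pi_ge0//.
apply: (@le_trans _ _ (pi : R)); last by rewrite ler_peMl ?pi_ge0// ler1n.
by apply: le_trans (pi_ge2 _); rewrite ler1n.
Qed.

Lemma lam_gt0 k : 0 < lam k.
Proof. exact: lt_le_trans (lam_ge1 k). Qed.

Lemma dot_cvg u v : \sum_(k < n) coord u k * coord v k @[n --> \oo] --> L2dot u v.
Proof.
have [w [wu]] : exists w, coord w =1 coord u /\ `|w - synth n (coord u)| @[n --> \oo] --> (0 : R).
  by apply: riesz_fischer; rewrite parseval ltry.
have -> : w = u by exact: coord_inj.
move=> cv; under eq_fun do rewrite -dot_synth.
have : L2dot u v - L2dot (synth n (coord u)) v @[n --> \oo] --> (0 : R).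
  apply: norm_cvg0; apply: (@squeeze_cvgr _ _ _ _ (fun=> 0) (fun n => `|u - synth n (coord u)| * `|v|)).
  - near=> n; rewrite normr_ge0/= -L2dotBl.
    exact: (L2_CauchySchwarz (u - synth n (coord u) : L2 (leb01 R)) v).
  - exact: cvg_cst.
  - by rewrite -[X in _ --> X](mul0r `|v|); apply: cvgM => //; exact: cvg_cst.
move=> h; have : L2dot u v - (L2dot u v - L2dot (synth n (coord u)) v) @[n --> \oo] --> L2dot u v - 0.
  by apply: cvgB => //; exact: cvg_cst.
by rewrite subr0; under eq_fun do rewrite subKr.
Unshelve. all: by end_near. Qed.

Lemma continuous_cos_pi k : continuous (fun x : R => Num.sqrt 2 * (k%:R * pi) * cos (k%:R * pi * x)).
Proof. by move=> x; apply: cvgM; [exact: cvg_cst|exact: continuous_cos_scale]. Qed.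

Lemma is_derive_sine k (x : R) :
  is_derive x 1 (sine k) (Num.sqrt 2 * (k%:R * pi) * cos (k%:R * pi * x)).
Proof.
have := @is_deriveZ _ _ _ _ (Num.sqrt 2) x 1 _ (is_derive_sin_scale (k%:R * pi) x).
by rewrite /GRing.scale/= mulrA.
Qed.

Lemma is_derive_cos_pi k (x : R) :
  is_derive x 1 (fun x : R => Num.sqrt 2 * (k%:R * pi) * cos (k%:R * pi * x))
    (- (k%:R * pi) ^+ 2 * sine k x).
Proof.
have := @is_deriveZ _ _ _ _ (Num.sqrt 2 * (k%:R * pi)) x 1 _ (is_derive_cos_scale (k%:R * pi) x).
rewrite /GRing.scale/= (_ : _ * - _ = - (k%:R * pi) ^+ 2 * sine k x)// /sine; ring.
Qed.

Lemma basis_eigen k : dirichlet_laplacian (basis k) (- lam k *: basis k).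
Proof.
exists (sine k.+1), (fun x => Num.sqrt 2 * (k.+1%:R * pi) * cos (k.+1%:R * pi * x)).
split.
- exact: basisE.
- move=> x; rewrite in_itv/= => /andP[x0 x1].
  rewrite (Rintegral_FTC2 x0 (@continuous_cos_pi k.+1) (@is_derive_sine k.+1)).
  by rewrite addrC subrK.
- move=> x; rewrite in_itv/= => /andP[x0 x1].
  have cf : continuous (fun y : R => - lam k * sine k.+1 y).
    by move=> y; apply: cvgM; [exact: cvg_cst|exact: continuous_sine].
  transitivity (Num.sqrt 2 * (k.+1%:R * pi) * cos (k.+1%:R * pi * 0) +
      \int[leb]_(y in `[0, x]) (- lam k * sine k.+1 y)).
    by rewrite (Rintegral_FTC2 x0 cf (@is_derive_cos_pi k.+1)) addrC subrK.
  congr (_ + fine _); apply: ae_eq_integral => //.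
  + by apply/measurable_EFinP/measurable_funTS; exact: (continuous_measurable_fun cf).
  + by apply/measurable_EFinP/measurable_funTS; exact: measurable_H.
  + have aef := ae_filter_ringOfSetsType leb.
    have h1 : \forall y \ae leb01 R, ((- lam k *: basis k : H R) : R -> R) y = - lam k * sine k.+1 y.
      have /= h2 := L2_scaleE (- lam k) (basis k : L2 (leb01 R)).
      by apply: filterS2 h2 (basisE k) => y /(_ Logic.I) e1 /(_ Logic.I) <-.
    move/ae_leb01P : h1 => h1.
    (* The a.e. identity is known on (0,1); the end points 0 and 1 are null. *)
    have n0 : \forall y \ae leb, y != 0.
      by exists [set 0]; split => //; [exact: lebesgue_measure_set1|move=> y /= /negP/negPn/eqP].
    have n1 : \forall y \ae leb, y != 1.
      by exists [set 1]; split => //; [exact: lebesgue_measure_set1|move=> y /= /negP/negPn/eqP].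
    apply: filterS3 h1 n0 n1 => y h1 y0 y1 /=.
    rewrite in_itv/= => /andP[yy0 yx]; rewrite /Hval in h1 *; rewrite h1// in_itv/=.
    by rewrite lt_neqAle eq_sym y0 yy0/= lt_neqAle y1 (le_trans yx).
- by split; rewrite /sine ?mulr0 ?sin0 ?mulr0// mulr1 sin_natpi mulr0.
Qed.

Lemma integrable_H01 v : leb.-integrable `[0, 1] (EFin \o v).
Proof.
have mv := measurable_H v.
apply/integrableP; split; first exact/measurable_EFinP/measurable_funTS.
have : (leb01 R).-integrable setT (fun x => (v x * 1)%:E).
  by apply: (@integrable_mul_bounded _ v (cst 1) 1) => // x; rewrite normr1.
move=> /integrableP[_]; under eq_integral do rewrite mulr1.
have mn : measurable_fun setT (fun x => `|(v x)%:E|%E).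
  by apply: measurableT_comp => //; exact/measurable_EFinP.
rewrite integral_leb01//; apply: le_lt_trans.
have mn1 (A : set R) : measurable_fun A (fun x => `|v x|).
  by apply: measurable_funTS; apply: measurableT_comp.
rewrite /= integral_itv_obnd_cbnd; last exact/measurable_EFinP.
by rewrite integral_itv_bndo_bndc//; exact/measurable_EFinP.
Qed.

Lemma primitive_continuous (h f : R -> R) c : leb.-integrable `[0, 1] (EFin \o h) ->
  (forall x, x \in `[0, 1] -> f x = c + \int[leb]_(y in `[0, x]) h y) ->
  {within `[0, 1], continuous f}.
Proof.
move=> ih fE; pose F1 : R -> R := fun x => c + \int[leb]_(y in `[0, x]) h y.
have cF1 : {within `[0, 1], continuous F1}.
  move=> x; apply: cvgD; first exact: cvg_cst.
  exact: (@parameterized_integral_continuous _ 0 1 h ler01 ih).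
apply: subspace_eq_continuous cF1 => x.
by rewrite inE/= => xI; apply/esym/fE.
Qed.

Lemma primitive_is_derive (h f : R -> R) c (x : R) : leb.-integrable `[0, 1] (EFin \o h) ->
  (forall x, x \in `[0, 1] -> f x = c + \int[leb]_(y in `[0, x]) h y) ->
  x \in `]0, 1[ -> {for x, continuous h} -> is_derive x 1 f (h x).
Proof.
move=> ih fE xI ch; have := xI; rewrite in_itv/= => /andP[x0 x1].
have [d1 d2] := @continuous_FTC1_closed _ h 0 x 1 x1 ih x0 ch.
pose F1 : R -> R := fun x => c + \int[leb]_(y in `[0, x]) h y.
apply: (@near_eq_is_derive _ _ _ F1).
  near=> y; rewrite fE//; apply: subset_itv_oo_cc; near: y; exact: near_in_itvoo.
rewrite -[h x]add0r; apply: is_deriveD.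
apply: (DeriveDef d1); by rewrite -derive1E.
Unshelve. all: by end_near. Qed.

Lemma integral_within01 (F f : R -> R) : {within `[0, 1], continuous F} ->
  {within `[0, 1], continuous f} ->
  (forall x : R, x \in `]0, 1[ -> is_derive x 1 F (f x)) ->
  \int[leb]_(x in `[0, 1]) f x = F 1 - F 0.
Proof.
move=> cF cf dF; rewrite /Rintegral (@continuous_FTC2 _ f F)//.
- have [_ F0 F1] := (continuous_within_itvP F (@ltr01 R)).1 cF.
  by split => // x /dF[].
- by move=> x /dF dx; rewrite derive1E; apply: derive_val.
Qed.

Lemma Rintegral_leb01_H v (s : R -> R) : continuous s ->
  \int[leb01 R]_x (v x * s x) = \int[leb]_(x in `[0, 1]) (v x * s x).
Proof.
move=> cs; have ms : measurable_fun setT s by exact: continuous_measurable_fun.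
have m := measurable_funM (measurable_H v) ms.
rewrite /Rintegral integral_leb01; last exact/measurable_EFinP.
rewrite integral_itv_obnd_cbnd; last exact/measurable_EFinP/measurable_funTS.
by rewrite integral_itv_bndo_bndc//; exact/measurable_EFinP/measurable_funTS.
Qed.

Lemma ae01 (Q : R -> Prop) :
  (\forall x \ae leb01 R, Q x) -> \forall x \ae leb, x \in `[0, 1] -> Q x.
Proof.
move=> /ae_leb01P h1; have aef := ae_filter_ringOfSetsType leb.
have n0 (z : R) : \forall y \ae leb, y != z.
  by exists [set z]; split => //; [exact: lebesgue_measure_set1|move=> y /= /negP/negPn/eqP].
apply: filterS3 h1 (n0 0) (n0 1) => y h1 y0 y1 /=.
rewrite in_itv/= => /andP[yy0 yx]; apply: h1; rewrite in_itv/=.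
by rewrite lt_neqAle eq_sym y0 yy0/= lt_neqAle y1.
Qed.

(** Green's identity: with s a sine and f, g as in the graph of A, the derivative of g s - f s' is
    (m + lam) f s, and the boundary terms vanish because f and s do. So an eigenvector for m has
    nonzero coordinates only where lam = -m. *)
Lemma eigen_coord u (m : R) k : dirichlet_laplacian u (m *: u) ->
  (m + lam k) * coord u k = 0.
Proof.
move=> [f [g [uf fE gE [f0 f1]]]].
have cg := primitive_continuous (integrable_H01 (m *: u)) gE.
have ig : leb.-integrable `[0, 1] (EFin \o g).
  by apply: continuous_compact_integrable => //; exact: segment_compact.
have cf := primitive_continuous ig fE.
have cg_in : {in `]0, 1[, continuous g} by have [] := (continuous_within_itvP g (@ltr01 R)).1 cg.
have ifi : leb.-integrable `[0, 1] (EFin \o f).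
  by apply: continuous_compact_integrable => //; exact: segment_compact.
have cf_in : {in `]0, 1[, continuous f} by have [] := (continuous_within_itvP f (@ltr01 R)).1 cf.
have df (x : R) : x \in `]0, 1[ -> is_derive x 1 f (g x).
  by move=> xI; exact: (primitive_is_derive ig fE xI (cg_in _ xI)).
have aef := ae_filter_ringOfSetsType leb.
have uf' : \forall y \ae leb, y \in `[0, 1] -> ((m *: u : H R) : R -> R) y = m * f y.
  have h1 : \forall y \ae leb01 R, ((m *: u : H R) : R -> R) y = m * f y.
    have /= h2 := L2_scaleE m (u : L2 (leb01 R)).
    by apply: filterS2 h2 uf => y /(_ Logic.I) e1 /(_ Logic.I) <-.
  exact: ae01.
have imf : leb.-integrable `[0, 1] (EFin \o (fun y => m * f y)).
  apply: continuous_compact_integrable; first exact: segment_compact.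
  by move=> x; apply: cvgM; [exact: cvg_cst|exact: cf].
(* Bootstrapping: [m *: u] is replaced by its continuous version m f, which makes g differentiable
   at every interior point. *)
have gE' x : x \in `[0, 1] -> g x = g 0 + \int[leb]_(y in `[0, x]) (m * f y).
  move=> xI; rewrite gE//; congr (_ + fine _).
  have sub : `[0, x] `<=` `[0, 1].
    by move: xI; rewrite in_itv/= => /andP[_ x1]; apply: subset_itvl; rewrite bnd_simp.
  apply: ae_eq_integral => //.
  - by apply/measurable_EFinP/measurable_funTS; exact: measurable_H.
  - by apply: measurable_funS (measurable_int _ imf).
  - by apply: filterS uf' => y h /= yI; rewrite h//; exact: (sub y yI).
have dg (x : R) : x \in `]0, 1[ -> is_derive x 1 g (m * f x).
  move=> xI; apply: (primitive_is_derive imf gE' xI).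
  by apply: cvgM; [exact: cvg_cst|exact: (cf_in x xI)].
pose s : R -> R := sine k.+1.
pose s' : R -> R := fun x : R => Num.sqrt 2 * (k.+1%:R * pi) * cos (k.+1%:R * pi * x).
have cs : {within `[0, 1], continuous s} by apply: continuous_subspaceT; exact: continuous_sine.
have cs' : {within `[0, 1], continuous s'} by apply: continuous_subspaceT; exact: continuous_cos_pi.
have ibp : \int[leb]_(x in `[0, 1]) ((m + lam k) * (f x * s x)) = 0.
  pose Phi x := g x * s x - f x * s' x.
  pose phi x := (m + lam k) * (f x * s x).
  have cPhi : {within `[0, 1], continuous Phi}.
    by move=> x; apply: cvgB; apply: cvgM; [exact: cg|exact: cs|exact: cf|exact: cs'].
  have cphi : {within `[0, 1], continuous phi}.
    move=> x; apply: cvgM; first exact: cvg_cst.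
    by apply: cvgM; [exact: cf|exact: cs].
  have dPhi (x : R) : x \in `]0, 1[ -> is_derive x 1 Phi (phi x).
    move=> xI.
    have h1 := @is_deriveM _ _ _ _ _ _ _ _ (dg x xI) (@is_derive_sine k.+1 x).
    have h2 := @is_deriveM _ _ _ _ _ _ _ _ (df x xI) (@is_derive_cos_pi k.+1 x).
    have := is_deriveB h1 h2; rewrite /GRing.scale/=.
    by move=> h3; apply: (is_derive_eq h3); rewrite /phi /lam /s; ring.
  rewrite (integral_within01 cPhi cphi dPhi) /Phi.
  by rewrite f0 f1 /s /sine !mulr0 sin0 mulr1 sin_natpi !mulr0 !mul0r !subr0.
rewrite coordE Rintegral_leb01_H; last exact: continuous_sine.
have <- : \int[leb]_(x in `[0, 1]) (f x * s x) = \int[leb]_(x in `[0, 1]) (u x * s x).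
  have msn : measurable_fun (`[0, 1] : set R) s by apply: measurable_funTS; exact: measurable_sine.
  congr fine; apply: ae_eq_integral => //.
  - apply/measurable_EFinP/measurable_funM => //.
    by apply/measurable_EFinP; exact: measurable_int ifi.
  - by apply/measurable_EFinP/measurable_funM => //; apply: measurable_funTS; exact: measurable_H.
  - by apply: filterS (ae01 uf) => y h /= yI; rewrite h.
rewrite -RintegralZl//; apply: continuous_compact_integrable; first exact: segment_compact.
by move=> x; apply: cvgM; [exact: cf|exact: cs].
Qed.

(** The graph condition quantifies over all eigenvectors; by [eigen_coord] an eigenvector for m
    involves only basis vectors with the same eigenvalue, so the basis decides it. *)
Lemma fcalc_graphP phi v w :
  fcalc_graph phi v w <-> forall k, coord w k = phi (- lam k) * coord v k.
Proof.
split=> [h k|h m u um]; first exact/h/basis_eigen.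
have h2 : \sum_(k < n) coord u k * coord w k @[n --> \oo] --> phi m * L2dot u v; last first.
  by rewrite -(cvg_lim (@Rhausdorff R) (@dot_cvg u w)); apply: cvg_lim.
have -> : (fun n => \sum_(k < n) coord u k * coord w k) =
    (fun n => phi m * \sum_(k < n) coord u k * coord v k).
  apply/funext => n; rewrite mulr_sumr; apply: eq_bigr => k _; rewrite h.
  have /eqP := eigen_coord k um; rewrite mulf_eq0 => /orP[|/eqP->]; last by rewrite !mul0r mulr0.
  by rewrite addr_eq0 => /eqP ->; rewrite mulrCA.
by apply: cvgM; [exact: cvg_cst|exact: dot_cvg].
Qed.

Lemma fcalc_domP phi v : fcalc_dom phi v <->
  (\sum_(k <oo) ((phi (- lam k) * coord v k) ^+ 2)%:E < +oo)%E.
Proof.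
split=> [[w /fcalc_graphP vw]|/riesz_fischer[w [wc _]]].
  by under eq_eseriesr do rewrite -vw; rewrite parseval ltry.
by exists w; apply/fcalc_graphP.
Qed.

Lemma coord_fcalc phi v k : fcalc_dom phi v ->
  coord (fcalc phi v) k = phi (- lam k) * coord v k.
Proof.
move=> [w vw]; move: k; apply/fcalc_graphP.
by rewrite /fcalc; case: xgetP => // /(_ w vw).
Qed.

Lemma heat_dom t v : 0 <= t -> fcalc_dom (fun m => expR (t * m)) v.
Proof.
move=> t0; apply/fcalc_domP; apply: le_lt_trans (ltry (`|v| ^+ 2)).
rewrite -parseval; apply: lee_nneseries => k _; first by rewrite lee_fin sqr_ge0.
rewrite lee_fin exprMn ler_piMl ?sqr_ge0// exprn_ile1 ?expR_ge0//.
by rewrite -expR0 ler_expR mulrN oppr_le0 mulr_ge0// ltW// lam_gt0.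
Qed.

Lemma coord_heat t v k : 0 <= t ->
  coord (heat t v) k = expR (- (t * lam k)) * coord v k.
Proof. by move=> t0; rewrite coord_fcalc ?mulrN//; exact: heat_dom. Qed.

(** The squared norm of H_r as an extended real, meaningful also for [v] outside H_r. *)
Definition hsum r v : \bar R := (\sum_(k <oo) ((lam k `^ r * coord v k) ^+ 2)%:E)%E.

Definition opow r v : H R := fcalc (fun m => (- m) `^ r) v.

Lemma HrP r v : Hr r v <-> (hsum r v < +oo)%E.
Proof. by rewrite /Hr fcalc_domP /hsum; under eq_eseriesr do rewrite opprK. Qed.

Lemma coord_opow r v k : Hr r v -> coord (opow r v) k = lam k `^ r * coord v k.
Proof. by move=> vr; rewrite coord_fcalc ?opprK. Qed.

Lemma Hr_normE r v : Hr_norm r v = `|opow r v|. Proof. by []. Qed.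

Lemma Hr_norm_ge0 r v : 0 <= Hr_norm r v. Proof. exact: normr_ge0. Qed.

Lemma hsumE r v : Hr r v -> hsum r v = (Hr_norm r v ^+ 2)%:E.
Proof.
move=> vr; rewrite Hr_normE -parseval; apply: eq_eseriesr => k _.
by rewrite coord_opow.
Qed.

Lemma HrZD r a u v : Hr r u -> Hr r v ->
  Hr r (a *: u + v) /\ opow r (a *: u + v) = a *: opow r u + opow r v.
Proof.
move=> ur vr.
have g : fcalc_graph (fun m => (- m) `^ r) (a *: u + v) (a *: opow r u + opow r v).
  by apply/fcalc_graphP => k; rewrite !coordD !coordZ !coord_opow// opprK; ring.
have h : Hr r (a *: u + v) by exists (a *: opow r u + opow r v).
split => //; apply: coord_inj => k.
by rewrite coord_opow// !coordD !coordZ !coord_opow//; ring.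
Qed.

Lemma HrD r u v : Hr r u -> Hr r v -> Hr r (u + v).
Proof. by move=> ur vr; have [] := HrZD 1 ur vr; rewrite scale1r. Qed.

Lemma HrB r u v : Hr r u -> Hr r v -> Hr r (u - v).
Proof. by move=> ur vr; have [] := HrZD (-1) vr ur; rewrite scaleN1r addrC. Qed.

Lemma Hr_normD r u v : Hr r u -> Hr r v -> Hr_norm r (u + v) <= Hr_norm r u + Hr_norm r v.
Proof.
move=> ur vr; have [_] := HrZD 1 ur vr; rewrite !scale1r !Hr_normE => ->.
exact: ler_normD.
Qed.

Lemma Hr_normB r u v : Hr r u -> Hr r v -> Hr_norm r (u - v) <= Hr_norm r u + Hr_norm r v.
Proof.
move=> ur vr; have [_] := HrZD (-1) vr ur; rewrite !scaleN1r !Hr_normE addrC => ->.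
by rewrite addrC; exact: ler_normB.
Qed.

(** Every eigenvalue is at least 1, so its powers increase with the exponent. *)
Lemma Hr_mono r s v : s <= r -> Hr r v -> Hr s v /\ Hr_norm s v <= Hr_norm r v.
Proof.
move=> sr vr.
have le : (hsum s v <= hsum r v)%E.
  apply: lee_nneseries => k _; first by rewrite lee_fin sqr_ge0.
  rewrite lee_fin !exprMn ler_wpM2r ?sqr_ge0// lerXn2r ?nnegrE ?powR_ge0//.
  by rewrite ler_powR// lam_ge1.
have vs : Hr s v by apply/HrP/(le_lt_trans le)/HrP.
split => //; rewrite -(@ler_pXn2r _ 2)// ?nnegrE ?Hr_norm_ge0//.
by rewrite -lee_fin -!hsumE.
Qed.

Lemma norm_le_Hr r v : 0 <= r -> Hr r v -> `|v| <= Hr_norm r v.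
Proof.
move=> r0 vr; rewrite -(@ler_pXn2r _ 2)// ?nnegrE ?Hr_norm_ge0//.
rewrite -lee_fin -hsumE// -parseval; apply: lee_nneseries => k _; first by rewrite lee_fin sqr_ge0.
rewrite lee_fin exprMn ler_peMl ?sqr_ge0// exprn_ege1//.
by rewrite -(powRr0 (lam k)) ler_powR// lam_ge1.
Qed.

Lemma Hr_synth r n c : Hr r (synth n c).
Proof.
exists (synth n (fun k => lam k `^ r * c k)); apply/fcalc_graphP => k.
by rewrite !coord_synth opprK; case: ltnP; rewrite ?mulr0.
Qed.

End functional_calculus.

(** * Almost everywhere convergent subsequences *)

Section subsequences.
Context d (T : measurableType d) (R : realType).
Variable mu : {measure set T -> \bar R}.

(** [phi i] is an index with integral at most 2^(-i). The bound i <= phi i is what later carries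
    eventual properties along the subsequence. *)
Lemma ae_subseq_cvg0 (D : set T) (f : nat -> T -> R) : measurable D ->
  (forall n, measurable_fun D (f n)) -> (forall n x, D x -> 0 <= f n x) ->
  (\int[mu]_(x in D) (f n x)%:E)%E @[n --> \oo] --> 0%E ->
  exists phi : nat -> nat, (forall i, (i <= phi i)%N) /\
    \forall x \ae mu, D x -> f (phi i) x @[i --> \oo] --> (0 : R).
Proof.
move=> mD mf f0 fc.
have ex i : exists n, (i <= n)%N /\ (\int[mu]_(x in D) (f n x)%:E <= ((1 / 2) ^+ i)%:E)%E.
  have /fine_cvgP[fn] := fc.
  have e0 : 0 < (1 / 2 : R) ^+ i by rewrite exprn_gt0.
  move=> /cvgr0_norm_le /(_ _ e0) h.
  near \oo => n; exists n; split; first by near: n; exists i.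
  rewrite -[leLHS]fineK; last by near: n.
  by rewrite lee_fin; apply: le_trans (ler_norm _) _; near: n.
pose phi i := projT1 (cid (ex i)).
have phiP i : (i <= phi i)%N /\ (\int[mu]_(x in D) (f (phi i) x)%:E <= ((1 / 2) ^+ i)%:E)%E.
  by rewrite /phi; case: cid.
exists phi; split; first by move=> i; have [] := phiP i.
apply: ae_cvg0_summable => //; first by move=> n x; exact: f0.
apply: (@le_lt_trans _ _ (\sum_(n <oo) ((1 / 2) ^+ n)%:E)%E).
  apply: lee_nneseries => n _ *; last by have [] := phiP n.
  by rewrite integral_ge0// => x Dx; rewrite lee_fin f0.
have q1 : `|1 / 2 : R| < 1 by rewrite ger0_norm; lra.
have h := @cvg_geometric_series _ (1 : R) _ q1.
have /cvg_lim -> // : (\sum_(0 <= n < k) ((1 / 2) ^+ n)%:E)%E @[k --> \oo] --> (1 / (1 - 1 / 2) : R)%:E.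
  under eq_fun => k do rewrite sumEFin.
  apply/fine_cvgP; split; first exact: nearW.
  apply: cvg_trans h; apply: near_eq_cvg; near=> k => /=.
  by rewrite /series/=; apply: eq_bigr => i _; rewrite [LHS]mul1r.
exact: ltry.
Unshelve. all: by end_near. Qed.

Lemma L2_cvg_ae (u : nat -> L2 mu) (v : L2 mu) :
  `|v - u n| @[n --> \oo] --> (0 : R) ->
  exists phi : nat -> nat, (forall i, (i <= phi i)%N) /\
    \forall x \ae mu, u (phi i) x @[i --> \oo] --> v x.
Proof.
move=> cv.
have [|||phi [phii h]] := @ae_subseq_cvg0 setT (fun n x => (v x - u n x) ^+ 2) measurableT.
- by move=> n; apply/measurable_funX/measurable_funB; exact: measurable_L2.
- by move=> *; rewrite sqr_ge0.
- under eq_fun do rewrite -L2dist2E.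
  apply/fine_cvgP; split; first exact: nearW.
  rewrite -[X in _ --> X](mulr0 (0 : R)) /=; under eq_fun do rewrite /= expr2.
  exact: cvgM.
exists phi; split => //; apply: filterS h => x /(_ I) /sqr_cvg0 h.
have : v x - (v x - u (phi i) x) @[i --> \oo] --> v x - 0 by apply: cvgB => //; exact: cvg_cst.
by under eq_fun do rewrite subKr; rewrite subr0.
Qed.

End subsequences.

(** * Power mean inequalities *)

Section power_means.
Context {R : realType}.
Implicit Types a b s t : R.

(** Jensen for the sixth power with weights s and t, applied to a/s and b/t: the square case [h2]
    followed by the cube case [h3]. *)
Lemma power_mean6_2 a b s t : 0 < s -> 0 < t ->
  (a + b) ^+ 6 <= (s + t) ^+ 5 * (a ^+ 6 / s ^+ 5 + b ^+ 6 / t ^+ 5).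
Proof.
move=> s0 t0; pose u := a / s; pose v := b / t.
have s0' := ltW s0; have t0' := ltW t0.
have -> : a = s * u by rewrite /u mulrCA divff ?mulr1// gt_eqF.
have -> : b = t * v by rewrite /v mulrCA divff ?mulr1// gt_eqF.
have -> : (s * u) ^+ 6 / s ^+ 5 = s * u ^+ 6 by field; rewrite gt_eqF.
have -> : (t * v) ^+ 6 / t ^+ 5 = t * v ^+ 6 by field; rewrite gt_eqF.
have h2 : (s * u + t * v) ^+ 2 <= (s + t) * (s * u ^+ 2 + t * v ^+ 2).
  rewrite -subr_ge0 (_ : _ - _ = s * t * (u - v) ^+ 2); last by ring.
  by rewrite mulr_ge0 ?sqr_ge0// mulr_ge0.
have h3 : (s * u ^+ 2 + t * v ^+ 2) ^+ 3 <= (s + t) ^+ 2 * (s * u ^+ 6 + t * v ^+ 6).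
  rewrite -subr_ge0 (_ : _ - _ = s * t * (u ^+ 2 - v ^+ 2) ^+ 2 *
    ((2 * s + t) * u ^+ 2 + (s + 2 * t) * v ^+ 2)); last by ring.
  apply: mulr_ge0; first by rewrite mulr_ge0 ?sqr_ge0// mulr_ge0.
  by apply: addr_ge0; apply: mulr_ge0; rewrite ?sqr_ge0//; lra.
have st0 : 0 <= s + t by rewrite addr_ge0.
have -> : (s * u + t * v) ^+ 6 = ((s * u + t * v) ^+ 2) ^+ 3 by rewrite -exprM.
apply: (@le_trans _ _ (((s + t) * (s * u ^+ 2 + t * v ^+ 2)) ^+ 3)).
  by rewrite lerXn2r ?nnegrE ?sqr_ge0// mulr_ge0// addr_ge0// mulr_ge0 ?sqr_ge0.
rewrite exprMn -[5%N]/(3 + 2)%N exprD -[leRHS]mulrA.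
by apply: ler_wpM2l; rewrite ?exprn_ge0.
Qed.

(** Hoelder with exponents 6 and 6/5 and free weights; geometric weights will sum dyadic blocks. *)
Lemma power_mean6 n (a w : nat -> R) : (forall j, 0 < w j) ->
  (\sum_(j < n) a j) ^+ 6 <= (\sum_(j < n) w j) ^+ 5 * \sum_(j < n) a j ^+ 6 / w j ^+ 5.
Proof.
move=> w0; case: n => [|n]; first by rewrite !big_ord0 !expr0n mul0r.
elim: n => [|n IH].
  rewrite !big_ord1 mulrCA mulfV ?mulr1//.
  by rewrite gt_eqF// exprn_gt0.
rewrite big_ord_recr/= [X in _ <= X ^+ 5 * _]big_ord_recr/= [X in _ <= _ * X]big_ord_recr/=.
set A := \sum_(j < n.+1) a j in IH *; set W := \sum_(j < n.+1) w j in IH *.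
set B := \sum_(j < n.+1) _ in IH *.
have W0 : 0 < W by rewrite /W big_ord_recl ltr_pwDl// sumr_ge0// => *; exact: ltW.
apply: le_trans (power_mean6_2 A (a n.+1) W0 (w0 n.+1)) _.
have W1 : 0 <= W + w n.+1 by rewrite addr_ge0 ?ltW.
apply: ler_wpM2l; first by rewrite exprn_ge0.
by rewrite lerD2r ler_pdivrMr ?exprn_gt0// mulrC.
Qed.

Lemma sum_sqr_le (r : seq nat) (a : nat -> R) :
  (\sum_(k <- r) a k) ^+ 2 <= (size r)%:R * \sum_(k <- r) a k ^+ 2.
Proof.
elim: r => [|x r IH]; first by rewrite !big_nil expr0n mul0r.
rewrite !big_cons /= -natr1; have : 0 <= (size r)%:R :> R by [].
(* Expanding this sum supplies the cross terms of the induction step. *)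
have : 0 <= \sum_(k <- r) (a k - a x) ^+ 2 by rewrite sumr_ge0// => *; rewrite sqr_ge0.
have -> : \sum_(k <- r) (a k - a x) ^+ 2 = \sum_(k <- r) a k ^+ 2 - 2 * a x * (\sum_(k <- r) a k)
    + (size r)%:R * a x ^+ 2.
  elim: r {IH} => [|y r IH]; first by rewrite !big_nil mul0r mulr0 subrr addr0.
  by rewrite !big_cons IH /= -natr1; ring.
move: IH; move: (\sum_(k <- r) a k) (\sum_(k <- r) _) => S Q; nra.
Qed.

End power_means.

Lemma synthE (R : realType) n (c : nat -> R) :
  (synth n c : R -> R) = (fun x => \sum_(k < n) c k * sine k.+1 x) %[ae leb01 R].
Proof.
have aef := ae_filter_ringOfSetsType (leb01 R).
elim: n => [|n IH].
  rewrite /synth; apply: filterS (L2_zeroE (leb01 R)) => x h xT.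
  by rewrite !big_ord0 /Hval h.
have -> : synth n.+1 c = synth n c + c n *: basis n by rewrite /synth big_ord_recr.
have h1 := L2_addE (synth n c : L2 (leb01 R)) (c n *: basis n).
have h2 := L2_scaleE (c n) (basis n : L2 (leb01 R)).
apply: filterS3 IH h1 (filterI h2 (basisE n)) => x IHx h1x [h2x h3x] xT.
rewrite /Hval h1x// h2x// big_ord_recr/= -IHx// -h3x//.
Qed.

(** * Sobolev embedding of H_rho into L^6 *)

Section sobolev.
Context {R : realType}.
Variable rho : R.
Hypothesis hrho : 1 / 6 < rho.
Implicit Types (u v : H R).

(** Block j has sixth moment at most 4 q^(10 j) times the sixth power of the H_rho norm. Of the ten
    factors q^j, five pay for the weights q^j in [power_mean6] and five leave a convergent series.
    The condition q < 1 is rho > 1/6. *)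
Let q : R := 2 `^ ((2 - 12 * rho) / 10).

Let rho_gt0 : 0 < rho. Proof. by move: hrho; lra. Qed.

Let q_gt0 : 0 < q. Proof. exact: powR_gt0. Qed.

Let q_lt1 : q < 1.
Proof.
have -> : q = (2 `^ ((12 * rho - 2) / 10))^-1.
  by rewrite -powRN /q; congr (_ `^ _); lra.
have s0 : 0 < (12 * rho - 2) / 10 by move: hrho; lra.
rewrite invf_lt1 ?powR_gt0//.
have : (1 : R) `^ ((12 * rho - 2) / 10) < 2 `^ ((12 * rho - 2) / 10).
  by apply: gt0_ltr_powR; rewrite ?nnegrE ?ltr1n.
by rewrite powR1.
Qed.

(** The indices with 2^j <= k + 1 < 2^(j+1), that is, the frequencies of the dyadic block in the
    unshifted numbering. *)
Definition dyadic (j : nat) : seq nat := index_iota (2 ^ j).-1 (2 ^ j.+1).-1.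

Definition dyadic_fun v j (x : R) : R := \sum_(k <- dyadic j) coord v k * sine k.+1 x.

Lemma measurable_dyadic_fun v j : measurable_fun setT (dyadic_fun v j).
Proof.
by apply: measurable_sum => k; apply: measurable_funM => //; exact: measurable_sine.
Qed.

Lemma size_dyadic j : size (dyadic j) = (2 ^ j)%N.
Proof. rewrite size_iota expnS; have := expn_gt0 2 j; lia. Qed.

Lemma sum_dyadic n (f : nat -> R) :
  \sum_(j < n) \sum_(k <- dyadic j) f k = \sum_(k < (2 ^ n).-1) f k.
Proof.
elim: n => [|n IH]; first by rewrite !big_ord0.
rewrite big_ord_recr/= IH -!(big_mkord xpredT f) /dyadic [RHS](big_cat_nat (n := (2 ^ n).-1))//=.
by rewrite -!subn1 leq_sub2r// leq_exp2l.
Qed.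

(** Cauchy-Schwarz over the 2^j terms of the block, each squared sine being at most 2. *)
Lemma dyadic_fun_sup v j x :
  dyadic_fun v j x ^+ 2 <= 2 * (2 ^ j)%:R * \sum_(k <- dyadic j) coord v k ^+ 2.
Proof.
apply: le_trans (sum_sqr_le _ _) _; rewrite size_dyadic -mulrA mulrCA ler_wpM2l//.
rewrite mulr_sumr; apply: ler_sum => k _; rewrite exprMn mulrC ler_wpM2r ?sqr_ge0//.
rewrite -real_normK ?num_real//.
have := sine_le k.+1 x; have h : Num.sqrt 2 ^+ 2 = 2 :> R by rewrite sqr_sqrtr.
by move=> hs; rewrite -[X in _ <= X]h lerXn2r ?nnegrE ?sqrtr_ge0.
Qed.

Lemma dyadic_fun_L2 v j :
  (\int[leb01 R]_x (dyadic_fun v j x ^+ 2)%:E =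
   (\sum_(k <- dyadic j) coord v k ^+ 2)%:E)%E.
Proof.
have aef := ae_filter_ringOfSetsType (leb01 R).
pose c (k : nat) := if k \in dyadic j then coord v k else 0.
pose n := (2 ^ j.+1).-1.
have inD k : k \in dyadic j -> (k < n)%N by rewrite mem_index_iota => /andP[].
have sumE (f : nat -> R) : \sum_(k <- dyadic j) f k = \sum_(k < n) (if val k \in dyadic j then f k else 0).
  rewrite -(big_mkord xpredT (fun k => if k \in dyadic j then f k else 0)) -big_mkcond /=.
  rewrite -[in RHS]big_filter; apply: perm_big; apply: uniq_perm.
  - exact: iota_uniq.
  - by rewrite filter_uniq// iota_uniq.
  - move=> k; rewrite mem_filter mem_index_iota; case: (boolP (k \in dyadic j)) => // /inD ->.
    by rewrite andbT.
have sE : (synth n c : R -> R) = dyadic_fun v j %[ae leb01 R].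
  apply: filterS (synthE n c) => x h xT; rewrite h// /dyadic_fun sumE.
  by apply: eq_bigr => k _; rewrite /c; case: ifP => _; rewrite ?mul0r.
transitivity (`|synth n c| ^+ 2)%:E.
  rewrite (L2norm2E (synth n c : L2 (leb01 R))).
  apply: ge0_ae_eq_integral => //.
  - by apply/measurable_EFinP/measurable_funX; exact: measurable_dyadic_fun.
  - by apply/measurable_EFinP/measurable_funX; exact: measurable_H.
  - by move=> x _; rewrite lee_fin sqr_ge0.
  - by move=> x _; rewrite lee_fin sqr_ge0.
  - by apply: filterS sE => x h xT; rewrite -h.
rewrite norm_synth sumE; congr EFin; apply: eq_bigr => k _.
by rewrite /c; case: ifP => _; rewrite ?expr0n.
Qed.

(** On block j one has lam k >= 4^j, so the squared coordinates sum to at most 2^(-4 rho j) times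
    the squared H_rho norm; the cube times 4^j has exponent (2 - 12 rho) j. *)
Lemma dyadic_coord_le v j : Hr rho v ->
  (2 ^ j)%:R ^+ 2 * (\sum_(k <- dyadic j) coord v k ^+ 2) ^+ 3 <=
  (q ^+ j) ^+ 10 * Hr_norm rho v ^+ 6.
Proof.
move=> vr.
pose N : R := (2 ^ j)%:R.
have N1 : 1 <= N by rewrite /N ler1n expn_gt0.
have N0 : 0 < N by exact: lt_le_trans N1.
have sumle : \sum_(k <- dyadic j) coord v k ^+ 2 <= N `^ (- (4 * rho)) * Hr_norm rho v ^+ 2.
  have : \sum_(k <- dyadic j) (lam k `^ rho * coord v k) ^+ 2 <= Hr_norm rho v ^+ 2.
    rewrite -lee_fin -hsumE// /hsum.
    apply: le_trans (@nneseries_lim_ge _ (fun k => ((lam k `^ rho * coord v k) ^+ 2)%:E) xpredT 0%N (2 ^ j.+1).-1 _).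
      rewrite sumEFin lee_fin [leRHS](big_cat_nat (n := (2 ^ j).-1))//=.
        by rewrite lerDr sumr_ge0// => *; rewrite sqr_ge0.
      by rewrite -!subn1 leq_sub2r// leq_exp2l.
    by move=> *; rewrite lee_fin sqr_ge0.
  move=> h; apply: le_trans (ler_wpM2l (powR_ge0 _ _) h).
  rewrite mulr_sumr big_seq [leRHS]big_seq; apply: ler_sum => k.
  rewrite mem_index_iota => /andP[jk _].
  rewrite exprMn mulrA ler_peMl ?sqr_ge0// powRN mulrC ler_pdivlMr ?powR_gt0// mul1r.
  have Nk : N <= k.+1%:R by rewrite /N ler_nat; move: jk; case: (2 ^ j)%N.
  have : N ^+ 2 <= lam k.
    rewrite /lam lerXn2r ?nnegrE ?mulr_ge0 ?pi_ge0// ?(ltW N0)//.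
    apply: le_trans Nk _; rewrite ler_peMr//.
    by apply: le_trans (pi_ge2 _); rewrite ler1n.
  move=> h2; rewrite -powR_mulrn ?powR_ge0// -powRrM.
  have -> : N `^ (4 * rho) = (N ^+ 2) `^ (rho * 2).
    by rewrite -powR_mulrn ?(ltW N0)// -powRrM; congr (_ `^ _); ring.
  have r0 : 0 <= rho * 2 by rewrite mulr_ge0// ltW.
  by apply: ge0_ler_powR => //; rewrite nnegrE ?sqr_ge0 ?(ltW (lam_gt0 k)).
have s0 : 0 <= \sum_(k <- dyadic j) coord v k ^+ 2 by rewrite sumr_ge0// => *; rewrite sqr_ge0.
apply: (@le_trans _ _ (N ^+ 2 * (N `^ (- (4 * rho)) * Hr_norm rho v ^+ 2) ^+ 3)).
  apply: ler_wpM2l; first exact: sqr_ge0.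
  by apply: lerXn2r => //; rewrite nnegrE mulr_ge0 ?sqr_ge0 ?powR_ge0.
rewrite exprMn -(exprM (Hr_norm _ _)) mulrA ler_wpM2r ?exprn_ge0 ?Hr_norm_ge0//.
rewrite -exprM /q -powR_mulrn ?powR_ge0// -powR_mulrn ?(ltW N0)// -(powR_mulrn 3) ?powR_ge0//.
rewrite -!powRrM -powRD; last by rewrite (gt_eqF N0) implybT.
rewrite /N natrX -powR_mulrn// -powRrM le_eqVlt; apply/orP; left; apply/eqP.
by congr (_ `^ _); rewrite natrM; field.
Qed.

(** Interpolation between L^2 and the sup norm: four of the six factors are bounded by the
    supremum. *)
Lemma dyadic_fun_L6 v j : Hr rho v ->
  (\int[leb01 R]_x (dyadic_fun v j x ^+ 6)%:E <= (4 * (q ^+ j) ^+ 10 * Hr_norm rho v ^+ 6)%:E)%E.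
Proof.
move=> vr; set n := \sum_(k <- dyadic j) coord v k ^+ 2.
have n0 : 0 <= n by rewrite sumr_ge0// => *; rewrite sqr_ge0.
pose M := (2 * (2 ^ j)%:R * n) ^+ 2.
apply: (@le_trans _ _ (\int[leb01 R]_x (M%:E * (dyadic_fun v j x ^+ 2)%:E))%E).
  apply: ge0_le_integral_nomeas => x _.
    by rewrite lee_fin (exprM _ 2 3) exprn_ge0 ?sqr_ge0.
  rewrite -EFinM lee_fin -[6%N]/(4 + 2)%N exprD ler_wpM2r ?sqr_ge0//.
  rewrite (exprM _ 2 2) /M lerXn2r ?nnegrE ?sqr_ge0// ?mulr_ge0//.
  exact: dyadic_fun_sup.
rewrite ge0_integralZl_EFin ?sqr_ge0//; last 2 first.
- by move=> x _; rewrite lee_fin sqr_ge0.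
- by apply/measurable_EFinP/measurable_funX; exact: measurable_dyadic_fun.
rewrite dyadic_fun_L2 -/n -EFinM lee_fin /M.
have := dyadic_coord_le j vr; rewrite -/n.
have -> : (2 * (2 ^ j)%:R * n) ^+ 2 * n = 4 * ((2 ^ j)%:R ^+ 2 * n ^+ 3) by ring.
by move=> h; rewrite -mulrA ler_wpM2l.
Qed.

(** [power_mean6] with weights q^j bounds the sums of the first n blocks uniformly in n; Fatou along
    an a.e. convergent subsequence reaches the limit. *)
Lemma sobolev6 : exists2 C : R, 0 <= C & forall v, Hr rho v ->
  (\int[leb01 R]_x (v x ^+ 6)%:E <= (C * Hr_norm rho v ^+ 6)%:E)%E.
Proof.
have geo (p : R) n : 0 < p -> p < 1 -> \sum_(j < n) p ^+ j <= 1 / (1 - p).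
  move=> p0 p1; rewrite ler_pdivlMr ?subr_gt0// mulrC.
  have -> : (1 - p) * \sum_(j < n) p ^+ j = 1 - p ^+ n by rewrite -[RHS]opprB subrX1; ring.
  by rewrite gerBl exprn_ge0 ?ltW.
exists ((1 / (1 - q)) ^+ 5 * (4 * (1 / (1 - q ^+ 5)))).
  have h5 : q ^+ 5 <= 1 by rewrite exprn_ile1 ?ltW.
  apply: mulr_ge0; first by rewrite exprn_ge0// divr_ge0// subr_ge0 ltW.
  by rewrite mulr_ge0// divr_ge0// subr_ge0.
move=> v vr.
pose V n x := \sum_(j < n) dyadic_fun v j x.
have mV n : measurable_fun setT (V n).
  by apply: measurable_sum => j; exact: measurable_dyadic_fun.
have aef := ae_filter_ringOfSetsType (leb01 R).
have VE n : (synth (2 ^ n).-1 (coord v) : R -> R) = V n %[ae leb01 R].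
  by apply: filterS (synthE (2 ^ n).-1 (coord v)) => x h xT; rewrite h// /V sum_dyadic.
have VL6 n : (\int[leb01 R]_x (V n x ^+ 6)%:E <=
    ((1 / (1 - q)) ^+ 5 * (4 * (1 / (1 - q ^+ 5))) * Hr_norm rho v ^+ 6)%:E)%E.
  have W0 : 0 <= \sum_(j < n) q ^+ j by rewrite sumr_ge0// => *; rewrite exprn_ge0 ?ltW.
  have d60 j x : 0 <= dyadic_fun v j x ^+ 6 by rewrite (exprM _ 2 3) exprn_ge0 ?sqr_ge0.
  have qj j : 0 < q ^+ j by rewrite exprn_gt0.
  have ij j : 0 <= (q ^+ j ^+ 5)^-1 by rewrite invr_ge0 exprn_ge0 ?ltW.
  apply: (@le_trans _ _ (\int[leb01 R]_x (((1 / (1 - q)) ^+ 5)%:E *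
      \sum_(j < n) (((q ^+ j) ^+ 5)^-1%:E * (dyadic_fun v j x ^+ 6)%:E)))%E).
    apply: ge0_le_integral_nomeas => x _.
      by rewrite lee_fin (exprM _ 2 3) exprn_ge0 ?sqr_ge0.
    under eq_bigr do rewrite -EFinM mulrC.
    rewrite sumEFin -EFinM lee_fin.
    apply: le_trans (power_mean6 n (fun j => dyadic_fun v j x) qj) _.
    apply: ler_wpM2r; first by rewrite sumr_ge0// => j _; rewrite mulr_ge0.
    apply: lerXn2r; rewrite ?nnegrE//; first by rewrite divr_ge0// subr_ge0 ltW.
    exact: geo.
  have md j : measurable_fun setT (fun x => (dyadic_fun v j x ^+ 6)%:E).
    by apply/measurable_EFinP/measurable_funX; exact: measurable_dyadic_fun.
  rewrite ge0_integralZl_EFin//; last 3 first.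
  - by move=> x _; rewrite sume_ge0// => j _; rewrite mule_ge0 ?lee_fin.
  - by apply: emeasurable_sum => j; exact: (measurable_funeM _ (md j)).
  - by rewrite exprn_ge0// divr_ge0// subr_ge0 ltW.
  rewrite ge0_integral_sum//; last 2 first.
  - by move=> j; exact: (measurable_funeM _ (md j)).
  - by move=> j x _; rewrite mule_ge0 ?lee_fin.
  apply: (@le_trans _ _ (((1 / (1 - q)) ^+ 5)%:E * \sum_(j < n) (4 * Hr_norm rho v ^+ 6 * (q ^+ 5) ^+ j)%:E)%E).
    apply: lee_wpmul2l; first by rewrite lee_fin exprn_ge0// divr_ge0// subr_ge0 ltW.
    apply: lee_sum => j _; rewrite ge0_integralZl_EFin//; [|by move=> x _; rewrite lee_fin|exact: md].
    apply: (@le_trans _ _ (((q ^+ j) ^+ 5)^-1%:E * (4 * (q ^+ j) ^+ 10 * Hr_norm rho v ^+ 6)%:E)%E).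
      by apply: lee_wpmul2l; rewrite ?lee_fin//; exact: dyadic_fun_L6.
    rewrite -EFinM lee_fin -exprM mulnC exprM le_eqVlt; apply/orP; left; apply/eqP.
    have -> : (q ^+ j) ^+ 10 = ((q ^+ 5) ^+ j) ^+ 2 by rewrite -!exprM; congr (_ ^+ _); lia.
    by field; rewrite gt_eqF// !exprn_gt0.
  rewrite sumEFin -EFinM lee_fin -mulr_sumr -[leRHS]mulrA; apply: ler_wpM2l.
    by rewrite exprn_ge0// divr_ge0// subr_ge0 ltW.
  rewrite mulrAC; apply: ler_wpM2r; first by rewrite exprn_ge0 ?Hr_norm_ge0.
  by apply: ler_wpM2l => //; apply: geo; [rewrite exprn_gt0|rewrite exprn_ilt1 ?ltW].
have [w [wc cv]] : exists w, coord w =1 coord v /\ `|w - synth n (coord v)| @[n --> \oo] --> (0 : R).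
  by apply: riesz_fischer; rewrite parseval ltry.
have wv : w = v by exact: coord_inj.
rewrite wv in cv.
have cv2 : `|v - synth (2 ^ n).-1 (coord v)| @[n --> \oo] --> (0 : R).
  apply: (cvg_comp (fun n => (2 ^ n).-1) (fun n => `|v - synth n (coord v)|) _ cv).
  move=> A [N _ NA]; exists N.+1 => // n /= Nn; apply: NA => /=.
  by have := ltn_expl n (ltnSn 1); lia.
have [phi [_ aev]] := @L2_cvg_ae _ _ _ (leb01 R) (fun n => synth (2 ^ n).-1 (coord v)) v cv2.
apply: (@fatou_le _ _ _ (leb01 R) setT (fun i x => V (phi i) x ^+ 6)) => //.
- by move=> i; apply: measurable_funX; exact: mV.
- by move=> i x _; rewrite (exprM _ 2 3) exprn_ge0 ?sqr_ge0.
- by apply: measurable_funX; exact: measurable_H.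
- by move=> x _; rewrite (exprM _ 2 3) exprn_ge0 ?sqr_ge0.
- apply: filterS2 aev (ae_foralln VE) => x h VEx xT.
  have h1 : V (phi i) x @[i --> \oo] --> v x.
    by apply: cvg_trans h; apply: near_eq_cvg; near=> i => /=; have := VEx (phi i) xT.
  have cX k : V (phi i) x ^+ k @[i --> \oo] --> v x ^+ k.
    elim: k => [|k IH]; first by rewrite expr0; under eq_fun do rewrite expr0; exact: cvg_cst.
    by rewrite exprS; under eq_fun do rewrite exprS; apply: cvgM.
  exact: cX.
- by apply: nearW => i; exact: VL6.
Unshelve. all: by end_near. Qed.

End sobolev.

Section integral_bounds.
Context d (T : measurableType d) (R : realType).
Variable mu : {measure set T -> \bar R}.
Implicit Types u w : L2 mu.

Lemma L2norm2_ae w (f : T -> R) : measurable_fun setT f -> (w : T -> R) = f %[ae mu] ->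
  ((`|w| ^+ 2)%:E = \int[mu]_x (f x ^+ 2)%:E)%E.
Proof.
move=> mf wf; rewrite L2norm2E; apply: ge0_ae_eq_integral => //.
- by apply/measurable_EFinP/measurable_funX; exact: measurable_L2.
- exact/measurable_EFinP/measurable_funX.
- by move=> x _; rewrite lee_fin sqr_ge0.
- by move=> x _; rewrite lee_fin sqr_ge0.
- by apply: filterS wf => x h xT; rewrite h.
Qed.

(** Passing to the positive part of [f] keeps the estimate valid when the right-hand side is
    infinite, as may happen for the fourth power of an element of H. *)
Lemma L2dot_le u w (f : T -> R) (g : T -> \bar R) : measurable_fun setT f ->
  (fun x => u x * w x) = f %[ae mu] -> (forall x, (f x)%:E <= g x)%E ->
  (forall x, 0 <= g x)%E -> ((L2dot u w)%:E <= \int[mu]_x g x)%E.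
Proof.
move=> mf uwf fg g0; have iuw := integrable_L2M u w.
rewrite /L2dot fineK; last exact: integrable_fin_num.
rewrite (@ae_eq_integral _ _ _ mu setT (fun x => (f x)%:E) (fun x => (u x * w x)%:E))//.
- rewrite integralE; apply: (@le_trans _ _ (\int[mu]_x (fun x => (f x)%:E)^\+ x)%E).
    by rewrite geeDl// oppe_le0 integral_ge0.
  apply: ge0_le_integral_nomeas => x _ //.
  by rewrite funeposE ge_max fg g0.
- by apply/measurable_EFinP/measurable_funM; exact: measurable_L2.
- exact/measurable_EFinP.
- by apply: filterS uwf => x h xT; rewrite h.
Qed.

End integral_bounds.

(** * Growth, local Lipschitz continuity and dissipativity of the cubic drift *)

Section cubic_nonlinearity.
Context {R : realType}.
Implicit Types (u v z o : H R).

Definition cubic (F : H R -> H R) : Prop := forall v, Hr (1 / 6) v ->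
  (F v : R -> R) = (fun x => v x - v x ^+ 3) %[ae leb01 R].

Variables (F : H R -> H R) (rho : R).
Hypotheses (hF : cubic F) (hrho : 1 / 6 < rho).

Lemma cubic_ae v : Hr rho v -> (F v : R -> R) = (fun x => v x - v x ^+ 3) %[ae leb01 R].
Proof. by move=> vr; apply: hF; have [] := Hr_mono (ltW hrho) vr. Qed.

Lemma measurable_power v n : measurable_fun setT (fun x => v x ^+ n).
Proof. by apply: measurable_funX; exact: measurable_H. Qed.

Lemma measurable_EFin_power v n : measurable_fun setT (fun x => (v x ^+ n)%:E).
Proof. by apply/measurable_EFinP; exact: measurable_power. Qed.

Lemma cubic_growth : exists2 C : R, 0 <= C & forall v, Hr rho v ->
  `|F v| ^+ 2 <= C * (Hr_norm rho v ^+ 2 + Hr_norm rho v ^+ 6).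
Proof.
have [C C0 HC] := sobolev6 hrho; exists (2 + 2 * C); first by rewrite addr_ge0// mulr_ge0.
move=> v vr; set N := Hr_norm rho v; have N0 : 0 <= N := Hr_norm_ge0 _ _.
have e6 (x : R) : 0 <= x ^+ 6 by rewrite (exprM _ 2 3) exprn_ge0 ?sqr_ge0.
rewrite -lee_fin (L2norm2_ae (w := F v : L2 (leb01 R)) _ (cubic_ae vr)); last first.
  by apply: measurable_funB; [exact: measurable_H|exact: measurable_power].
apply: (@le_trans _ _ (\int[leb01 R]_x (2%:E * (v x ^+ 2)%:E + 2%:E * (v x ^+ 6)%:E))%E).
  apply: ge0_le_integral_nomeas => x _; first by rewrite lee_fin sqr_ge0.
  rewrite -!EFinM -EFinD lee_fin (exprM _ 3 2).
  by move: (v x) (v x ^+ 3) => a b; have := sqr_ge0 (a + b); nra.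
rewrite ge0_integralD//; last 4 first.
- by move=> x _; rewrite mule_ge0 ?lee_fin ?sqr_ge0.
- by apply: measurable_funeM; exact: measurable_EFin_power.
- by move=> x _; rewrite mule_ge0 ?lee_fin.
- by apply: measurable_funeM; exact: measurable_EFin_power.
rewrite !ge0_integralZl_EFin//; [|by move=> x _; rewrite lee_fin|exact: measurable_EFin_power
  |by move=> x _; rewrite lee_fin sqr_ge0|exact: measurable_EFin_power].
apply: (@le_trans _ _ (2%:E * (N ^+ 2)%:E + 2%:E * (C * N ^+ 6)%:E)%E).
  apply: leeD; apply: lee_wpmul2l => //; last exact: HC.
  rewrite -(L2norm2E (v : L2 (leb01 R))) lee_fin lerXn2r ?nnegrE//.
  by apply: norm_le_Hr => //; rewrite ltW// (lt_trans _ hrho).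
rewrite -!EFinM -EFinD lee_fin.
have := mulr_ge0 C0 (exprn_ge0 2 N0); have := exprn_ge0 6 N0; lra.
Qed.

(** Hoelder with exponents 3/2 and 3, replaced by the pointwise bound s^2 t <= s^3 + t^3 after
    dividing [u] and [v] by their H_rho norms; this costs the factor 2. If one of the norms is 0, so
    is the integrand. *)
Lemma quartic_quadratic : exists2 C : R, 0 <= C & forall u v, Hr rho u -> Hr rho v ->
  (\int[leb01 R]_x (u x ^+ 4 * v x ^+ 2)%:E <= (C * Hr_norm rho u ^+ 4 * Hr_norm rho v ^+ 2)%:E)%E.
Proof.
have [C C0 HC] := sobolev6 hrho; exists (2 * C); first by rewrite mulr_ge0.
have rho0 : 0 <= rho by rewrite ltW// (lt_trans _ hrho).
have e6 (x : R) : 0 <= x ^+ 6 by rewrite (exprM _ 2 3) exprn_ge0 ?sqr_ge0.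
have e4 (x : R) : 0 <= x ^+ 4 by rewrite (exprM _ 2 2) sqr_ge0.
move=> u v ur vr; set a := Hr_norm rho u; set b := Hr_norm rho v.
have aef := ae_filter_ringOfSetsType (leb01 R).
have zero w (f : R -> R) : Hr rho w -> Hr_norm rho w = 0 -> measurable_fun setT f ->
    (forall x, w x = 0 -> f x = 0) -> (\int[leb01 R]_x (f x)%:E = 0)%E.
  move=> wr w0 mf f0; have wz : w = 0.
    by apply/eqP; rewrite -normr_le0 -w0; exact: norm_le_Hr.
  rewrite (@ae_eq_integral _ _ _ (leb01 R) setT (cst 0%E))//; first by rewrite integral0.
  - exact/measurable_EFinP.
  - by apply: filterS (L2_zeroE (leb01 R)) => x h xT; rewrite f0// wz; exact: h.
have mf : measurable_fun setT (fun x => u x ^+ 4 * v x ^+ 2).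
  by apply: measurable_funM; exact: measurable_power.
have [a0|a0] := eqVneq a 0.
  by rewrite (zero u)// ?a0 ?expr0n ?mulr0 ?mul0r// => x ->; rewrite expr0n mul0r.
have [b0|b0] := eqVneq b 0.
  by rewrite (zero v)// ?b0 ?expr0n ?mulr0// => x ->; rewrite expr0n mulr0.
have ap : 0 < a by rewrite lt_neqAle eq_sym a0 Hr_norm_ge0.
have bp : 0 < b by rewrite lt_neqAle eq_sym b0 Hr_norm_ge0.
have cube_le (s t : R) : 0 <= s -> 0 <= t -> s ^+ 2 * t <= s ^+ 3 + t ^+ 3.
  move=> s0 t0; have [st|/ltW ts] := lerP s t.
    apply: (@le_trans _ _ (t ^+ 3)); last by rewrite lerDr exprn_ge0.
    by rewrite [leRHS]exprSr; apply: ler_wpM2r => //; apply: lerXn2r.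
  apply: (@le_trans _ _ (s ^+ 3)); last by rewrite lerDl exprn_ge0.
  by rewrite [leRHS]exprSr ler_wpM2l// sqr_ge0.
apply: (@le_trans _ _ (\int[leb01 R]_x ((b ^+ 2 / a ^+ 2)%:E * (u x ^+ 6)%:E + (a ^+ 4 / b ^+ 4)%:E * (v x ^+ 6)%:E))%E).
  apply: ge0_le_integral_nomeas => x _; first by rewrite lee_fin mulr_ge0 ?sqr_ge0.
  rewrite -!EFinM -EFinD lee_fin.
  set s := (u x / a) ^+ 2; set t := (v x / b) ^+ 2.
  have s0 : 0 <= s by rewrite sqr_ge0.
  have t0 : 0 <= t by rewrite sqr_ge0.
  have -> : u x ^+ 4 * v x ^+ 2 = a ^+ 4 * b ^+ 2 * (s ^+ 2 * t) by rewrite /s /t; field; rewrite a0 b0.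
  have -> : b ^+ 2 / a ^+ 2 * u x ^+ 6 + a ^+ 4 / b ^+ 4 * v x ^+ 6 =
      a ^+ 4 * b ^+ 2 * (s ^+ 3 + t ^+ 3) by rewrite /s /t; field; rewrite a0 b0.
  apply: ler_wpM2l; first by rewrite mulr_ge0 ?exprn_ge0 ?ltW.
  exact: cube_le.
have ba0 : 0 <= b ^+ 2 / a ^+ 2 by rewrite divr_ge0 ?sqr_ge0.
have ab0 : 0 <= a ^+ 4 / b ^+ 4 by rewrite divr_ge0.
rewrite ge0_integralD//; last 4 first.
- by move=> x _; rewrite mule_ge0 ?lee_fin.
- by apply: measurable_funeM; exact: measurable_EFin_power.
- by move=> x _; rewrite mule_ge0 ?lee_fin.
- by apply: measurable_funeM; exact: measurable_EFin_power.
rewrite !ge0_integralZl_EFin//; [|by move=> x _; rewrite lee_fin|exact: measurable_EFin_power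
  |by move=> x _; rewrite lee_fin|exact: measurable_EFin_power].
apply: (@le_trans _ _ ((b ^+ 2 / a ^+ 2)%:E * (C * a ^+ 6)%:E + (a ^+ 4 / b ^+ 4)%:E * (C * b ^+ 6)%:E)%E).
  by apply: leeD; apply: lee_wpmul2l; rewrite ?lee_fin//; exact: HC.
rewrite -!EFinM -EFinD lee_fin le_eqVlt; apply/orP; left; apply/eqP.
by field; rewrite a0 b0.
Qed.

(** The difference of the cubics is (a - b)(1 - (a^2 + ab + b^2)), and the square of the second
    factor is at most 2 + 9 a^4 + 9 b^4. [quartic_quadratic] integrates the resulting terms. *)
Lemma cubic_lipschitz : exists2 C : R, 0 <= C & forall u v, Hr rho u -> Hr rho v ->
  `|F u - F v| ^+ 2 <=
    C * (1 + Hr_norm rho u ^+ 4 + Hr_norm rho v ^+ 4) * Hr_norm rho (u - v) ^+ 2.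
Proof.
have [C C0 HC] := quartic_quadratic; exists (2 + 9 * C); first by rewrite addr_ge0// mulr_ge0.
have rho0 : 0 <= rho by rewrite ltW// (lt_trans _ hrho).
have e4 (x : R) : 0 <= x ^+ 4 by rewrite (exprM _ 2 2) sqr_ge0.
have aef := ae_filter_ringOfSetsType (leb01 R).
move=> u v ur vr; have wr := HrB ur vr; set w : H R := u - v.
have wE := L2_subE (u : L2 (leb01 R)) v.
have pos (y : H R) x : 0 <= y x ^+ 4 * w x ^+ 2 by rewrite mulr_ge0 ?sqr_ge0.
have FwE : ((F u - F v : H R) : R -> R) = (fun x => (u x - u x ^+ 3) - (v x - v x ^+ 3)) %[ae leb01 R].
  apply: filterS3 (L2_subE (F u : L2 (leb01 R)) (F v)) (cubic_ae ur) (cubic_ae vr) => x h1 h2 h3 xT.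
  by rewrite /Hval h1// -h2// -h3.
rewrite -lee_fin (L2norm2_ae (w := F u - F v : L2 (leb01 R)) _ FwE); last first.
  by apply: measurable_funB; apply: measurable_funB; try exact: measurable_power; exact: measurable_H.
have mp (p q r : nat) : measurable_fun setT (fun x => (u x ^+ p * w x ^+ q)%:E).
  by apply/measurable_EFinP; apply: measurable_funM; exact: measurable_power.
have mq (p q r : nat) : measurable_fun setT (fun x => (v x ^+ p * w x ^+ q)%:E).
  by apply/measurable_EFinP; apply: measurable_funM; exact: measurable_power.
apply: (@le_trans _ _ (\int[leb01 R]_x (2%:E * (w x ^+ 2)%:E +
    (9%:E * (u x ^+ 4 * w x ^+ 2)%:E + 9%:E * (v x ^+ 4 * w x ^+ 2)%:E)))%E).
  apply: ae_ge0_le_integral => //.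
  - by move=> x _; rewrite lee_fin sqr_ge0.
  - apply/measurable_EFinP/measurable_funX.
    by apply: measurable_funB; apply: measurable_funB; try exact: measurable_power; exact: measurable_H.
  - by move=> x _; rewrite !adde_ge0// mule_ge0 ?lee_fin ?sqr_ge0 ?pos.
  - apply: emeasurable_funD; first by apply: measurable_funeM; exact: measurable_EFin_power.
    by apply: emeasurable_funD; apply: measurable_funeM; [exact: (mp 4%N 2%N 0%N)|exact: (mq 4%N 2%N 0%N)].
  - apply: filterS wE => x h xT; have -> : w x = u x - v x by exact: h.
    rewrite -!EFinM -!EFinD lee_fin; move: (u x) (v x) => a b.
    have -> : (a - a ^+ 3 - (b - b ^+ 3)) ^+ 2 = (a - b) ^+ 2 * (1 - (a ^+ 2 + a * b + b ^+ 2)) ^+ 2 by ring.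
    have -> : 2 * (a - b) ^+ 2 + (9 * (a ^+ 4 * (a - b) ^+ 2) + 9 * (b ^+ 4 * (a - b) ^+ 2)) =
      (a - b) ^+ 2 * (2 + 9 * a ^+ 4 + 9 * b ^+ 4) by ring.
    apply: ler_wpM2l; first exact: sqr_ge0.
    have h1 : 0 <= a ^+ 2 + a * b + b ^+ 2.
      by have := sqr_ge0 (a + b); have := sqr_ge0 a; have := sqr_ge0 b; lra.
    have h2 : a ^+ 2 + a * b + b ^+ 2 <= 3 / 2 * (a ^+ 2 + b ^+ 2).
      by have := sqr_ge0 (a - b); lra.
    have h3 : (a ^+ 2 + a * b + b ^+ 2) ^+ 2 <= (3 / 2 * (a ^+ 2 + b ^+ 2)) ^+ 2.
      by rewrite lerXn2r ?nnegrE// (le_trans h1 h2).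
    have h4 : (a ^+ 2 + b ^+ 2) ^+ 2 <= 2 * (a ^+ 4 + b ^+ 4).
      by have := sqr_ge0 (a ^+ 2 - b ^+ 2); rewrite (exprM a 2 2) (exprM b 2 2); lra.
    move: h3 h4; rewrite exprMn; move: (a ^+ 2 + a * b + b ^+ 2) => y.
    by have := sqr_ge0 (1 + y); lra.
rewrite ge0_integralD//; last 4 first.
- by move=> x _; rewrite mule_ge0 ?lee_fin ?sqr_ge0.
- by apply: measurable_funeM; exact: measurable_EFin_power.
- by move=> x _; rewrite !adde_ge0// mule_ge0 ?lee_fin ?sqr_ge0 ?pos.
- by apply: emeasurable_funD; apply: measurable_funeM; [exact: (mp 4%N 2%N 0%N)|exact: (mq 4%N 2%N 0%N)].
rewrite ge0_integralD//; last 4 first.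
- by move=> x _; rewrite mule_ge0 ?lee_fin ?pos.
- by apply: measurable_funeM; exact: (mp 4%N 2%N 0%N).
- by move=> x _; rewrite mule_ge0 ?lee_fin ?pos.
- by apply: measurable_funeM; exact: (mq 4%N 2%N 0%N).
rewrite !ge0_integralZl_EFin//; [|by move=> x _; rewrite lee_fin|exact: (mq 4%N 2%N 0%N)
  |by move=> x _; rewrite lee_fin|exact: (mp 4%N 2%N 0%N)
  |by move=> x _; rewrite lee_fin sqr_ge0|exact: measurable_EFin_power].
set N := Hr_norm rho w; set a := Hr_norm rho u; set b := Hr_norm rho v.
apply: (@le_trans _ _ (2%:E * (N ^+ 2)%:E + (9%:E * (C * a ^+ 4 * N ^+ 2)%:E + 9%:E * (C * b ^+ 4 * N ^+ 2)%:E))%E).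
  apply: leeD; [apply: lee_wpmul2l|apply: leeD; (apply: lee_wpmul2l; last exact: HC)] => //.
  rewrite -(L2norm2E (w : L2 (leb01 R))) lee_fin lerXn2r ?nnegrE ?Hr_norm_ge0//.
  exact: norm_le_Hr.
rewrite -!EFinM -!EFinD lee_fin.
have -> : 2 * N ^+ 2 + (9 * (C * a ^+ 4 * N ^+ 2) + 9 * (C * b ^+ 4 * N ^+ 2)) =
  (2 + 9 * C * (a ^+ 4 + b ^+ 4)) * N ^+ 2 by ring.
apply: ler_wpM2r; first exact: sqr_ge0.
by move: (a ^+ 4) (b ^+ 4) (e4 a) (e4 b) => x y x0 y0; nra.
Qed.

(** Pointwise, the term -a^4 in (a - b)(a - a^3) absorbs everything else that contains a, leaving a
    quartic in b. The right-hand side thus depends on [o] alone. *)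
Lemma cubic_dissipative z o : Hr rho z ->
  ((L2dot (z - o) (F z))%:E <= \int[leb01 R]_x (3 * (1 + o x ^+ 4))%:E)%E.
Proof.
move=> zr; have aef := ae_filter_ringOfSetsType (leb01 R).
have e4 (x : R) : 0 <= x ^+ 4 by rewrite (exprM _ 2 2) sqr_ge0.
apply: (@L2dot_le _ _ _ (leb01 R) (z - o) (F z) (fun x => (z x - o x) * (z x - z x ^+ 3))).
- apply: measurable_funM; apply: measurable_funB; try exact: measurable_power; exact: measurable_H.
- apply: filterS2 (L2_subE (z : L2 (leb01 R)) o) (cubic_ae zr) => x h1 h2 xT.
  by rewrite h1// -h2.
- move=> x; rewrite lee_fin; move: (z x) (o x) => a b.
  have -> : (a - b) * (a - a ^+ 3) = a ^+ 2 - a ^+ 4 - a * b + a ^+ 3 * b by ring.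
  have h1 := sqr_ge0 (a ^+ 2 / 2 - 1); have h2 := sqr_ge0 (a + b).
  have h3 := sqr_ge0 (b ^+ 2 - 1).
  have h4 := sqr_ge0 (a ^+ 2 / 2 - a * b); have h5 := sqr_ge0 (a ^+ 2 / 4 - 2 * b ^+ 2).
  have := e4 a; have := e4 b; nra.
- by move=> x; rewrite lee_fin mulr_ge0// addr_ge0.
Qed.

End cubic_nonlinearity.

(** * Cauchy-Schwarz on a finite measure space *)

Section finite_measure_bounds.
Context d (T : measurableType d) (R : realType).
Variables (mu : {measure set T -> \bar R}) (D : set T).
Hypotheses (mD : measurable D) (muD : (mu D < +oo)%E).

Lemma bounded_integrable (g : T -> R) (M : R) : measurable_fun D g ->
  (forall x, D x -> `|g x| <= M) -> mu.-integrable D (EFin \o g).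
Proof.
move=> mg gM; apply: measurable_bounded_integrable => //.
exists M; split; first exact: num_real.
by move=> y My x Dx; apply: le_trans (gM x Dx) (ltW My).
Qed.

Lemma Rintegral_CauchySchwarz (f g : T -> R) (K M : R) : measurable_fun D f -> measurable_fun D g ->
  (forall x, D x -> `|f x| <= K) -> (forall x, D x -> `|g x| <= M) ->
  (\int[mu]_(x in D) (f x * g x)) ^+ 2 <=
  \int[mu]_(x in D) (f x ^+ 2) * \int[mu]_(x in D) (g x ^+ 2).
Proof.
move=> mf mg fK gM.
have bM (u v : T -> R) (A B : R) : measurable_fun D u -> measurable_fun D v ->
    (forall x, D x -> `|u x| <= A) -> (forall x, D x -> `|v x| <= B) ->
    mu.-integrable D (EFin \o (fun x => u x * v x)).
  move=> mu' mv uA vB; apply: (bounded_integrable (M := A * B)); first exact: measurable_funM.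
  by move=> x Dx; rewrite normrM ler_pM ?uA ?vB.
have ifg := bM _ _ _ _ mf mg fK gM; have iff := bM _ _ _ _ mf mf fK fK.
have igg := bM _ _ _ _ mg mg gM gM.
set m := \int[mu]_(x in D) (f x ^+ 2); set a := \int[mu]_(x in D) (f x * g x).
set b := \int[mu]_(x in D) (g x ^+ 2).
have m0 : 0 <= m by apply: Rintegral_ge0 => x _; exact: sqr_ge0.
have sq c : 0 <= b - 2 * c * a + c ^+ 2 * m.
  have i2 : mu.-integrable D (EFin \o (fun x => 2 * c * (f x * g x))).
    exact: (integrableZl mD (2 * c) ifg).
  have i3 : mu.-integrable D (EFin \o (fun x => c ^+ 2 * (f x * f x))).
    exact: (integrableZl mD (c ^+ 2) iff).
  have -> : b - 2 * c * a + c ^+ 2 * m =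
      \int[mu]_(x in D) (g x * g x - 2 * c * (f x * g x) + c ^+ 2 * (f x * f x)).
    rewrite RintegralD//; last exact: (integrableB mD igg i2).
    by rewrite RintegralB// !RintegralZl.
  apply: Rintegral_ge0 => x Dx.
  by rewrite (_ : _ + _ = (g x - c * f x) ^+ 2) ?sqr_ge0//; ring.
have [m00|mn0] := eqVneq m 0.
  have [->|a0] := eqVneq a 0; first by rewrite expr0n m00 mul0r.
  (* If m = 0 the quadratic form is affine in c, and this c gives it the value -1. *)
  have := sq ((b + 1) / (2 * a)); rewrite m00 mulr0 addr0.
  have -> : b - 2 * ((b + 1) / (2 * a)) * a = - 1 by field.
  lra.
have mp : 0 < m by rewrite lt_neqAle eq_sym mn0.
have := sq (a / m); rewrite (_ : _ + _ = b - a ^+ 2 / m); last by field.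
by rewrite subr_ge0 ler_pdivrMr// mulrC.
Qed.

Lemma Rintegral_sqr_le (g : T -> R) (M : R) : measurable_fun D g ->
  (forall x, D x -> `|g x| <= M) ->
  (\int[mu]_(x in D) g x) ^+ 2 <= fine (mu D) * \int[mu]_(x in D) (g x ^+ 2).
Proof.
move=> mg gM; have n1 x : D x -> `|cst 1 x : R| <= 1 by rewrite normr1.
have := Rintegral_CauchySchwarz (measurable_cst (1 : R)) mg n1 gM.
under [X in X ^+ 2 <= _ -> _]eq_Rintegral do rewrite mul1r.
by under [X in _ <= X * _ -> _]eq_Rintegral do rewrite expr1n; rewrite Rintegral_cst// mul1r.
Qed.

End finite_measure_bounds.

Lemma coord_sub_cvg (R : realType) (u : nat -> H R) (v : H R) k :
  `|u n - v| @[n --> \oo] --> (0 : R) -> coord (u n) k @[n --> \oo] --> coord v k.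
Proof.
move=> /cvgr0_norm_le h; apply/cvgrPdist_le => e e0.
apply: filterS (h _ e0) => n.
rewrite normr_id => /(le_trans _); apply.
by rewrite distrC -coordB coord_le.
Qed.

(** * Measurability and Bochner integrals in coordinates *)

Section coordinate_measurability.
Context d (T : measurableType d) (R : realType).
Variable D : set T.

Lemma norm_coord_cvg (v : H R) :
  \sum_(k < n) coord v k ^+ 2 @[n --> \oo] --> `|v| ^+ 2.
Proof.
have h := @dot_cvg R v v; have e : L2dot v v = `|v| ^+ 2 by rewrite L2dotvv.
by rewrite e in h; under eq_fun do under eq_bigr do rewrite expr2.
Qed.

(** By Parseval the squared norm is a pointwise limit of sums of squared coordinates. Measurability
    of H-valued maps is therefore handled one coordinate at a time. *)
Lemma measurable_norm_coord (g : T -> H R) :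
  (forall k, measurable_fun D (fun s => coord (g s) k)) ->
  measurable_fun D (fun s => `|g s|).
Proof.
move=> mg.
have m2 : measurable_fun D (fun s => `|g s| ^+ 2).
  apply: (@measurable_fun_cvg _ _ _ D (fun n s => \sum_(k < n) coord (g s) k ^+ 2)).
    by move=> n; apply: measurable_sum => k; exact: measurable_funX.
  by move=> s _; exact: norm_coord_cvg.
have -> : (fun s => `|g s|) = (fun s => Num.sqrt (`|g s| ^+ 2)).
  by apply/funext => s; rewrite sqrtr_sqr normr_id.
apply: (@measurableT_comp _ _ _ _ _ _ (@Num.sqrt R)) => //.
by apply: continuous_measurable_fun; exact: sqrt_continuous.
Qed.

End coordinate_measurability.

Section bochner_coordinates.
Context d (T : measurableType d) (R : realType).
Variables (mu : {measure set T -> \bar R}) (D : set T).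
Hypotheses (mD : measurable D) (muD : (mu D < +oo)%E).
Implicit Types (s : seq (set T * H R)) (f : T -> H R).

Lemma coord_simple_fun s x k :
  coord (simple_fun s x) k = \sum_(p <- s) (\1_(p.1) x : R) * coord p.2 k.
Proof. by rewrite /simple_fun coord_sum; apply: eq_bigr => p _; rewrite coordZ. Qed.

Lemma integrable_coord_simple_fun s k :
  (forall p, p \in s -> measurable p.1 /\ (mu (p.1 `&` D) < +oo)%E) ->
  mu.-integrable D (EFin \o (fun x => coord (simple_fun s x) k)).
Proof.
move=> hs; under eq_fun do rewrite coord_simple_fun.
elim: s hs => [|p s IH] hs.
  by under eq_fun do rewrite big_nil; exact: integrable0.
have [mp _] := hs p (mem_head _ _).
have i1 : mu.-integrable D (EFin \o (fun x => (\1_(p.1) x : R) * coord p.2 k)).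
  apply: (bounded_integrable mD muD (M := `|coord p.2 k|)).
    by apply: measurable_funM => //; exact: measurable_indic.
  move=> x _; rewrite normrM ler_piMl// indicE; case: (x \in _); rewrite ?normr1 ?normr0//.
have i2 : mu.-integrable D (EFin \o (fun x => \sum_(p <- s) (\1_(p.1) x : R) * coord p.2 k)).
  by apply: IH => r rs; apply: hs; rewrite inE rs orbT.
by have := integrableD mD i1 i2; apply: eq_integrable => // x _ /=; rewrite big_cons.
Qed.

Lemma coord_simple_int s k :
  (forall p, p \in s -> measurable p.1 /\ (mu (p.1 `&` D) < +oo)%E) ->
  coord (simple_int mu D s) k = \int[mu]_(x in D) coord (simple_fun s x) k.
Proof.
move=> hs; under eq_Rintegral do rewrite coord_simple_fun.
rewrite /simple_int coord_sum.
elim: s hs => [|p s IH] hs.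
  by rewrite big_nil; under eq_Rintegral do rewrite big_nil; rewrite Rintegral_cst// mul0r.
have [mp _] := hs p (mem_head _ _).
have hs' r : r \in s -> measurable r.1 /\ (mu (r.1 `&` D) < +oo)%E.
  by move=> rs; apply: hs; rewrite inE rs orbT.
have iI : mu.-integrable D (EFin \o (fun x => \1_(p.1) x : R)).
  apply: (bounded_integrable mD muD (M := 1)); first exact: measurable_indic.
  by move=> x _; rewrite indicE; case: (x \in _); rewrite ?normr1 ?normr0.
have i1 : mu.-integrable D (EFin \o (fun x => (\1_(p.1) x : R) * coord p.2 k)).
  exact: (integrableZr mD (coord p.2 k) iI).
have i2 : mu.-integrable D (EFin \o (fun x => \sum_(p <- s) (\1_(p.1) x : R) * coord p.2 k)).
  by apply: eq_integrable (integrable_coord_simple_fun k hs') => // x _ /=; rewrite coord_simple_fun.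
under eq_Rintegral do rewrite big_cons.
rewrite big_cons RintegralD//.
rewrite IH// RintegralZr// coordZ; congr (_ * _ + _).
by rewrite /Rintegral integral_indic// setIC.
Qed.

(** Coordinates are contractions, so they commute with the limit of simple integrals. All Bochner
    integrals of [f] thus agree, and the one chosen by [xget] can be computed. *)
Lemma bochner_coord_unique f I k : is_bochner_integral mu D f I ->
  mu.-integrable D (EFin \o (fun x => coord (f x) k)) ->
  coord I k = \int[mu]_(x in D) coord (f x) k.
Proof.
move=> [s [hs _ ms cs cI]] fi.
have h1 : coord (simple_int mu D (s n)) k @[n --> \oo] --> coord I k.
  apply: coord_sub_cvg; apply/norm_cvg0P; rewrite -(subrr I).
  by apply: cvgB => //; exact: cvg_cst.
suff h2 : coord (simple_int mu D (s n)) k @[n --> \oo] --> \int[mu]_(x in D) coord (f x) k.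
  exact: (cvg_unique (@Rhausdorff R) h1 h2).
apply/cvgrPdist_le => e e0.
have /fine_cvgP[fn /cvgr0_norm_le /(_ e e0) h] := cs.
move: fn h; apply: filterS2 => n fn h.
have isn := integrable_coord_simple_fun k (hs n).
rewrite (coord_simple_int k (hs n)) -(RintegralB mD fi isn).
have iB : mu.-integrable D (EFin \o (fun x => coord (f x) k - coord (simple_fun (s n) x) k)).
  exact: (integrableB mD fi isn).
apply: le_trans (le_normr_Rintegral mD iB) _.
apply: le_trans (le_trans (ler_norm _) h); rewrite -lee_fin (fineK fn).
rewrite /Rintegral fineK; last first.
  by apply: integrable_fin_num => //; exact: integrable_norm.
apply: ge0_le_integral_nomeas => x Dx; rewrite lee_fin//.
by rewrite -coordB coord_le.
Qed.

(** Cauchy-Schwarz in each coordinate, then Parseval under the integral. *)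
Lemma sum_sqr_integral_le f (M : R) :
  (forall k, measurable_fun D (fun x => coord (f x) k)) ->
  (forall x, D x -> `|f x| <= M) ->
  (\sum_(k <oo) ((\int[mu]_(x in D) coord (f x) k) ^+ 2)%:E <=
   (fine (mu D))%:E * \int[mu]_(x in D) (`|f x| ^+ 2)%:E)%E.
Proof.
move=> mf fM.
have M0 x : D x -> 0 <= M by move=> Dx; exact: le_trans (fM x Dx).
apply: (@le_trans _ _ (\sum_(k <oo) ((fine (mu D))%:E * \int[mu]_(x in D) (coord (f x) k ^+ 2)%:E))%E).
  apply: lee_nneseries => k _; first by rewrite lee_fin sqr_ge0.
  have cM x : D x -> `|coord (f x) k| <= M by move=> Dx; exact: le_trans (coord_le _ _) (fM x Dx).
  have := Rintegral_sqr_le mD muD (mf k) cM; rewrite -lee_fin => /le_trans; apply.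
  rewrite EFinM; apply: lee_wpmul2l; first by rewrite lee_fin fine_ge0.
  rewrite /Rintegral fineK//; apply: integrable_fin_num => //.
  apply: (bounded_integrable mD muD (M := M ^+ 2)); first exact: measurable_funX.
  by move=> x Dx; rewrite normrX lerXn2r ?nnegrE ?cM// (M0 x Dx).
rewrite nneseriesZl; last by move=> k _; rewrite integral_ge0// => x _; rewrite lee_fin sqr_ge0.
rewrite -integral_nneseries//; last 2 first.
- by move=> k; apply/measurable_EFinP/measurable_funX.
- by move=> k x _; rewrite lee_fin sqr_ge0.
by under eq_integral do rewrite parseval.
Qed.

(** The candidate is synthesised from the coordinate integrals, which are square summable by
    [sum_sqr_integral_le]; the same estimate for f minus the simple functions shows that their
    integrals converge to it. *)
Lemma bochner_exists f (s : nat -> seq (set T * H R)) (M : R) :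
  (forall n p, p \in s n -> measurable p.1) ->
  (forall k, measurable_fun D (fun x => coord (f x) k)) ->
  (forall x, D x -> `|f x| <= M) ->
  (forall n x, D x -> `|simple_fun (s n) x| <= M) ->
  (forall x, D x -> simple_fun (s n) x @[n --> \oo] --> f x) ->
  exists I, is_bochner_integral mu D f I.
Proof.
move=> ms mf fM sM sf.
have hs n p : p \in s n -> measurable p.1 /\ (mu (p.1 `&` D) < +oo)%E.
  move=> /ms mp; split => //; apply: le_lt_trans muD.
  by apply: le_measure; rewrite ?inE//; exact: measurableI.
have mcs n k : measurable_fun D (fun x => coord (simple_fun (s n) x) k).
  by have /measurable_int/measurable_EFinP := integrable_coord_simple_fun k (hs n).
have md n k : measurable_fun D (fun x => coord (f x - simple_fun (s n) x) k).
  by under eq_fun do rewrite coordB; exact: measurable_funB.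
have mnd n : measurable_fun D (fun x => `|f x - simple_fun (s n) x|).
  exact: measurable_norm_coord.
have d2M n x : D x -> `|f x - simple_fun (s n) x| <= 2 * M.
  move=> Dx; apply: le_trans (ler_normB _ _) _.
  by have := fM x Dx; have := sM n x Dx; lra.
have dcv x : D x -> `|f x - simple_fun (s n) x| @[n --> \oo] --> (0 : R).
  move=> Dx; have h := sf x Dx; apply/norm_cvg0P; rewrite -(subrr (f x)).
  by apply: cvgB => //; exact: cvg_cst.
have mn : measurable_fun D (fun x => `|f x|) by exact: measurable_norm_coord.
have M0 x : D x -> 0 <= M by move=> Dx; exact: le_trans (fM x Dx).
have [I Ic] : exists I, coord I =1 (fun k => \int[mu]_(x in D) coord (f x) k).
  have [|I [Ic _]] := @riesz_fischer R (fun k => \int[mu]_(x in D) coord (f x) k); last by exists I.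
  apply: le_lt_trans (sum_sqr_integral_le mf fM) _.
  apply: (@le_lt_trans _ _ ((fine (mu D))%:E * \int[mu]_(x in D) (M ^+ 2)%:E)%E).
    apply: lee_wpmul2l; first by rewrite lee_fin fine_ge0.
    apply: ge0_le_integral_nomeas => x Dx; rewrite lee_fin ?sqr_ge0//.
    by rewrite lerXn2r ?nnegrE ?fM// (M0 x Dx).
  rewrite integral_cst// muleA -EFinM; apply: lte_mul_pinfty => //.
  by rewrite lee_fin mulr_ge0 ?fine_ge0 ?sqr_ge0.
exists I, s; split => //.
- by apply: filterE.
- apply/fine_cvgP; split.
    apply: nearW => n; apply: integrable_fin_num => //.
    by apply: (bounded_integrable mD muD (M := 2 * M)) => // x Dx; rewrite normr_id d2M.
  have -> : (0 : R) = \int[mu]_(x in D) (cst 0 x) by rewrite Rintegral_cst// mul0r.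
  apply: (Rdominated_cvg (h := cst (2 * M)) mD mnd) => //.
  + exact: filterE.
  + apply: (bounded_integrable mD muD (M := `|2 * M|)) => //.
  + by move=> n x Dx; rewrite normr_id d2M.
- have e2 : \int[mu]_(x in D) (`|f x - simple_fun (s n) x| ^+ 2) @[n --> \oo] --> (0 : R).
    have -> : (0 : R) = \int[mu]_(x in D) (cst 0 x) by rewrite Rintegral_cst// mul0r.
    apply: (Rdominated_cvg (h := cst ((2 * M) ^+ 2)) mD) => //.
    + by move=> n; exact: measurable_funX.
    + apply: filterE => x Dx; rewrite -(mulr0 (0 : R)); under eq_fun do rewrite expr2.
      by apply: cvgM; exact: dcv.
    + by apply: (bounded_integrable mD muD (M := `|(2 * M) ^+ 2|)).
    + move=> n x Dx; rewrite normrX normr_id /= lerXn2r ?nnegrE ?d2M//.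
      by rewrite mulr_ge0// (M0 x Dx).
  have sq : `|I - simple_int mu D (s n)| ^+ 2 @[n --> \oo] --> (0 : R).
    apply: (@squeeze_cvgr _ _ _ _ (fun=> 0) (fun n => fine (mu D) * \int[mu]_(x in D) (`|f x - simple_fun (s n) x| ^+ 2))).
    + near=> n; rewrite sqr_ge0/=.
      have iE : (\int[mu]_(x in D) (`|f x - simple_fun (s n) x| ^+ 2))%:E =
          (\int[mu]_(x in D) (`|f x - simple_fun (s n) x| ^+ 2)%:E)%E.
        rewrite /Rintegral fineK//; apply: integrable_fin_num => //.
        apply: (bounded_integrable mD muD (M := (2 * M) ^+ 2)); first exact: measurable_funX.
        move=> x Dx; rewrite normrX normr_id /= lerXn2r ?nnegrE ?d2M//.
        by rewrite mulr_ge0// (M0 x Dx).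
      rewrite -lee_fin -parseval EFinM iE.
      apply: le_trans (sum_sqr_integral_le (md n) (d2M n)).
      apply: lee_nneseries => k _; first by rewrite lee_fin sqr_ge0.
      rewrite lee_fin coordB Ic (coord_simple_int k (hs n)) -RintegralB//.
      * by under eq_Rintegral do rewrite -coordB.
      * apply: (bounded_integrable mD muD (M := M)) => // x Dx.
        exact: le_trans (coord_le _ _) (fM x Dx).
      * exact: (integrable_coord_simple_fun k (hs n)).
    + exact: cvg_cst.
    + by rewrite -[X in _ --> X](mulr0 (fine (mu D))); apply: cvgM => //; exact: cvg_cst.
  move/sqr_cvg0 : sq => h; apply/cvgrPdist_le => e e0.
  by move/cvgr0_norm_le : h => /(_ _ e0); apply: filterS => n; rewrite normr_id.
Unshelve. all: by end_near. Qed.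

End bochner_coordinates.

Section bochner_right_continuous.
Context {R : realType}.
Local Notation leb := (@lebesgue_measure R).
Variables (t M : R) (f : R -> H R).
Hypotheses (t0 : 0 <= t) (fM : forall s, s \in `[0, t] -> `|f s| <= M).
Hypothesis rc : forall s, 0 <= s < t -> forall eps, 0 < eps ->
  exists2 del, 0 < del & forall r, s < r < s + del -> r <= t -> `|f r - f s| <= eps.

Let node (m i : nat) : R := i%:R * t / m.+1%:R.

Let cell (m i : nat) : set R := [set` `[node m i, node m i.+1[].

(** On each cell the value at its right end point is taken: it lies strictly to the right of every
    point of the cell, where right continuity gives control. The singleton covers the end point t,
    which no cell contains. *)
Let step (m : nat) : seq (set R * H R) :=
  ([set t], f t) :: [seq (cell m i, f (node m i.+1)) | i <- index_iota 0 m.+1].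

Let step_end m : simple_fun (step m) t = f t.
Proof.
rewrite /simple_fun /step big_cons big_map /= indicE mem_set// scale1r.
rewrite big1_seq ?addr0// => i; rewrite mem_index_iota/= => im.
rewrite indicE memNset ?scale0r// /cell/= in_itv/= => /andP[_].
rewrite /node ltr_pdivlMr// mulrC ltNge ler_wpM2r// ler_nat; lia.
Qed.

Let step_mid m s : 0 <= s < t ->
  exists2 r, s < r <= s + t / m.+1%:R & r <= t /\ simple_fun (step m) s = f r.
Proof.
move=> /andP[s0 st]; have tp : 0 < t by exact: le_lt_trans st.
have m0 : 0 < m.+1%:R :> R by [].
pose i := Num.truncn (s * m.+1%:R / t).
have q0 : 0 <= s * m.+1%:R / t by rewrite divr_ge0 ?mulr_ge0.
have /andP[i1 i2] : i%:R <= s * m.+1%:R / t < i.+1%:R by exact: truncn_itv.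
have im : (i < m.+1)%N.
  rewrite -(ltr_nat R); apply: le_lt_trans i1 _.
  by rewrite ltr_pdivrMr// mulrC ltr_pM2l.
have si : node m i <= s by rewrite /node ler_pdivrMr// -ler_pdivlMr.
have si1 : s < node m i.+1 by rewrite /node ltr_pdivlMr// -ltr_pdivrMr.
exists (node m i.+1).
  have h : i.+1%:R = i%:R + 1 :> R by rewrite natr1.
  by rewrite si1/= (_ : node m i.+1 = node m i + t / m.+1%:R) ?lerD2r// /node h !mulrDl mul1r.
split.
  by rewrite /node ler_pdivrMr// mulrC ler_wpM2l// ler_nat.
rewrite /simple_fun /step big_cons big_map /= indicE memNset ?scale0r ?add0r; last first.
  by move=> /= st'; rewrite st' ltxx in st.
have iI : i \in index_iota 0 m.+1 by rewrite mem_index_iota.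
rewrite (bigD1_seq i iI (iota_uniq _ _))/= indicE mem_set/=; last first.
  by rewrite /cell/= in_itv/= si si1.
rewrite scale1r big1_seq ?addr0// => j /andP[ji _].
rewrite indicE memNset ?scale0r// /cell/= in_itv/= => /andP[j1 j2].
have h1 : j%:R < i.+1%:R :> R.
  have := le_lt_trans j1 si1; rewrite /node ltr_pM2r ?invr_gt0// ltr_pM2r//.
have h2 : i%:R < j.+1%:R :> R.
  have := le_lt_trans si j2; rewrite /node ltr_pM2r ?invr_gt0// ltr_pM2r//.
by move: h1 h2 ji; rewrite !ltr_nat !ltnS eqn_leq => -> ->.
Qed.

Let step_in m s : s \in `[0, t] -> exists2 r, r \in `[0, t] & simple_fun (step m) s = f r.
Proof.
rewrite in_itv/= => /andP[s0]; rewrite le_eqVlt => /predU1P[->|st].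
  by exists t; rewrite ?step_end// in_itv/= t0 lexx.
have [|r /andP[r1 _] [r2 r3]] := @step_mid m s; first by rewrite s0.
by exists r => //; rewrite in_itv/= r2 (le_trans s0 (ltW r1)).
Qed.

Let step_cvg s : s \in `[0, t] -> simple_fun (step m) s @[m --> \oo] --> f s.
Proof.
rewrite in_itv/= => /andP[s0]; rewrite le_eqVlt => /predU1P[->|st].
  by under eq_fun do rewrite step_end; exact: cvg_cst.
apply/cvgrPdist_le => e e0.
have sI : 0 <= s < t by rewrite s0.
have [del d0 hd] := rc sI e0.
have tp : 0 < t by exact: le_lt_trans st.
exists (Num.truncn (t / del)).+1 => // m /= hm.
have [r /andP[r1 r2] [r3 ->]] := @step_mid m s sI.
rewrite distrC; apply: hd => //; rewrite r1/=.
apply: le_lt_trans r2 _; rewrite ltrD2l ltr_pdivrMr// mulrC -ltr_pdivrMr//.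
have q0 : 0 <= t / del by rewrite divr_ge0 ?ltW.
have /andP[_ h] := truncn_itv q0; apply: lt_le_trans h _.
by rewrite ler_nat leqW.
Qed.

Let mI : measurable (`[0, t] : set R). Proof. exact: measurable_itv. Qed.

Let leb_lty : (leb `[0%R, t] < +oo)%E.
Proof. by rewrite lebesgue_measure_itv/=; case: ifP => _; rewrite ?ltry// sube0 ltry. Qed.

Lemma measurable_coord_right_continuous k :
  measurable_fun (`[0, t] : set R) (fun s => coord (f s) k).
Proof.
apply: (@measurable_fun_cvg _ _ _ _ (fun m s => coord (simple_fun (step m) s) k)).
  move=> m; have : leb.-integrable `[0, t] (EFin \o (fun x => coord (simple_fun (step m) x) k)).
    apply: (@integrable_coord_simple_fun _ _ _ leb `[0, t]%classic mI leb_lty) => p.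
    rewrite inE => /orP[/eqP->|/mapP[i _ ->]]; split => /=.
    - exact: measurable_set1.
    - by apply: le_lt_trans leb_lty; apply: le_measure; rewrite ?inE//; apply: measurableI => //; exact: measurable_set1.
    - exact: measurable_itv.
    - by apply: le_lt_trans leb_lty; apply: le_measure; rewrite ?inE//; apply: measurableI => //; exact: measurable_itv.
  by move/measurable_int/measurable_EFinP.
move=> s sI; apply: coord_sub_cvg; apply/norm_cvg0P; rewrite -(subrr (f s)).
by apply: cvgB; [exact: step_cvg|exact: cvg_cst].
Qed.

(** [bochner_exists] rules out the default value of [bochner_integral], and [bochner_coord_unique]
    computes it. *)
Lemma coord_bochner_right_continuous k :
  coord (bochner_integral leb `[0, t] f) k = \int[leb]_(s in `[0, t]) coord (f s) k.
Proof.
have mc := measurable_coord_right_continuous.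
have [I bI] : exists I, is_bochner_integral leb `[0, t] f I.
  apply: (@bochner_exists _ _ _ leb `[0, t]%classic mI leb_lty f step M) => //.
  - move=> n p; rewrite inE => /orP[/eqP->|/mapP[i _ ->]] /=; first exact: measurable_set1.
    exact: measurable_itv.
  - by move=> n s sI; have [r rI E] := step_in n sI; have := fM rI; rewrite -E.
have bJ := @xgetPex _ 0 (is_bochner_integral leb `[0, t] f) (ex_intro _ I bI).
apply: (@bochner_coord_unique _ _ _ leb `[0, t]%classic mI leb_lty _ _ _ bJ).
apply: (@bounded_integrable _ _ _ leb `[0, t]%classic mI leb_lty _ M (mc k)) => s sI.
by apply: (le_trans (coord_le _ _)); exact: fM.
Qed.

End bochner_right_continuous.

(** * Contractivity and strong continuity of the heat semigroup *)

Section heat_semigroup.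
Context {R : realType}.
Implicit Types (u v w : H R) (k n : nat) (r s t : R).

Lemma sum_coord_sqr_le n v : \sum_(k < n) coord v k ^+ 2 <= `|v| ^+ 2.
Proof.
rewrite -lee_fin -parseval -sumEFin -(big_mkord xpredT (fun k => (coord v k ^+ 2)%:E)).
by apply: nneseries_lim_ge => k _; rewrite lee_fin sqr_ge0.
Qed.

Lemma norm_le_coord u v : (forall k, `|coord u k| <= `|coord v k|) -> `|u| <= `|v|.
Proof.
move=> h; rewrite -(@ler_pXn2r _ 2)// ?nnegrE//.
rewrite -lee_fin -!parseval; apply: lee_nneseries => k _; first by rewrite lee_fin sqr_ge0.
by rewrite lee_fin -(real_normK (num_real (coord u k))) -(real_normK (num_real (coord v k))) lerXn2r ?nnegrE.
Qed.

Lemma Hr_le_coord r u v : (forall k, `|coord u k| <= `|coord v k|) -> Hr r v ->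
  Hr r u /\ Hr_norm r u <= Hr_norm r v.
Proof.
move=> h vr.
have le : (hsum r u <= hsum r v)%E.
  apply: lee_nneseries => k _; first by rewrite lee_fin sqr_ge0.
  rewrite lee_fin !exprMn ler_wpM2l ?sqr_ge0//.
  by rewrite -(real_normK (num_real (coord u k))) -(real_normK (num_real (coord v k))) lerXn2r ?nnegrE.
have ur : Hr r u by apply/HrP/(le_lt_trans le)/HrP.
split => //; rewrite -(@ler_pXn2r _ 2)// ?nnegrE ?Hr_norm_ge0//.
by rewrite -lee_fin -!hsumE.
Qed.

Lemma heat_coord_le t v k : 0 <= t -> `|coord (heat t v) k| <= `|coord v k|.
Proof.
move=> t0; rewrite coord_heat// normrM ler_piMl//.
by rewrite ger0_norm ?expR_ge0// expR_le1 oppr_le0 mulr_ge0// ltW// lam_gt0.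
Qed.

Lemma heat_norm_le t v : 0 <= t -> `|heat t v| <= `|v|.
Proof. by move=> t0; apply: norm_le_coord => k; exact: heat_coord_le. Qed.

Lemma heatB t u v : 0 <= t -> heat t (u - v) = heat t u - heat t v.
Proof. by move=> t0; apply: coord_inj => k; rewrite !(coordB, coord_heat)// mulrBr. Qed.

Lemma heat_Hr r t v : 0 <= t -> Hr r v -> Hr r (heat t v) /\ Hr_norm r (heat t v) <= Hr_norm r v.
Proof. by move=> t0; apply: Hr_le_coord => k; exact: heat_coord_le. Qed.

Lemma expR_opp_lip (a b : R) : 0 <= a -> 0 <= b -> `|expR (- a) - expR (- b)| <= `|a - b|.
Proof.
wlog ab : a b / a <= b => [hw|a0 b0].
  have /orP[ab|ba] := le_total a b; first exact: hw.
  by move=> a0 b0; rewrite distrC (distrC a); apply: hw.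
have e1 : expR (- b) <= expR (- a) by rewrite ler_expR lerN2.
rewrite ger0_norm ?subr_ge0// distrC ger0_norm ?subr_ge0//.
have -> : expR (- b) = expR (- a) * expR (a - b) by rewrite -expRD; congr expR; ring.
have h1 := expR_ge1Dx (a - b).
have h2 : expR (- a) <= 1 by rewrite expR_le1 oppr_le0.
have h3 : expR (a - b) <= 1 by rewrite expR_le1 subr_le0.
have h4 := expR_ge0 (- a); nra.
Qed.

Lemma lam_mono i j : (i <= j)%N -> lam i <= lam j :> R.
Proof.
move=> ij; rewrite /lam lerXn2r ?nnegrE ?mulr_ge0 ?pi_ge0//.
by rewrite ler_wpM2r ?pi_ge0// ler_nat ltnS.
Qed.

Lemma heat_synth_lip n r t v : 0 <= r -> 0 <= t ->
  `|heat r (synth n (coord v)) - heat t (synth n (coord v))| <= `|r - t| * lam n * `|v|.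
Proof.
move=> r0 t0; have l0 : (0 : R) < lam n := lam_gt0 n.
have -> : `|r - t| * lam n * `|v| = `|(`|r - t| * lam n) *: v|.
  by rewrite normrZ ger0_norm// mulr_ge0// ltW.
apply: norm_le_coord => k; rewrite coordB !coord_heat// coord_synth coordZ -mulrBl.
case: ltnP => kn; last by rewrite mulr0 normr0.
rewrite (normrM (_ - _)) (normrM (_ * _)) ler_wpM2r// (normrM `|r - t|) normr_id (ger0_norm (ltW l0)).
have lk0 : (0 : R) < lam k := lam_gt0 k.
apply: le_trans (expR_opp_lip (mulr_ge0 r0 (ltW lk0)) (mulr_ge0 t0 (ltW lk0))) _.
by rewrite -mulrBl normrM (ger0_norm (ltW lk0)) ler_wpM2l// lam_mono// ltnW.
Qed.

Lemma synth_cvg v : `|v - synth n (coord v)| @[n --> \oo] --> (0 : R).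
Proof.
have [|w [wv cv]] := @riesz_fischer R (coord v); first by rewrite parseval ltry.
have vw : w = v by exact: coord_inj.
by rewrite vw in cv.
Qed.

(** The orbit of a finite section of [v] is Lipschitz in time; the remainder is small uniformly in
    time because the semigroup is contractive. *)
Lemma heat_continuous v t : 0 <= t -> forall eps, 0 < eps ->
  exists2 del, 0 < del & forall r, 0 <= r -> `|r - t| < del -> `|heat r v - heat t v| <= eps.
Proof.
move=> t0 eps e0; have e3 : 0 < eps / 3 by rewrite divr_gt0.
have /cvgr0_norm_le /(_ _ e3) [n _ hn] := synth_cvg v.
have {hn} := hn n (leqnn n); rewrite /= normr_id => hn.
have l0 : (0 : R) < lam n := lam_gt0 n; have v1 : 0 < `|v| + 1 by rewrite ltr_pwDr.
exists (eps / 3 / (lam n * (`|v| + 1))); first by rewrite divr_gt0// mulr_gt0.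
have lv := mulr_gt0 l0 v1; move=> r r0; rewrite ltr_pdivlMr// => hr.
set vn := synth n (coord v) in hn.
have -> : heat r v - heat t v = heat r (v - vn) + (heat r vn - heat t vn) - heat t (v - vn).
  by rewrite !heatB// addrA subrK opprB addrA subrK.
have h1 := heat_norm_le (v - vn) r0; have h2 := heat_norm_le (v - vn) t0.
have h3 := heat_synth_lip n v r0 t0; rewrite -/vn in h3.
have h4 : `|r - t| * lam n * `|v| <= `|r - t| * (lam n * (`|v| + 1)).
  by rewrite -mulrA ler_wpM2l// ler_wpM2l ?lerDl// ltW.
have h5 := ler_normB (heat r (v - vn) + (heat r vn - heat t vn)) (heat t (v - vn)).
have h6 := ler_normD (heat r (v - vn)) (heat r vn - heat t vn).
have -> : eps = eps / 3 + eps / 3 + eps / 3 by field.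
apply: le_trans h5 _; apply: lerD; last exact: le_trans h2 hn.
apply: le_trans h6 _; apply: lerD; first exact: le_trans h1 hn.
exact: le_trans h3 (le_trans h4 (ltW hr)).
Qed.

End heat_semigroup.

(** * Duhamel integrals and parabolic smoothing *)

Section duhamel.
Context {R : realType}.
Local Notation leb := (@lebesgue_measure R).
Implicit Types (t M : R) (g : R -> H R).

(** This class contains both the drift along a continuous path and the step functions of the
    scheme. *)
Definition right_cont t g := forall s, 0 <= s < t -> forall eps, 0 < eps ->
  exists2 del, 0 < del & forall r, s < r < s + del -> r <= t -> `|g r - g s| <= eps.

Lemma right_cont_le t t' g : t' <= t -> right_cont t g -> right_cont t' g.
Proof.
move=> tt rg s /andP[s0 st] eps e0.
have [|del d0 hd] := rg s _ eps e0; first by rewrite s0 (lt_le_trans st).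
by exists del => // r hr rt; apply: hd => //; exact: le_trans rt tt.
Qed.

Lemma right_cont_heat t g : right_cont t g -> right_cont t (fun s => heat (t - s) (g s)).
Proof.
move=> rg s sI eps e0; have /andP[s0 st] := sI.
have e2 : 0 < eps / 2 by rewrite divr_gt0.
have [d1 d10 h1] := rg s sI _ e2.
have ts : 0 <= t - s by rewrite subr_ge0 ltW.
have [d2 d20 h2] := heat_continuous (g s) ts e2.
exists (Num.min d1 d2); first by rewrite lt_min d10.
move=> r /andP[sr rd] rt; have tr : 0 <= t - r by rewrite subr_ge0.
have [rd1 rd2] : r < s + d1 /\ r < s + d2.
  by move: rd; rewrite -!ltrBlDl lt_min => /andP[].
have -> : heat (t - r) (g r) - heat (t - s) (g s) =
    heat (t - r) (g r - g s) + (heat (t - r) (g s) - heat (t - s) (g s)).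
  by rewrite heatB// addrA subrK.
have h3 := h1 r _ rt; rewrite sr rd1 in h3; have {}h3 := h3 isT.
have h4 := heat_norm_le (g r - g s) tr.
have h5 : `|heat (t - r) (g s) - heat (t - s) (g s)| <= eps / 2.
  apply: h2 => //; rewrite (_ : t - r - (t - s) = s - r); last ring.
  by rewrite ltr_norml; apply/andP; split; lra.
have h6 := ler_normD (heat (t - r) (g r - g s)) (heat (t - r) (g s) - heat (t - s) (g s)).
lra.
Qed.

Definition duhamel t g : H R :=
  bochner_integral leb `[0, t] (fun s => heat (t - s) (g s)).

Lemma coord_duhamel t M g k : 0 <= t -> (forall s, s \in `[0, t] -> `|g s| <= M) ->
  right_cont t g ->
  coord (duhamel t g) k = \int[leb]_(s in `[0, t]) (expR (- ((t - s) * lam k)) * coord (g s) k).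
Proof.
move=> t0 gM rg; rewrite /duhamel (@coord_bochner_right_continuous _ t M)//; last 2 first.
- move=> s sI; apply: le_trans (gM s sI); apply: heat_norm_le.
  by move: sI; rewrite in_itv/= subr_ge0 => /andP[].
- exact: right_cont_heat.
apply: eq_Rintegral => s; rewrite inE/= in_itv/= => /andP[_ st].
by rewrite coord_heat// subr_ge0.
Qed.

Lemma measurable_coord_right_cont t g k : 0 <= t -> right_cont t g -> measurable_fun (`[0, t] : set R) (fun s => coord (g s) k).
Proof. by move=> t0 rg; exact: (measurable_coord_right_continuous t0 rg k). Qed.

Lemma heat_kernel_sqr (l t : R) : 0 <= t -> 0 < l ->
  \int[leb]_(s in `[0, t]) (expR (- ((t - s) * l)) ^+ 2) <= 1 / (2 * l).
Proof.
move=> t0 l0.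
have dF (x : R) : is_derive x 1 (fun s : R => expR (- ((t - s) * l)) ^+ 2 / (2 * l))
    (expR (- ((t - x) * l)) ^+ 2).
  apply: is_derive_eq; rewrite /GRing.scale/=; field.
  by rewrite gt_eqF.
have cf : continuous (fun s : R => expR (- ((t - s) * l)) ^+ 2).
  move=> x; apply: (@continuous_comp _ _ _ (fun s : R => expR (- ((t - s) * l))) (fun y : R => y ^+ 2)); last exact: exprn_continuous.
  apply: (@continuous_comp _ _ _ (fun s : R => - ((t - s) * l)) (@expR R)).
    by apply: cvgN; apply: cvgM; [apply: cvgB; [exact: cvg_cst|exact: cvg_id]|exact: cvg_cst].
  exact: continuous_expR.
rewrite (Rintegral_FTC2 t0 cf dF) subrr mul0r oppr0 expR0 expr1n gerBl.
by rewrite divr_ge0 ?sqr_ge0// mulr_ge0// ltW.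
Qed.

(* The weight lam^(2 rho) costs at most lam, which is what the square integral of e^(-lam s) gains. *)
Lemma smoothing (rho t M : R) g (D : H R) : rho <= 1 / 2 -> 0 <= t ->
  (forall s, s \in `[0, t] -> `|g s| <= M) ->
  (forall k, measurable_fun (`[0, t] : set R) (fun s => coord (g s) k)) ->
  (forall k, `|coord D k| <=
     `|\int[leb]_(s in `[0, t]) (expR (- ((t - s) * lam k)) * coord (g s) k)|) ->
  Hr rho D /\ Hr_norm rho D ^+ 2 <= 1 / 2 * \int[leb]_(s in `[0, t]) (`|g s| ^+ 2).
Proof.
move=> r2 t0 gM mg hD.
have mI : measurable (`[0, t] : set R) by exact: measurable_itv.
have lI : (leb `[0%R, t] < +oo)%E.
  by rewrite lebesgue_measure_itv/=; case: ifP => _; rewrite ?ltry// sube0 ltry.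
have M0 : 0 <= M by apply: le_trans (gM 0 _); rewrite ?in_itv/= ?lexx.
have bd k s : `[0, t]%classic s -> `|coord (g s) k| <= M.
  by move=> sI; apply: le_trans (coord_le _ _) _; exact: gM.
have mn : measurable_fun (`[0, t] : set R) (fun s => `|g s|) by exact: measurable_norm_coord.
have ig2 : leb.-integrable `[0, t] (EFin \o (fun s => `|g s| ^+ 2)).
  apply: (@bounded_integrable _ _ _ leb `[0, t]%classic mI lI _ (M ^+ 2)).
    exact: measurable_funX.
  by move=> s sI; rewrite normrX normr_id lerXn2r ?nnegrE//; exact: gM.
have igk k : leb.-integrable `[0, t] (EFin \o (fun s => coord (g s) k ^+ 2)).
  apply: (@bounded_integrable _ _ _ leb `[0, t]%classic mI lI _ (M ^+ 2)).
    by apply: measurable_funX; exact: mg.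
  by move=> s sI; rewrite normrX lerXn2r ?nnegrE//; exact: bd.
have me k : measurable_fun (`[0, t] : set R) (fun s : R => expR (- ((t - s) * lam k))).
  apply: (@measurableT_comp _ _ _ _ _ _ (@expR R)); first exact: measurable_expR.
  by apply: measurableT_comp => //; apply: measurable_funM => //; exact: measurable_funB.
have be k (s : R) : `[0, t]%classic s -> `|expR (- ((t - s) * lam k))| <= 1.
  rewrite /= in_itv/= => /andP[_ st]; rewrite ger0_norm ?expR_ge0// expR_le1 oppr_le0.
  by rewrite mulr_ge0 ?subr_ge0// ltW// lam_gt0.
have key k : (lam k `^ rho * coord D k) ^+ 2 <= 1 / 2 * \int[leb]_(s in `[0, t]) (coord (g s) k ^+ 2).
  have l1 : (1 : R) <= lam k := lam_ge1 k; have l0 : (0 : R) < lam k := lam_gt0 k.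
  set c := \int[leb]_(s in `[0, t]) (coord (g s) k ^+ 2).
  have c0 : 0 <= c by apply: Rintegral_ge0 => s _; exact: sqr_ge0.
  have h1 : coord D k ^+ 2 <= 1 / (2 * lam k) * c.
    apply: (@le_trans _ _ ((\int[leb]_(s in `[0, t]) (expR (- ((t - s) * lam k)) * coord (g s) k)) ^+ 2)).
      rewrite -(real_normK (num_real (coord D k))) -[leRHS](real_normK (num_real _)).
      by rewrite lerXn2r ?nnegrE//; exact: hD.
    apply: le_trans (@Rintegral_CauchySchwarz _ _ _ leb `[0, t]%classic mI lI _ _ _ _ (me k) (mg k) (be k) (bd k)) _.
    by rewrite ler_wpM2r//; exact: heat_kernel_sqr.
  have h2 : (lam k `^ rho) ^+ 2 <= lam k.
    rewrite -powR_mulrn ?powR_ge0// -powRrM -[leRHS]powRr1 ?(ltW l0)//.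
    by apply: ler_powR => //; lra.
  rewrite exprMn; apply: (@le_trans _ _ (lam k * (1 / (2 * lam k) * c))).
    by rewrite ler_pM ?sqr_ge0.
  rewrite (_ : lam k * _ = 1 / 2 * c)//; field.
  by rewrite gt_eqF.
have ek k : (\int[leb]_(s in `[0%R, t]) (coord (g s) k ^+ 2)%:E = (\int[leb]_(s in `[0%R, t]) (coord (g s) k ^+ 2))%:E)%E.
  by rewrite /Rintegral fineK//; exact: (@integrable_fin_num _ _ _ leb `[0, t]%classic mI _ (igk k)).
have en : (\int[leb]_(s in `[0%R, t]) (`|g s| ^+ 2)%:E = (\int[leb]_(s in `[0%R, t]) (`|g s| ^+ 2))%:E)%E.
  by rewrite /Rintegral fineK//; exact: (@integrable_fin_num _ _ _ leb `[0, t]%classic mI _ ig2).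
have le : (hsum rho D <= (1 / 2 * \int[leb]_(s in `[0, t]) (`|g s| ^+ 2))%:E)%E.
  have e1 : (hsum rho D <= \sum_(k <oo) ((1 / 2)%:E * \int[leb]_(s in `[0%R, t]) (coord (g s) k ^+ 2)%:E))%E.
    apply: lee_nneseries => k _; first by rewrite lee_fin sqr_ge0.
    by rewrite ek -EFinM lee_fin; exact: key.
  apply: le_trans e1 _; rewrite nneseriesZl; last by move=> k _; rewrite integral_ge0// => x _; rewrite lee_fin sqr_ge0.
  rewrite -integral_nneseries//; last 2 first.
  - by move=> k; apply/measurable_EFinP; apply: measurable_funX; exact: mg.
  - by move=> k x _; rewrite lee_fin sqr_ge0.
  under eq_integral do rewrite parseval.
  rewrite [leRHS]EFinM; apply: lee_wpmul2l; first by rewrite lee_fin.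
  by rewrite -en.
have Dr : Hr rho D by apply/HrP; exact: le_lt_trans le (ltry _).
by split => //; rewrite -lee_fin -hsumE.
Qed.

End duhamel.

Lemma le_1Dsqr (R : realFieldType) (a b : R) : a ^+ 2 <= b -> a <= 1 + b.
Proof. by move=> h; have := sqr_ge0 (a - 1 / 2); nra. Qed.

Lemma sqrD_le (R : realFieldType) (a b : R) : (a + b) ^+ 2 <= 2 * a ^+ 2 + 2 * b ^+ 2.
Proof. by have := sqr_ge0 (a - b); nra. Qed.

Lemma lipschitz_factor_le (R : realFieldType) (C a b k : R) : 0 <= C -> 0 <= a -> 0 <= b ->
  a <= k -> b <= k -> C * (1 + a + b) <= (2 * C + 1) * (1 + k).
Proof. by nra. Qed.

Lemma gronwall_terms_le (R : realFieldType) (y1 y2 w a : R) :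
  y1 <= y2 -> y1 + (w - (a + y2)) + a <= w.
Proof. by lra. Qed.

Lemma cancel_common (R : realFieldType) (a b c d : R) : a - (b + c + (a - b - d)) = d - c.
Proof. ring. Qed.

Lemma leb_itv0_lty (R : realType) (t : R) : (@lebesgue_measure R `[0%R, t] < +oo)%E.
Proof. by rewrite lebesgue_measure_itv/=; case: ifP => _; rewrite ?ltry// sube0 ltry. Qed.

Lemma bounded_integrable_itv (R : realType) (t M : R) (f : R -> R) :
  measurable_fun (`[0, t] : set R) f -> (forall s, s \in `[0, t] -> `|f s| <= M) ->
  (@lebesgue_measure R).-integrable `[0, t] (EFin \o f).
Proof.
move=> mf fM.
exact: (@bounded_integrable _ _ _ (@lebesgue_measure R) `[0, t]%classic (measurable_itv _) (leb_itv0_lty t) _ M mf).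
Qed.

Lemma Rintegral_itv_le (R : realType) (t M : R) (f : R -> R) : 0 <= t ->
  measurable_fun (`[0, t] : set R) f -> (forall s, s \in `[0, t] -> 0 <= f s <= M) ->
  \int[@lebesgue_measure R]_(s in `[0, t]) f s <= M * t.
Proof.
move=> t0 mf fM.
have iM (g : R -> R) : measurable_fun (`[0, t] : set R) g -> (forall s, s \in `[0, t] -> `|g s| <= M) ->
  (@lebesgue_measure R).-integrable `[0, t] (EFin \o g) by exact: bounded_integrable_itv.
have lE : fine (@lebesgue_measure R `[0, t]) = t.
  rewrite lebesgue_measure_itv/= lte_fin; case: ifPn => [_|]; first by rewrite sube0.
  by rewrite -leNgt => h; apply/eqP; rewrite eq_le h t0.
have /fM/andP[h1 h2] : 0 \in `[0, t] by rewrite in_itv/= lexx.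
have M0 : 0 <= M := le_trans h1 h2.
rewrite -[X in _ * X]lE -Rintegral_cst; last exact: measurable_itv.
apply: le_Rintegral; first exact: measurable_itv.
- by apply: iM => // s /fM/andP[h3 h4]; rewrite ger0_norm.
- by apply: iM => // s sI; rewrite ger0_norm.
- by move=> s sI; have /andP[] := fM s sI.
Qed.

(** * The time grid, step functions and compactness of [0,T] *)

Section grid.
Context {R : realType}.
Implicit Types (h s t T : R) (j n : nat).

Lemma round_down_cell h j s : 0 < h -> j%:R * h <= s < j.+1%:R * h ->
  round_down h s = j%:R * h.
Proof.
move=> h0 /andP[js sj]; rewrite /round_down.
set S := [set x | _]; have Sj : S (j%:R * h) by split => //; exists j%:Z.
have ub : ubound S (j%:R * h).
  move=> x [xs [k xk]]; rewrite xk ler_pM2r// -[j%:R]/(j%:Z%:~R) ler_int.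
  have : k%:~R < (j.+1%:Z)%:~R :> R by rewrite -(ltr_pM2r h0) -xk; exact: le_lt_trans sj.
  by rewrite ltr_int; lia.
apply/eqP; rewrite eq_le; apply/andP; split; first by apply: ge_sup => //; exists (j%:R * h).
by apply: ub_le_sup => //; exists (j%:R * h).
Qed.

Lemma grid_cell h s : 0 < h -> 0 <= s -> exists j, j%:R * h <= s < j.+1%:R * h.
Proof.
move=> h0 s0; exists (Num.truncn (s / h)).
have /truncn_itv/andP[h1 h2] : 0 <= s / h by rewrite divr_ge0// ltW.
by rewrite -ler_pdivlMr// h1 -ltr_pdivrMr.
Qed.

Lemma round_down_grid h s : 0 < h -> 0 <= s ->
  exists2 j, round_down h s = j%:R * h & j%:R * h <= s < j%:R * h + h.
Proof.
move=> h0 s0; have [j hj] := grid_cell h0 s0; exists j; first exact: round_down_cell.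
by rewrite [X in _ < X](_ : _ = j.+1%:R * h)// -natr1 mulrDl mul1r.
Qed.

Lemma right_cont_step h t (Psi : R -> H R) : 0 < h ->
  right_cont t (fun s => Psi (round_down h s)).
Proof.
move=> h0 s /andP[s0 st] eps e0; have [j hj] := grid_cell h0 s0.
have /andP[j1 j2] := hj; exists (j.+1%:R * h - s); first by rewrite subr_gt0.
move=> r /andP[sr]; rewrite addrC subrK => rj _.
have hr : j%:R * h <= r < j.+1%:R * h by rewrite rj (le_trans j1 (ltW sr)).
by rewrite (round_down_cell h0 hj) (round_down_cell h0 hr) subrr normr0 ltW.
Qed.

(** Up to time t only finitely many grid points, hence finitely many values of the arbitrary
    function [Psi], are met. *)
Lemma bounded_step h t (Psi : R -> H R) : 0 < h ->
  exists2 M, 0 <= M & forall s, s \in `[0, t] -> `|Psi (round_down h s)| <= M.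
Proof.
move=> h0; exists (\sum_(i < (Num.truncn (t / h)).+1) `|Psi (i%:R * h)|).
  by apply: sumr_ge0.
move=> s; rewrite in_itv/= => /andP[s0 st].
have [j -> /andP[j1 _]] := round_down_grid h0 s0.
have jt : (j < (Num.truncn (t / h)).+1)%N.
  have t0 : 0 <= t / h by rewrite divr_ge0 ?(ltW h0)// (le_trans s0).
  have /andP[_ h2] := truncn_itv t0.
  by rewrite -(ltr_nat R); apply: le_lt_trans h2; rewrite ler_pdivlMr// (le_trans j1).
by rewrite (bigD1 (Ordinal jt))//= lerDl sumr_ge0.
Qed.

(** Compactness of [0,T]. The index [n] serves in turn as a bound on the path, as an inverse radius
    in the modulus of continuity, and as a projection level. *)
Lemma itv_uniform T (Q : nat -> R -> Prop) :
  (forall s, s \in `[0, T] -> exists N, exists2 del, 0 < del & forall r, r \in `[0, T] ->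
     `|r - s| < del -> forall n, (N <= n)%N -> Q n r) ->
  exists N, forall n, (N <= n)%N -> forall r, r \in `[0, T] -> Q n r.
Proof.
move=> hQ; have := @segment_compact R 0 T.
move=> /compact_near_coveringP/near_covering_withinP/(_ nat \oo Q _).
have h : forall x, `[0, T]%classic x -> \forall x' \near x & i \near \oo, `[0, T]%classic x' -> Q i x'.
  move=> s sI; have [N [del d0 hd]] := hQ s sI.
  exists (ball s del, [set n | (N <= n)%N]); first by split; [exact: nbhsx_ballx|exists N].
  move=> [r n] /= [rb nN] rI; apply: hd => //.
  by move: rb; rewrite /ball/= distrC.
by move=> /(_ h) [N _ hN]; exists N => n nN r rI; apply: (hN n nN).
Qed.

End grid.

(** * The spectral projections *)

Section projection.
Context {R : realType}.
Implicit Types (u v : H R) (n k : nat).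

Definition proj n v : H R := synth n (coord v).

Lemma coord_proj n v k : coord (proj n v) k = if (k < n)%N then coord v k else 0.
Proof. exact: coord_synth. Qed.

Lemma proj_coord_le n v k : `|coord (proj n v) k| <= `|coord v k|.
Proof. by rewrite coord_proj; case: ifP => //; rewrite normr0. Qed.

Lemma projB n u v : proj n (u - v) = proj n u - proj n v.
Proof. by apply: coord_inj => k; rewrite !(coordB, coord_proj); case: ifP; rewrite ?subr0. Qed.

Lemma projD n u v : proj n (u + v) = proj n u + proj n v.
Proof. by apply: coord_inj => k; rewrite !(coordD, coord_proj); case: ifP; rewrite ?addr0. Qed.

Lemma proj_heat n t v : 0 <= t -> proj n (heat t v) = heat t (proj n v).
Proof.
by move=> t0; apply: coord_inj => k; rewrite coord_heat// !coord_proj coord_heat//; case: ifP; rewrite ?mulr0.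
Qed.

Lemma proj_Hr r n v : Hr r (proj n v). Proof. exact: Hr_synth. Qed.

Lemma Hr_norm_proj r n v : Hr r v -> Hr_norm r (proj n v) <= Hr_norm r v.
Proof. by move=> vr; have [] := @Hr_le_coord _ r (proj n v) v (proj_coord_le n v) vr. Qed.

Lemma norm_proj n v : `|proj n v| <= `|v|.
Proof. by apply: norm_le_coord; exact: proj_coord_le. Qed.

Lemma proj_cvg_Hr r v : Hr r v -> Hr_norm r (v - proj n v) @[n --> \oo] --> (0 : R).
Proof.
move=> vr; have := synth_cvg (opow r v).
have e n : Hr_norm r (v - proj n v) = `|opow r v - synth n (coord (opow r v))|.
  rewrite Hr_normE; congr `|_|; apply: coord_inj => k.
  rewrite coord_opow ?coordB ?coord_proj ?coord_synth ?coord_opow//; last exact: (HrB vr (proj_Hr _ _ _)).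
  by case: ifP; rewrite ?subrr ?mulr0 ?subr0.
by under [X in _ -> (X @ _) --> _]eq_fun do rewrite e.
Qed.

Lemma coord_duhamel_step h t n (Psi : R -> H R) k : 0 < h -> 0 <= t ->
  coord (bochner_integral lebesgue_measure `[0, t]
    (fun s => proj n (heat (t - s) (Psi (round_down h s))))) k =
  if (k < n)%N then
    \int[lebesgue_measure]_(s in `[0, t]) (expR (- ((t - s) * lam k)) * coord (Psi (round_down h s)) k)
  else 0.
Proof.
move=> h0 t0; pose g s := proj n (Psi (round_down h s)).
have [M M0 hM] := bounded_step t Psi h0.
have gM s : s \in `[0, t] -> `|g s| <= M by move=> sI; apply: le_trans (norm_proj _ _) (hM s sI).
have rg : right_cont t g  := @right_cont_step _ h t (fun s => proj n (Psi s)) h0.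
rewrite (@coord_bochner_right_continuous _ t M)//; last 2 first.
- move=> s sI; apply: le_trans (norm_proj _ _) _; apply: le_trans (hM s sI); apply: heat_norm_le.
  by move: sI; rewrite in_itv/= subr_ge0 => /andP[].
- move=> s sI eps e0; have [del d0 hd] := right_cont_heat rg sI e0.
  exists del => // r sr rt; have /andP[s0 st] := sI.
  by rewrite !proj_heat ?subr_ge0 ?(ltW st)//; exact: hd.
have e s : s \in `[0, t]%classic -> coord (proj n (heat (t - s) (Psi (round_down h s)))) k =
    (if (k < n)%N then expR (- ((t - s) * lam k)) * coord (Psi (round_down h s)) k else 0).
  rewrite inE/= in_itv/= => /andP[_ st]; rewrite coord_proj; case: ifP => // _.
  by rewrite coord_heat// subr_ge0.
transitivity (\int[lebesgue_measure]_(s in `[0, t]) (if (k < n)%N then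
    expR (- ((t - s) * lam k)) * coord (Psi (round_down h s)) k else 0)).
  by apply: eq_Rintegral => s sI; apply: e.
case: ifP => // _.
by rewrite Rintegral_cst// mul0r.
Qed.

End projection.

(** * Pathwise convergence *)

Section pathwise.
Context {R : realType}.
Local Notation leb := (@lebesgue_measure R).
Variables (T rho chi : R) (xi : H R) (F : H R -> H R).
Hypotheses (T0 : 0 < T) (rho6 : 1 / 6 < rho) (rho2 : rho <= 1 / 2) (chi0 : 0 < chi).
Hypotheses (hF : cubic F) (xir : Hr rho xi).
Implicit Types (h s t : R) (j n : nat) (z oo : R -> H R).

Definition forcing n h z oo s : H R :=
  (Hr_norm rho (z s) + Hr_norm rho (oo s + proj n (heat s xi)) <= `|h| `^ (- chi))%R%:R *: F (z s).

Definition scheme n h z oo t : H R :=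
  proj n (heat t xi) +
  bochner_integral leb `[0, t]
    (fun s => proj n (heat (t - s) (forcing n h z oo (round_down h s)))) + oo t.

Lemma coord_scheme n h z oo t k : 0 < h -> 0 <= t -> (k < n)%N ->
  coord (scheme n h z oo t) k = expR (- (t * lam k)) * coord xi k +
    \int[leb]_(s in `[0, t])
      (expR (- ((t - s) * lam k)) * coord (forcing n h z oo (round_down h s)) k) +
    coord (oo t) k.
Proof.
move=> h0 t0 kn; rewrite /scheme !coordD coord_proj kn coord_heat//.
by rewrite (coord_duhamel_step _ (forcing n h z oo) _ h0 t0) kn.
Qed.

Variable x : R -> H R.
Hypothesis hx : Hr_continuous_on `[0, T] rho x.

Lemma path_Hr t : t \in `[0, T] -> Hr rho (x t).
Proof. by move: hx => [+ _]; apply. Qed.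

Lemma path_bounded : exists2 K, 0 <= K & forall t, t \in `[0, T] -> Hr_norm rho (x t) <= K.
Proof.
have [N hN] : exists N, forall n, (N <= n)%N -> forall r, r \in `[0, T] -> Hr_norm rho (x r) <= n%:R.
  apply: itv_uniform => s sI; have [del d0 hd] := hx.2 s sI 1 ltr01.
  (* One unit exceeds the norm at s, the other pays for the variation near s. *)
  exists (Num.truncn (Hr_norm rho (x s))).+2, del => // r rI rs n nN.
  have h1 := hd r rI rs.
  have h2 : Hr_norm rho (x r) <= Hr_norm rho (x r - x s) + Hr_norm rho (x s).
    rewrite -{1}(subrK (x s) (x r)); apply: Hr_normD; last exact: path_Hr.
    by apply: HrB; exact: path_Hr.
  have /andP[_ h3] := truncn_itv (Hr_norm_ge0 rho (x s)).
  have h4 : (Num.truncn (Hr_norm rho (x s))).+2%:R <= n%:R :> R by rewrite ler_nat.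
  apply: le_trans h2 _; apply: le_trans h4; rewrite -natr1 addrC.
  by rewrite lerD// ltW.
by exists N%:R => // t tI; exact: (hN N).
Qed.

Lemma path_uniform eps : 0 < eps -> exists2 del, 0 < del & forall s r, s \in `[0, T] -> r \in `[0, T] ->
  `|r - s| < del -> Hr_norm rho (x r - x s) <= eps.
Proof.
move=> e0; have e2 : 0 < eps / 2 by rewrite divr_gt0.
(* The radius of uniform continuity is encoded as 1/(n + 1). *)
have [N hN] : exists N, forall n, (N <= n)%N -> forall s, s \in `[0, T] ->
    forall r, r \in `[0, T] -> `|r - s| < n.+1%:R^-1 -> Hr_norm rho (x r - x s) <= eps.
  apply: itv_uniform => s sI; have [del d0 hd] := hx.2 s sI _ e2.
  exists (Num.truncn (2 / del)), (del / 2); first by rewrite divr_gt0.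
  move=> r rI rs n nN r' rI' rr.
  have n2 : n.+1%:R^-1 < del / 2.
    rewrite -[X in _ < X]invf_div ltf_pV2 ?posrE ?divr_gt0//.
    have /andP[_ h3] : (Num.truncn (2 / del))%:R <= 2 / del < (Num.truncn (2 / del)).+1%:R.
      by apply: truncn_itv; rewrite divr_ge0// ltW.
    by apply: lt_le_trans h3 _; rewrite ler_nat.
  have h1 := hd r rI (lt_trans rs _); have h2 := hd r' rI' _.
  have rs' : `|r' - s| < del.
    rewrite (_ : r' - s = (r' - r) + (r - s)); last by rewrite addrA subrK.
    apply: le_lt_trans (ler_normD _ _) _; apply: lt_trans (ltrD rr rs) _.
    by rewrite [ltRHS](_ : del = del / 2 + del / 2) ?ltrD2r//; field.
  have {}h1 : Hr_norm rho (x r - x s) < eps / 2 by apply: h1; lra.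
  have {}h2 := h2 rs'.
  rewrite (_ : x r' - x r = (x r' - x s) - (x r - x s)); last by rewrite opprB addrA subrK.
  apply: le_trans (Hr_normB _ _) _; [by apply: HrB; exact: path_Hr..|].
  by lra.
exists N.+1%:R^-1; first by rewrite invr_gt0.
by move=> s r sI rI; exact: (hN N).
Qed.

(** At each time the tails tend to 0 in H_rho; they are equicontinuous in time because the
    complement of [proj n] contracts H_rho, so compactness makes this uniform. *)
Lemma path_tail eps : 0 < eps -> exists N, forall n, (N <= n)%N -> forall t, t \in `[0, T] ->
  Hr_norm rho (x t - proj n (x t)) <= eps.
Proof.
move=> e0; have e2 : 0 < eps / 2 by rewrite divr_gt0.
apply: itv_uniform => s sI; have [del d0 hd] := hx.2 s sI _ e2.
have /cvgr0_norm_le/(_ _ e2) [N _ hN] := proj_cvg_Hr (path_Hr sI).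
exists N, del => // r rI rs n nN; have h1 := hd r rI rs.
have h2 := hN n nN; rewrite /= ger0_norm ?Hr_norm_ge0// in h2.
have xr := path_Hr rI; have xs := path_Hr sI.
rewrite (_ : x r - proj n (x r) = (x s - proj n (x s)) + ((x r - x s) - proj n (x r - x s))); last first.
  by apply: coord_inj => k; rewrite (coordB (x r) (proj n _)) (coordD (x s - _)) (coordB (x s)) (coordB (x r - x s)) !coord_proj !(coordB (x r) (x s)); case: (k < n)%N; ring.
have h3 : Hr_norm rho ((x r - x s) - proj n (x r - x s)) <= Hr_norm rho (x r - x s).
  have [//||_ ->//] := @Hr_le_coord _ rho ((x r - x s) - proj n (x r - x s)) (x r - x s); last exact: HrB.
  by move=> k; rewrite coordB coord_proj; case: ifP; rewrite ?subrr ?normr0 ?subr0.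
apply: le_trans (Hr_normD (HrB xs (proj_Hr _ n _)) (HrB (HrB xr xs) (proj_Hr _ n _))) _.
rewrite [leRHS](_ : eps = eps / 2 + eps / 2); last by field.
exact: (lerD h2 (le_trans h3 (ltW h1))).
Qed.

Lemma F_lip : exists2 C, 1 <= C & forall K u v, Hr rho u -> Hr rho v ->
  Hr_norm rho u <= K -> Hr_norm rho v <= K ->
  `|F u - F v| ^+ 2 <= C * (1 + K ^+ 4) * Hr_norm rho (u - v) ^+ 2.
Proof.
have [C C0 hC] := cubic_lipschitz hF rho6.
exists (2 * C + 1); first by lra.
move=> K u v ur vr uK vK; apply: le_trans (hC u v ur vr) _.
rewrite ler_wpM2r ?sqr_ge0//.
have u0 := Hr_norm_ge0 rho u; have v0 := Hr_norm_ge0 rho v.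
have h1 : Hr_norm rho u ^+ 4 <= K ^+ 4 := lerXn2r 4 u0 (le_trans u0 uK) uK.
have h2 : Hr_norm rho v ^+ 4 <= K ^+ 4 := lerXn2r 4 v0 (le_trans v0 vK) vK.
have h3 : 0 <= Hr_norm rho v ^+ 4 by rewrite exprn_ge0.
have h4 : 0 <= Hr_norm rho u ^+ 4 by rewrite exprn_ge0.
exact (lipschitz_factor_le C0 h4 h3 h1 h2).
Qed.

Lemma F_path_bounded : exists2 M, 0 <= M & forall t, t \in `[0, T] -> `|F (x t)| <= M.
Proof.
have [K K0 hK] := path_bounded; have [C C0 hC] := cubic_growth hF rho6.
exists (1 + C * (K ^+ 2 + K ^+ 6)).
  by rewrite addr_ge0// mulr_ge0// addr_ge0// exprn_ge0.
move=> t tI; have := hC _ (path_Hr tI).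
have n0 := Hr_norm_ge0 rho (x t).
have h1 : Hr_norm rho (x t) ^+ 2 <= K ^+ 2 by rewrite lerXn2r ?nnegrE// hK.
have h2 : Hr_norm rho (x t) ^+ 6 <= K ^+ 6 by rewrite lerXn2r ?nnegrE// hK.
have h3 : C * (Hr_norm rho (x t) ^+ 2 + Hr_norm rho (x t) ^+ 6) <= C * (K ^+ 2 + K ^+ 6).
  by rewrite ler_wpM2l// lerD.
by move=> h; apply: le_1Dsqr; apply: le_trans h _.
Qed.

Lemma right_cont_F : right_cont T (fun s => F (x s)).
Proof.
have [K K0 hK] := path_bounded; have [C C1 hC] := F_lip.
move=> s /andP[s0 sT] eps e0; set L := C * (1 + K ^+ 4).
have L1 : 1 <= L.
  have K1 : 1 <= 1 + K ^+ 4 by rewrite lerDl exprn_ge0.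
  by rewrite /L -[leLHS]mulr1; apply: ler_pM.
have L0 : 0 <= L by apply: le_trans L1.
have e2 : 0 < eps / L by rewrite divr_gt0// (lt_le_trans _ L1).
have [del d0 hd] := path_uniform e2; exists del => // r /andP[sr rd] rT.
have sI : s \in `[0, T] by rewrite in_itv/= s0 ltW.
have rI : r \in `[0, T] by rewrite in_itv/= rT (le_trans s0 (ltW sr)).
have h1 : `|r - s| < del by rewrite ger0_norm ?subr_ge0 ?ltW// ltrBlDl.
have := hd s r sI rI h1; rewrite ler_pdivlMr ?(lt_le_trans _ L1)// => h2.
have := hC K _ _ (path_Hr rI) (path_Hr sI) (hK r rI) (hK s sI); rewrite -/L => h3.
rewrite -(@ler_pXn2r _ 2)// ?nnegrE ?(ltW e0)//; apply: le_trans h3 _.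
apply: (@le_trans _ _ ((Hr_norm rho (x r - x s) * L) ^+ 2)).
  rewrite exprMn mulrC ler_wpM2l ?sqr_ge0// expr2; nra.
apply: lerXn2r => //; rewrite nnegrE ?(ltW e0)//.
by apply: mulr_ge0 => //; exact: Hr_norm_ge0.
Qed.

Let Dh t := duhamel t (fun s => F (x s)).

Let in0T t s : t \in `[0, T] -> s \in `[0, t] -> s \in `[0, T].
Proof. by rewrite !in_itv/= => /andP[_ tT] /andP[-> st]; exact: le_trans st tT. Qed.

Let ge0T t : t \in `[0, T] -> 0 <= t.
Proof. by rewrite in_itv/= => /andP[]. Qed.

Lemma coord_Dh t k : t \in `[0, T] ->
  coord (Dh t) k = \int[leb]_(s in `[0, t]) (expR (- ((t - s) * lam k)) * coord (F (x s)) k).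
Proof.
move=> tI; have [M M0 hM] := F_path_bounded.
apply: (@coord_duhamel _ t M); first exact: ge0T.
  by move=> s sI; apply: hM; exact: in0T sI.
apply: right_cont_le right_cont_F; by move: tI; rewrite in_itv/= => /andP[].
Qed.

Lemma measurable_F_path t k : t \in `[0, T] ->
  measurable_fun (`[0, t] : set R) (fun s => coord (F (x s)) k).
Proof.
move=> tI; apply: measurable_coord_right_cont; first exact: ge0T.
apply: right_cont_le right_cont_F; by move: tI; rewrite in_itv/= => /andP[].
Qed.

Lemma Dh_bounded : exists2 B, 0 <= B & forall t, t \in `[0, T] -> Hr rho (Dh t) /\ Hr_norm rho (Dh t) <= B.
Proof.
have [M M0 hM] := F_path_bounded.
exists (1 + M ^+ 2 * T); first by rewrite addr_ge0// mulr_ge0 ?sqr_ge0// ltW.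
move=> t tI; have t0 := ge0T tI.
have bM s : s \in `[0, t] -> `|F (x s)| <= M by move=> sI; apply: hM; exact: in0T sI.
have [|Dr Dn] := @smoothing _ rho t M (fun s => F (x s)) (Dh t) rho2 t0 bM (fun k => measurable_F_path k tI).
  by move=> k; rewrite coord_Dh.
split => //.
have : \int[leb]_(s in `[0, t]) (`|F (x s)| ^+ 2) <= M ^+ 2 * t.
  apply: Rintegral_itv_le => //.
    by apply: measurable_funX; apply: measurable_norm_coord => k; exact: measurable_F_path.
  by move=> s sI; rewrite sqr_ge0/= lerXn2r ?nnegrE//; exact: bM.
have tT : t <= T by move: tI; rewrite in_itv/= => /andP[].
move=> h; apply: le_1Dsqr; apply: le_trans Dn _; apply: (@le_trans _ _ (1 / 2 * (M ^+ 2 * T))).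
  by rewrite ler_wpM2l//; apply: le_trans h _; rewrite ler_wpM2l ?sqr_ge0.
rewrite ler_piMl//; last lra.
by rewrite mulr_ge0 ?sqr_ge0// ltW.
Qed.

(** The stochastic convolution as recovered from the equation of [x]; its regularity is inherited
    from the other three terms. *)
Definition path_noise t : H R := x t - heat t xi - Dh t.

(** The initial value cancels, leaving the projection of [x t - Dh t]. The bound is uniform in [n],
    which is what keeps the truncation inactive for all small steps. *)
Lemma path_noise_bounded : exists2 L, 0 <= L & forall n t, t \in `[0, T] ->
  Hr_norm rho (proj n (path_noise t) + proj n (heat t xi)) <= L.
Proof.
have [K K0 hK] := path_bounded; have [B B0 hB] := Dh_bounded.
exists (K + B); first by rewrite addr_ge0.
move=> n t tI; have [Dr Db] := hB t tI.
rewrite (_ : _ + _ = proj n (x t - Dh t)); last first.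
  by rewrite -projD; congr proj; rewrite /path_noise addrAC subrK.
apply: le_trans (Hr_norm_proj _ _) _; first exact: HrB (path_Hr tI) Dr.
by apply: le_trans (Hr_normB (path_Hr tI) Dr) _; rewrite lerD// hK.
Qed.

Lemma Rintegral_exp_majorant (c A C t : R) : 0 <= t -> 0 < C ->
  \int[leb]_(s in `[0, t]) (c + A * C * expR (C * s)) = c * t + A * (expR (C * t) - 1).
Proof.
move=> t0 C0.
have dF (y : R) : is_derive y 1 (fun s : R => c * s + A * expR (C * s)) (c + A * C * expR (C * y)).
  by apply: is_derive_eq; rewrite /GRing.scale/=; ring.
have cf : continuous (fun s : R => c + A * C * expR (C * s)).
  move=> y; apply: cvgD; first exact: cvg_cst.
  apply: cvgM; first exact: cvg_cst.
  apply: (@continuous_comp _ _ _ (fun s : R => C * s) (@expR R)); last exact: continuous_expR.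
  by apply: cvgM; [exact: cvg_cst|exact: cvg_id].
by rewrite (Rintegral_FTC2 t0 cf dF) !mulr0 expR0; ring.
Qed.

Section error_estimate.
Variables (n : nat) (h K C eta del a : R) (z oo : R -> H R).
Let E t := Hr_norm rho (x t - z t).
Hypotheses (h0 : 0 < h) (hdel : h <= del) (C0 : 0 < C) (a0 : 0 <= a).
Hypothesis hK : forall t, t \in `[0, T] -> Hr_norm rho (x t) <= K.
Hypothesis hC : forall u v, Hr rho u -> Hr rho v -> Hr_norm rho u <= K + 1 -> Hr_norm rho v <= K + 1 ->
  2 * `|F u - F v| ^+ 2 <= C * Hr_norm rho (u - v) ^+ 2.
Hypothesis hdelta : forall s r, s \in `[0, T] -> r \in `[0, T] -> `|r - s| < del ->
  Hr_norm rho (x r - x s) <= eta.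
Hypothesis htail : forall t, t \in `[0, T] -> 2 * Hr_norm rho (x t - proj n (x t)) ^+ 2 <= a.
Hypothesis hL : forall t, t \in `[0, T] ->
  K + 1 + Hr_norm rho (proj n (path_noise t) + proj n (heat t xi)) <= `|h| `^ (- chi).
Let A := a + C * eta ^+ 2 * T.
Hypothesis A1 : A * expR (C * T) <= 1.
Let exact t := z t = scheme n h z oo t /\ oo t = proj n (path_noise t).
Hypothesis hgrid : forall j, j%:R * h <= T -> exact (j%:R * h).

Let Ceta : 0 <= C * eta ^+ 2. Proof. by apply: mulr_ge0; [exact: ltW|exact: sqr_ge0]. Qed.

Let A0 : 0 <= A. Proof. by apply: addr_ge0 => //; apply: mulr_ge0 => //; exact: ltW. Qed.

Lemma scheme_Hr t : t \in `[0, T] -> exact t -> Hr rho (z t).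
Proof.
move=> tI [zt ot]; suff -> : z t = proj n (z t) by exact: proj_Hr.
rewrite zt /scheme ot; apply: coord_inj => k; rewrite coord_proj; case: ifPn => // kn.
rewrite !coordD coord_proj (negbTE kn) (coord_duhamel_step _ (forcing n h z oo) _ h0 (ge0T tI)).
by rewrite (negbTE kn) coord_proj (negbTE kn) !addr0.
Qed.

(** A supersolution argument. On [0, t) the squared drift error is at most C eta^2 + A C e^(C s),
    with integral C eta^2 t + A (e^(C t) - 1); by [smoothing] twice the squared low-frequency error
    is bounded by this, and [a] bounds the tail. [A1] keeps the error at earlier grid points at most
    1, so there [z] stays in the ball of radius K + 1 and, by [hL], the truncation is off. *)
Lemma error_step t : t \in `[0, T] -> exact t ->
  (forall j, j%:R * h < t -> E (j%:R * h) ^+ 2 <= A * expR (C * (j%:R * h))) ->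
  E t ^+ 2 <= A * expR (C * t).
Proof.
move=> tI et hj; have [zt ot] := et; have t0 := ge0T tI.
have tT : t <= T by move: tI; rewrite in_itv/= => /andP[].
have xt := path_Hr tI; have Hzt := scheme_Hr tI et.
pose g s := F (x s) - forcing n h z oo (round_down h s).
(* The low-frequency part of the error; the rest is the tail of [x t], controlled by [htail]. *)
pose u := proj n (x t - z t).
have [MF MF0 hMF] := F_path_bounded.
have [MG MG0 hMG] := bounded_step t (forcing n h z oo) h0.
have gM s : s \in `[0, t] -> `|g s| <= MF + MG.
  move=> sI; apply: le_trans (ler_normB _ _) _; apply: lerD (hMG s sI).
  by apply: hMF; exact: in0T sI.
have mG k : measurable_fun (`[0, t] : set R) (fun s => coord (forcing n h z oo (round_down h s)) k).
  by apply: measurable_coord_right_cont => //; exact: right_cont_step.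
have mg k : measurable_fun (`[0, t] : set R) (fun s => coord (g s) k).
  have -> : (fun s => coord (g s) k) =
      (fun s => coord (F (x s)) k - coord (forcing n h z oo (round_down h s)) k).
    by apply/funext => s; rewrite coordB.
  by apply: measurable_funB; [exact: measurable_F_path|exact: mG].
have mng : measurable_fun (`[0, t] : set R) (fun s => `|g s| ^+ 2).
  by apply: measurable_funX; exact: measurable_norm_coord.
have me k : measurable_fun (`[0, t] : set R) (fun s : R => expR (- ((t - s) * lam k))).
  apply: (@measurableT_comp _ _ _ _ _ _ (@expR R)); first exact: measurable_expR.
  by apply: measurableT_comp => //; apply: measurable_funM => //; exact: measurable_funB.
have be k (s : R) : s \in `[0, t] -> `|expR (- ((t - s) * lam k))| <= 1.
  rewrite in_itv/= => /andP[_ st]; rewrite ger0_norm ?expR_ge0// expR_le1 oppr_le0.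
  by rewrite mulr_ge0 ?subr_ge0// ltW// lam_gt0.
have iE k (f : R -> H R) (M : R) : measurable_fun (`[0, t] : set R) (fun s => coord (f s) k) ->
    (forall s, s \in `[0, t] -> `|f s| <= M) ->
    leb.-integrable `[0, t] (EFin \o (fun s => expR (- ((t - s) * lam k)) * coord (f s) k)).
  move=> mf fM; apply: (bounded_integrable_itv (M := M)); first exact: measurable_funM.
  move=> s sI; rewrite normrM -[leRHS]mul1r; apply: ler_pM => //; first exact: be.
  exact: le_trans (coord_le _ _) (fM s sI).
(* In the coordinates below n the noise of [x] and [oo] coincide and cancel; what remains is the
   Duhamel integral of [g]. *)
have cu k : `|coord u k| <=
    `|\int[leb]_(s in `[0, t]) (expR (- ((t - s) * lam k)) * coord (g s) k)|.
  rewrite /u coord_proj; case: ifP => kn; last by rewrite normr0.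
  rewrite (_ : coord _ k = \int[leb]_(s in `[0, t]) (expR (- ((t - s) * lam k)) * coord (g s) k))//.
  rewrite coordB zt coord_scheme// ot coord_proj kn /path_noise !coordB coord_Dh// coord_heat//.
  rewrite (_ : \int[leb]_(s in `[0, t]) (expR (- ((t - s) * lam k)) * coord (g s) k) =
    \int[leb]_(s in `[0, t]) (expR (- ((t - s) * lam k)) * coord (F (x s)) k) -
    \int[leb]_(s in `[0, t]) (expR (- ((t - s) * lam k)) * coord (forcing n h z oo (round_down h s)) k)).
    exact: cancel_common.
  rewrite -RintegralB//; last 2 first.
  - apply: (iE k (fun s => F (x s)) MF); first exact: measurable_F_path.
    by move=> s sI; apply: hMF; exact: in0T sI.
  - exact: (iE k (fun s => forcing n h z oo (round_down h s)) MG (mG k) hMG).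
  by apply: eq_Rintegral => s _; rewrite coordB mulrBr.
have [ur un] := @smoothing _ rho t _ g u rho2 t0 gM mg cu.
(* Strict at t: if t is a grid point, then at s = t the rounded time is t itself, where no bound is
   available yet. *)
have gb s : 0 <= s < t -> `|g s| ^+ 2 <= C * eta ^+ 2 + A * C * expR (C * s).
  move=> /andP[s0 st]; have sI : s \in `[0, T] by rewrite in_itv/= s0 (le_trans (ltW st)).
  have [j rE /andP[j1 j2]] := round_down_grid h0 s0.
  have jt : j%:R * h < t := le_lt_trans j1 st.
  have jI : j%:R * h \in `[0, T].
    by rewrite in_itv/= mulr_ge0 ?ler0n ?(ltW h0)//= ltW// (lt_le_trans jt).
  have ej := hgrid (le_trans (ltW jt) tT); have zj := scheme_Hr jI ej; have xj := path_Hr jI.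
  have Ej := hj j jt.
  have ml : C * (j%:R * h) <= C * s by rewrite ler_wpM2l// ltW.
  have mT : C * (j%:R * h) <= C * T by rewrite ler_wpM2l ?(ltW C0)// (le_trans (ltW jt)).
  have Ej1 : E (j%:R * h) <= 1.
    rewrite -(@ler_pXn2r _ 2)// ?nnegrE ?Hr_norm_ge0// expr1n.
    by apply: le_trans Ej _; apply: le_trans A1; rewrite ler_wpM2l// ler_expR.
  have zK : Hr_norm rho (z (j%:R * h)) <= K + 1.
    rewrite (_ : z (j%:R * h) = x (j%:R * h) - (x (j%:R * h) - z (j%:R * h))); last by rewrite opprB addrC subrK.
    by apply: le_trans (Hr_normB xj (HrB xj zj)) _; apply: lerD => //; exact: hK.
  have ind : forcing n h z oo (j%:R * h) = F (z (j%:R * h)).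
    rewrite /forcing (_ : (_ <= _) = true) ?scale1r//.
    by apply: le_trans (hL jI); rewrite ej.2 lerD2r.
  rewrite /g rE ind.
  rewrite (_ : F (x s) - F (z (j%:R * h)) = (F (x s) - F (x (j%:R * h))) + (F (x (j%:R * h)) - F (z (j%:R * h)))); last by rewrite addrA subrK.
  have K1 r : r \in `[0, T] -> Hr_norm rho (x r) <= K + 1.
    by move=> rI; apply: le_trans (hK rI) _; rewrite lerDl.
  have b1 := hC (path_Hr sI) xj (K1 _ sI) (K1 _ jI).
  have b2 := hC xj zj (K1 _ jI) zK.
  have b3 : Hr_norm rho (x s - x (j%:R * h)) ^+ 2 <= eta ^+ 2.
    have sj : `|s - j%:R * h| < del.
      by rewrite ger0_norm ?subr_ge0// ltrBlDl (lt_le_trans j2)// lerD2l.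
    have d0 := hdelta jI sI sj.
    by apply: lerXn2r => //; rewrite nnegrE ?(le_trans _ d0) ?Hr_norm_ge0.
  have b4 := ler_wpM2l (ltW C0) b3.
  have b5 : C * Hr_norm rho (x (j%:R * h) - z (j%:R * h)) ^+ 2 <= A * C * expR (C * s).
    rewrite mulrAC mulrC ler_wpM2r ?(ltW C0)//; apply: le_trans Ej _.
    by rewrite ler_wpM2l// ler_expR.
  set p := F (x s) - _; set q := F (x _) - F (z _).
  have b6 : `|p + q| ^+ 2 <= 2 * `|p| ^+ 2 + 2 * `|q| ^+ 2.
    apply: (@le_trans _ _ ((`|p| + `|q|) ^+ 2)).
      by apply: lerXn2r; rewrite ?nnegrE ?addr_ge0//; exact: ler_normD.
    exact: sqrD_le.
  apply: le_trans b6 _; apply: lerD; [exact: le_trans b1 b4|exact: le_trans b2 b5].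
have int_g : \int[leb]_(s in `[0, t]) (`|g s| ^+ 2) <= C * eta ^+ 2 * t + A * (expR (C * t) - 1).
  rewrite -Rintegral_exp_majorant//.
  have mm : measurable_fun (`[0, t] : set R) (fun s : R => C * eta ^+ 2 + A * C * expR (C * s)).
    apply: measurable_funD => //; apply: measurable_funM => //.
    apply: (@measurableT_comp _ _ _ _ _ _ (@expR R)); first exact: measurable_expR.
    by apply: measurable_funM.
  have sub : (`[0, t[%classic : set R) `<=` `[0, t]%classic.
    by move=> s; rewrite /= !in_itv/= => /andP[-> /ltW ->].
  have ig : leb.-integrable `[0, t] (EFin \o (fun s => `|g s| ^+ 2)).
    apply: (bounded_integrable_itv (M := (MF + MG) ^+ 2)) => // s sI.
    by rewrite normrX normr_id; apply: lerXn2r; rewrite ?nnegrE ?addr_ge0//; exact: gM.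
  have im : leb.-integrable `[0, t] (EFin \o (fun s : R => C * eta ^+ 2 + A * C * expR (C * s))).
    apply: (bounded_integrable_itv (M := C * eta ^+ 2 + A * C * expR (C * t))) => // s.
    rewrite in_itv/= => /andP[s0 st]; rewrite ger0_norm.
      by rewrite lerD2l ler_wpM2l ?mulr_ge0 ?(ltW C0)// ler_expR ler_wpM2l// ltW.
    by apply: addr_ge0 => //; apply: mulr_ge0; [apply: mulr_ge0 => //; exact: ltW|exact: expR_ge0].
  have mo : measurable (`[0, t[%classic : set R) by exact: measurable_itv.
  have ig' : leb.-integrable `[0, t[ (EFin \o (fun s => `|g s| ^+ 2)) by exact: integrableS ig.
  have im' : leb.-integrable `[0, t[ (EFin \o (fun s : R => C * eta ^+ 2 + A * C * expR (C * s))).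
    exact: integrableS im.
  rewrite -!Rintegral_itv_bndo_bndc//.
  apply: (@le_Rintegral _ _ _ leb `[0, t[%classic _ _ mo ig' im').
  by move=> s; rewrite /= in_itv/= => sI; exact: gb.
have v0 := htail tI.
have xzE : x t - z t = u + (x t - proj n (x t)).
  have -> : z t = proj n (z t).
    rewrite zt /scheme ot; apply: coord_inj => k; rewrite coord_proj; case: ifPn => // kn.
    rewrite !coordD coord_proj (negbTE kn) (coord_duhamel_step _ (forcing n h z oo) _ h0 t0).
    by rewrite (negbTE kn) coord_proj (negbTE kn) !addr0.
  by rewrite /u projB [RHS]addrC addrA subrK.
have nE : E t <= Hr_norm rho u + Hr_norm rho (x t - proj n (x t)).
  by rewrite /E xzE; apply: Hr_normD => //; exact: (HrB xt (proj_Hr _ _ _)).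
have E0 : 0 <= E t := Hr_norm_ge0 _ _.
have p1 : E t ^+ 2 <= 2 * Hr_norm rho u ^+ 2 + 2 * Hr_norm rho (x t - proj n (x t)) ^+ 2.
  apply: (@le_trans _ _ ((Hr_norm rho u + Hr_norm rho (x t - proj n (x t))) ^+ 2)).
    exact: (lerXn2r 2 E0 (addr_ge0 (Hr_norm_ge0 _ _) (Hr_norm_ge0 _ _)) nE).
  exact: sqrD_le.
have p2 : C * eta ^+ 2 * t <= C * eta ^+ 2 * T.
  by rewrite ler_wpM2l// mulr_ge0 ?sqr_ge0// ltW.
have p3 : 2 * Hr_norm rho u ^+ 2 <= C * eta ^+ 2 * t + A * (expR (C * t) - 1).
  apply: le_trans int_g; rewrite -ler_pdivlMl//; apply: le_trans un _.
  by rewrite div1r.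
apply: le_trans p1 _; apply: le_trans (lerD p3 v0) _.
rewrite mulrBr mulr1 /A; move: p2; rewrite -/A; set w := A * expR _; rewrite /A => p2.
exact: gronwall_terms_le.
Qed.

Lemma error_grid j : j%:R * h <= T -> E (j%:R * h) ^+ 2 <= A * expR (C * (j%:R * h)).
Proof.
elim/ltn_ind: j => j IH jT.
apply: error_step => //; [|exact: hgrid|].
  by rewrite in_itv/= mulr_ge0 ?ler0n// ltW.
move=> i; rewrite ltr_pM2r// ltr_nat => ij; apply: IH => //.
by apply: le_trans jT; rewrite ler_pM2r// ler_nat ltnW.
Qed.

Lemma error_bound t : t \in `[0, T] -> exact t -> E t ^+ 2 <= A * expR (C * T).
Proof.
move=> tI et; have tT : t <= T by move: tI; rewrite in_itv/= => /andP[].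
apply: (@le_trans _ _ (A * expR (C * t))); last by rewrite ler_wpM2l// ler_expR ler_wpM2l// ltW.
apply: error_step => // j jt; apply: error_grid; exact: le_trans (ltW jt) tT.
Qed.

End error_estimate.

(** The equations are required only at the grid points and at the one time [tau n], so that
    countably many null sets will be involved. *)
Lemma pathwise_cvg (h : nat -> R) (z oo : nat -> R -> H R) (tau : nat -> R) :
  (forall n, (0 < n)%N -> 0 < h n) -> h n @[n --> \oo] --> (0 : R) ->
  (forall n, (0 < n)%N -> tau n \in `[0, T]) ->
  (forall n t, (0 < n)%N -> t = tau n \/ (exists2 j, t = j%:R * h n & t <= T) ->
     z n t = scheme n (h n) (z n) (oo n) t /\ oo n t = proj n (path_noise t)) ->
  `|x (tau n) - z n (tau n)| @[n --> \oo] --> (0 : R).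
Proof.
move=> h0 hcv tauI hz.
have [K K0 hK] := path_bounded; have [C0 C01 hC0] := F_lip.
have [L L0 hL] := path_noise_bounded.
pose C := 2 * (C0 * (1 + (K + 1) ^+ 4)).
have Cp : 0 < C.
  rewrite mulr_gt0// mulr_gt0 ?(lt_le_trans _ C01)// ltr_pwDl// exprn_ge0// addr_ge0//.
have hC u v : Hr rho u -> Hr rho v -> Hr_norm rho u <= K + 1 -> Hr_norm rho v <= K + 1 ->
    2 * `|F u - F v| ^+ 2 <= C * Hr_norm rho (u - v) ^+ 2.
  by move=> ur vr uK vK; rewrite /C -mulrA ler_wpM2l//; exact: hC0.
apply/cvgrPdist_le => eps e0.
have small (b : R) : 0 < b -> exists2 c : R, 0 < c & c ^+ 2 <= b.
  move=> b0; exists (Num.min 1 b); first by rewrite lt_min ltr01.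
  apply: (@le_trans _ _ (Num.min 1 b)); last by rewrite ge_min lexx orbT.
  by rewrite expr2 ler_piMl ?ge_min ?lexx// le_min ler01 ltW.
have ep : 0 < expR (C * T) := expR_gt0 _.
(* The budget for [A] of the error estimate: one half is spent on the tail bound [a], the other on C
   eta^2 T. The minimum with 1 provides [A1]. *)
pose q := Num.min 1 (eps ^+ 2) / expR (C * T).
have q0 : 0 < q by rewrite divr_gt0// lt_min ltr01 exprn_gt0.
have q2 : 0 < q / 2 by rewrite divr_gt0.
have [eta eta0 heta] : exists2 c : R, 0 < c & c ^+ 2 <= q / 2 / (C * T).
  by apply: small; rewrite divr_gt0// mulr_gt0.
have [ta ta0 hta] : exists2 c : R, 0 < c & c ^+ 2 <= q / 2 / 2 by apply: small; rewrite divr_gt0.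
have [del d0 hdel] := path_uniform eta0.
have [N hN] := path_tail ta0.
(* M dominates what the truncation compares with its threshold as long as the error is at most 1;
   [hM] is the step size at which h^(-chi) equals M. *)
pose M := K + 1 + L; have M0 : 0 < M by rewrite /M; lra.
pose hM := M^-1 `^ (1 / chi); have hM0 : 0 < hM by rewrite powR_gt0// invr_gt0.
have small_h n : (0 < n)%N -> h n <= hM -> M <= `|h n| `^ (- chi).
  move=> n0 hn; rewrite ger0_norm ?(ltW (h0 n n0))// powRN.
  have hc : h n `^ chi <= M^-1.
    apply: (@le_trans _ _ (hM `^ chi)).
      by apply: ge0_ler_powR; rewrite ?nnegrE ?(ltW chi0) ?(ltW hM0) ?(ltW (h0 n n0)).
    by rewrite /hM -powRrM div1r mulVf ?gt_eqF// powRr1// invr_ge0 ltW.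
  by rewrite -[M]invrK lef_pV2 ?posrE ?invr_gt0// powR_gt0// h0.
have /cvgr0_norm_le/(_ _ d0) [N1 _ hN1] := hcv.
have /cvgr0_norm_le/(_ _ hM0) [N2 _ hN2] := hcv.
exists (N + N1 + N2).+1 => // n /= hn.
have n0 : (0 < n)%N by exact: leq_trans hn.
have [nN [n1N n2N]] : (N <= n)%N /\ (N1 <= n)%N /\ (N2 <= n)%N by clear -hn; lia.
have {}n1 : h n <= del by apply: le_trans (ler_norm _) (hN1 n n1N).
have {}n2 : h n <= hM by apply: le_trans (ler_norm _) (hN2 n n2N).
have aT : C * eta ^+ 2 * T <= q / 2.
  by move: heta; rewrite (ler_pdivlMr _ _ (mulr_gt0 Cp T0)) (mulrC (eta ^+ 2)) mulrAC.
have Aq : (q / 2 + C * eta ^+ 2 * T) * expR (C * T) <= Num.min 1 (eps ^+ 2).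
  by rewrite -ler_pdivlMr// -/q [leRHS](_ : q = q / 2 + q / 2) ?lerD2l//; field.
have ht t : t \in `[0, T] -> 2 * Hr_norm rho (x t - proj n (x t)) ^+ 2 <= q / 2.
  move=> tI; rewrite mulrC -ler_pdivlMr//; apply: le_trans hta.
  by apply: lerXn2r; rewrite ?nnegrE ?Hr_norm_ge0 ?(ltW ta0)//; exact: hN.
have hLn t : t \in `[0, T] ->
    K + 1 + Hr_norm rho (proj n (path_noise t) + proj n (heat t xi)) <= `|h n| `^ (- chi).
  by move=> tI; apply: le_trans (small_h n n0 n2); rewrite lerD2l; exact: hL.
have A1 : (q / 2 + C * eta ^+ 2 * T) * expR (C * T) <= 1.
  by apply: le_trans Aq _; rewrite ge_min lexx.
have g j : j%:R * h n <= T -> z n (j%:R * h n) = scheme n (h n) (z n) (oo n) (j%:R * h n) /\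
    oo n (j%:R * h n) = proj n (path_noise (j%:R * h n)).
  by move=> jT; apply: hz => //; right; exists j.
have et := hz n (tau n) n0 (or_introl erefl).
have := error_bound (h0 n n0) n1 Cp (ltW q2) hK hC hdel ht hLn A1 g (tauI n n0) et.
move=> E2; have {}E2 := le_trans E2 Aq.
have E1 : Hr_norm rho (x (tau n) - z n (tau n)) <= eps.
  rewrite -(@ler_pXn2r _ 2)// ?nnegrE ?Hr_norm_ge0 ?(ltW e0)//.
  by apply: le_trans E2 _; rewrite ge_min lexx orbT.
have zr := scheme_Hr (h0 n n0) (tauI n n0) et.
rewrite sub0r normrN normr_id; apply: le_trans E1; apply: norm_le_Hr; last exact: (HrB (path_Hr (tauI n n0)) zr).
by move: rho6; lra.
Qed.

End pathwise.

Lemma square_terms_le (R : realFieldType) (u1 u2 u3 u4 c d z b y : R) :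
  u1 <= c -> u2 <= u4 -> u3 <= b * y ->
  u1 + 2 * (d * z + u3) + u2 <= c + (2 * d * z + 2 * b * y + u4).
Proof. by lra. Qed.

Lemma energy_terms_le (R : realFieldType) (x1 x2 x3 x4 x5 a1 a2 a3 : R) :
  x4 <= a1 -> x5 <= a2 -> x1 <= a3 -> x3 <= x4 -> x2 <= x5 ->
  2 * x1 + 2 * x2 + x3 <= 2 * a2 + a1 + 2 * a3.
Proof. by lra. Qed.

(** * One-step coefficients and the energy estimate for the scheme *)

Section one_step_coefficients.
Context {R : realType}.
Implicit Types l d rho : R.

Lemma decay_sqr_le (l d : R) : 0 < l -> 0 <= d ->
  0 <= (1 - expR (- (d * l))) / l <= d.
Proof.
move=> l0 d0; have dl : 0 <= d * l by rewrite mulr_ge0// ltW.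
rewrite divr_ge0 ?(ltW l0) ?subr_ge0 ?expR_le1 ?oppr_le0//= ler_pdivrMr//.
by have := expR_ge1Dx (- (d * l)); lra.
Qed.

(* e^(-x) (1 - e^(-x)) / x differs from 1 by at most min(1, 2x). *)
Lemma decay_defect (l d rho : R) : 0 < l -> 0 <= d -> 0 <= rho <= 1 ->
  `|expR (- (d * l)) * ((1 - expR (- (d * l))) / l) - d| <= d * ((2 * d) `^ rho * l `^ rho).
Proof.
move=> l0; rewrite le_eqVlt => /predU1P[<-|d0] /andP[r0 r1].
  by rewrite !(mul0r, oppr0, expR0, subrr, mulr0, addr0, normr0).
rewrite -powRM ?mulr_ge0 ?(ltW d0) ?(ltW l0)// -mulrA; set x := d * l.
have x0 : 0 < x by rewrite mulr_gt0.
set e := expR (- x); have e0 : 0 <= e := expR_ge0 _.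
have e1 : 1 - x <= e by exact: expR_ge1Dx.
have e2 : e * (1 + x) <= 1.
  have /(ler_wpM2l e0) := expR_ge1Dx x; rewrite /e -expRD addNr expR0.
  by [].
have e3 : e <= 1 by rewrite expR_le1 oppr_le0 ltW.
pose c := e * (1 - e) / x.
have c0 : 0 <= c by rewrite divr_ge0 ?mulr_ge0 ?subr_ge0// ltW.
have c1 : c <= 1 by rewrite ler_pdivrMr// mul1r; nra.
have c2 : 1 - 2 * x <= c.
  rewrite ler_pdivlMr//; have : e * (x * e) <= e * (1 - e) by rewrite ler_wpM2l//; lra.
  move=> h; apply: le_trans h; nra.
have -> : e * ((1 - e) / l) - d = - (d * (1 - c)).
  by rewrite /c /x; field; rewrite !gt_eqF.
rewrite normrN normrM (ger0_norm (ltW d0)) ler_pM2l// ger0_norm ?subr_ge0//.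
have [x1|x1] := lerP (2 * x) 1; last first.
  apply: (@le_trans _ _ 1); first by rewrite gerBl.
  by have := ler_powR (ltW x1) r0; rewrite powRr0.
apply: (@le_trans _ _ (2 * x)); first lra.
rewrite -[leLHS]powRr1; last lra.
by apply: ger_powR => //; rewrite x1 andbT; lra.
Qed.

End one_step_coefficients.

Section energy.
Context {R : realType}.
Local Notation leb := (@lebesgue_measure R).
Variables (rho chi : R) (xi : H R) (F : H R -> H R).
Implicit Types (h s t d : R) (j n : nat) (z oo : R -> H R).

Lemma Rintegral_heat_kernel (l a b : R) : a <= b -> 0 < l ->
  \int[leb]_(s in `[a, b]) expR (- ((b - s) * l)) = (1 - expR (- ((b - a) * l))) / l.
Proof.
move=> ab l0.
have dF (x : R) : is_derive x 1 (fun s : R => expR (- ((b - s) * l)) / l) (expR (- ((b - x) * l))).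
  by apply: is_derive_eq; rewrite /GRing.scale/=; field; rewrite gt_eqF.
have cf : continuous (fun s : R => expR (- ((b - s) * l))).
  move=> x; apply: (@continuous_comp _ _ _ (fun s : R => - ((b - s) * l)) (@expR R)).
    by apply: cvgN; apply: cvgM; [apply: cvgB; [exact: cvg_cst|exact: cvg_id]|exact: cvg_cst].
  exact: continuous_expR.
by rewrite (Rintegral_FTC2 ab cf dF) subrr mul0r oppr0 expR0 -mulrBl.
Qed.

(** The integral is split at the grid point: the semigroup transports the part before it, and after
    it the integrand is the heat kernel times a constant. *)
Lemma coord_step h t d j (Psi : R -> H R) k : 0 < h -> t = j%:R * h + d -> 0 <= d <= h ->
  \int[leb]_(s in `[0, t]) (expR (- ((t - s) * lam k)) * coord (Psi (round_down h s)) k) =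
  expR (- (d * lam k)) * (\int[leb]_(s in `[0, j%:R * h])
      (expR (- ((j%:R * h - s) * lam k)) * coord (Psi (round_down h s)) k)) +
  (1 - expR (- (d * lam k))) / lam k * coord (Psi (j%:R * h)) k.
Proof.
move=> h0 tE /andP[d0 dh]; set a := j%:R * h.
have l0 : (0 : R) < lam k := lam_gt0 k.
have a0 : 0 <= a by rewrite mulr_ge0// ltW.
have at_ : a <= t by rewrite tE lerDl.
have t0 : 0 <= t by exact: le_trans at_.
pose f s := expR (- ((t - s) * lam k)) * coord (Psi (round_down h s)) k.
have [M M0 hM] := bounded_step t Psi h0.
have mP : measurable_fun (`[0, t] : set R) (fun s => coord (Psi (round_down h s)) k).
  by apply: measurable_coord_right_cont => //; exact: right_cont_step.
have iF : leb.-integrable `[0, t] (EFin \o f).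
  apply: (bounded_integrable_itv (M := M)).
    apply: measurable_funM => //; apply: (@measurableT_comp _ _ _ _ _ _ (@expR R)).
      exact: measurable_expR.
    by apply: measurableT_comp => //; apply: measurable_funM => //; exact: measurable_funB.
  move=> s sI; rewrite normrM -[leRHS]mul1r; apply: ler_pM => //.
    move: sI; rewrite in_itv/= => /andP[_ st].
    by rewrite ger0_norm ?expR_ge0// expR_le1 oppr_le0 mulr_ge0 ?subr_ge0// ltW.
  exact: le_trans (coord_le _ _) (hM s sI).
have := @Rintegral_itvB _ f (BLeft 0) (BRight t) a iF.
rewrite !bnd_simp => /(_ a0 at_) split; rewrite [RHS]addrC; apply/eqP; rewrite -subr_eq; apply/eqP.
have -> : expR (- (d * lam k)) * (\int[leb]_(s in `[0, a])
      (expR (- ((a - s) * lam k)) * coord (Psi (round_down h s)) k)) = \int[leb]_(s in `[0, a]) f s.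
  rewrite -RintegralZl//; last first.
    apply: (bounded_integrable_itv (M := M)).
      apply: measurable_funM; last first.
        by apply: measurable_coord_right_cont => //; exact: right_cont_step.
      apply: (@measurableT_comp _ _ _ _ _ _ (@expR R)); first exact: measurable_expR.
      by apply: measurableT_comp => //; apply: measurable_funM => //; exact: measurable_funB.
    move=> s sI; rewrite normrM -[leRHS]mul1r; move: sI; rewrite in_itv/= => /andP[s0 sa].
    apply: ler_pM => //.
      by rewrite ger0_norm ?expR_ge0// expR_le1 oppr_le0 mulr_ge0 ?subr_ge0// ltW.
    by apply: le_trans (coord_le _ _) (hM s _); rewrite in_itv/= s0 (le_trans sa).
  apply: eq_Rintegral => s _; rewrite /f mulrA -expRD; congr (expR _ * _).
  by rewrite tE -/a; ring.
rewrite split.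
have subs : ([set` `]a, t]] : set R) `<=` `[0, t]%classic.
  by move=> s; rewrite /= !in_itv/= => /andP[/ltW as_ ->]; rewrite (le_trans a0 as_).
have subs' : ([set` `[a, t[] : set R) `<=` `[0, t]%classic.
  by move=> s; rewrite /= !in_itv/= => /andP[as_ /ltW ->]; rewrite (le_trans a0 as_).
rewrite Rintegral_itv_obnd_cbnd; last by apply: integrableS iF => //; exact: measurable_itv.
(* The right end point is dropped: if d = h, then t is the next grid point and [round_down] jumps
   there. *)
rewrite -Rintegral_itv_bndo_bndc; last by apply: integrableS iF => //; exact: measurable_itv.
have cE : coord (Psi a) k * \int[leb]_(s in `[a, t]) expR (- ((t - s) * lam k)) =
    (1 - expR (- (d * lam k))) / lam k * coord (Psi a) k.
  by rewrite Rintegral_heat_kernel// mulrC (_ : t - a = d)// tE -/a addrC addKr.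
rewrite -cE.
have cexp : continuous (fun s : R => expR (- ((t - s) * lam k))).
  move=> x; apply: (@continuous_comp _ _ _ (fun s : R => - ((t - s) * lam k)) (@expR R)).
    by apply: cvgN; apply: cvgM; [apply: cvgB; [exact: cvg_cst|exact: cvg_id]|exact: cvg_cst].
  exact: continuous_expR.
have ie : leb.-integrable `[a, t] (EFin \o (fun s : R => expR (- ((t - s) * lam k)))).
  exact: continuous_integrable_itv.
have ie' : leb.-integrable `[a, t[ (EFin \o (fun s : R => expR (- ((t - s) * lam k)))).
  apply: integrableS ie => //.
  by move=> s; rewrite /= !in_itv/= => /andP[-> /ltW ->].
rewrite -Rintegral_itv_bndo_bndc// -RintegralZl//.
apply: eq_Rintegral => s; rewrite inE/= in_itv/= => /andP[as_ st].
rewrite /f mulrC (@round_down_cell _ h j)// -natr1 mulrDl mul1r as_/=.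
by apply: lt_le_trans st _; rewrite tE lerD2l.
Qed.

Lemma scheme_step n h t d j z oo k : 0 < h -> t = j%:R * h + d -> 0 <= d <= h -> (k < n)%N ->
  z (j%:R * h) = scheme rho chi xi F n h z oo (j%:R * h) -> z t = scheme rho chi xi F n h z oo t ->
  coord (z t - oo t) k = expR (- (d * lam k)) * coord (z (j%:R * h) - oo (j%:R * h)) k +
    (1 - expR (- (d * lam k))) / lam k * coord (forcing rho chi xi F n h z oo (j%:R * h)) k.
Proof.
move=> h0 tE dI kn zj zt; have /andP[d0 dh] := dI.
have a0 : 0 <= j%:R * h by rewrite mulr_ge0// ltW.
have t0 : 0 <= t by rewrite tE addr_ge0.
rewrite !coordB zt {1}zj !coord_scheme// !addrK (coord_step (forcing rho chi xi F n h z oo) k h0 tE dI).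
rewrite addrA mulrDr mulrA -expRD; congr (expR _ * _ + _ + _).
by rewrite tE; ring.
Qed.

Lemma sum_CauchySchwarz n (a b : nat -> R) :
  (\sum_(k < n) a k * b k) ^+ 2 <= (\sum_(k < n) a k ^+ 2) * \sum_(k < n) b k ^+ 2.
Proof.
have := L2_CauchySchwarz (synth n a) (synth n b).
rewrite dot_synth (eq_bigr (fun k : 'I_n => a k * b k)); last by move=> k _; rewrite coord_synth ltn_ord.
rewrite -(@ler_pXn2r _ 2)// ?nnegrE ?mulr_ge0// real_normK ?num_real//.
by rewrite exprMn !norm_synth.
Qed.

Hypotheses (rho01 : 0 <= rho <= 1) (xir : Hr rho xi).

(** In coordinates the step maps y to E y + B f, and the square is expanded. Since E <= 1 the first
    square does not grow. The cross term is 2 d <y, f>, bounded by [q], plus a defect which by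
    [decay_defect] carries d^rho lam^rho; the H_rho norm of y is at most (2 + N) eta and f at most
    Cg eta^3, so h^rho eta^4 <= 1 controls it. The last square is at most d Cg^2 h eta^6. *)
Lemma energy_step (eta Cg h d t q : R) n j z oo :
  0 < h <= 1 -> t = j%:R * h + d -> 0 <= d <= h ->
  `|h| `^ (- chi) = eta -> 1 <= eta -> h `^ rho * eta ^+ 4 <= 1 -> h * eta ^+ 6 <= 1 -> 0 <= Cg -> 0 <= q ->
  z (j%:R * h) = proj n (z (j%:R * h)) -> oo (j%:R * h) = proj n (oo (j%:R * h)) ->
  z t = proj n (z t) -> oo t = proj n (oo t) ->
  z (j%:R * h) = scheme rho chi xi F n h z oo (j%:R * h) -> z t = scheme rho chi xi F n h z oo t ->
  (forall v, Hr rho v -> Hr_norm rho v <= eta -> `|F v| <= Cg * eta ^+ 3) ->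
  L2dot (z (j%:R * h) - oo (j%:R * h)) (F (z (j%:R * h))) <= q ->
  `|z t - oo t| ^+ 2 <= `|z (j%:R * h) - oo (j%:R * h)| ^+ 2 +
    d * (4 * (2 + Hr_norm rho xi) * Cg + Cg ^+ 2 + 2 * q).
Proof.
move=> /andP[h0 h1] tE dI etaE eta1 he4 he6 Cg0 q0 zPa oPa zPt oPt zj zt hF hq.
have /andP[d0 dh] := dI; have /andP[r0 r1] := rho01.
set a := j%:R * h; set y := z a - oo a; set f := forcing rho chi xi F n h z oo a.
set N := Hr_norm rho xi; have N0 : 0 <= N := Hr_norm_ge0 _ _.
have eta0 : 0 <= eta by exact: le_trans eta1.
have a0 : 0 <= a by rewrite mulr_ge0// ltW.
have yP : y = proj n y by rewrite /y projB -zPa -oPa.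
have zr : Hr rho (z a) by rewrite zPa; exact: proj_Hr.
have or : Hr rho (oo a) by rewrite oPa; exact: proj_Hr.
have yr : Hr rho y by exact: (HrB zr or).
pose E k := expR (- (d * lam k)) : R; pose B k := (1 - E k) / lam k.
have l0 k : (0 : R) < lam k := lam_gt0 k.
have Bd k : 0 <= B k <= d := decay_sqr_le (l0 k) d0.
have E1 k : 0 <= E k <= 1.
  by rewrite expR_ge0 expR_le1 oppr_le0 mulr_ge0// ltW.
have normP (v : H R) : v = proj n v -> `|v| ^+ 2 = \sum_(k < n) coord v k ^+ 2.
  by move=> {1}->; rewrite norm_synth.
have wP : z t - oo t = proj n (z t - oo t) by rewrite projB -zPt -oPt.
have cw (k : 'I_n) : coord (z t - oo t) k = E k * coord y k + B k * coord f k.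
  exact: (scheme_step h0 tE dI (ltn_ord k) zj zt).
(* either the truncation switches F off, or both z and oo are controlled *)
have [f0|[fF zN oN]] : f = 0 \/ [/\ f = F (z a), Hr_norm rho (z a) <= eta &
    Hr_norm rho (oo a) <= eta + N].
- rewrite /f /forcing etaE.
  have [hle|hle] := boolP (Hr_norm rho (z a) + Hr_norm rho (oo a + proj n (heat a xi)) <= eta); last first.
    by left; rewrite /= mulr0n scale0r.
  right; rewrite scale1r.
  have g1 := Hr_norm_ge0 rho (z a); have g2 := Hr_norm_ge0 rho (oo a + proj n (heat a xi)).
  split => //; first by apply: le_trans hle; rewrite lerDl.
  have [hr hn] := heat_Hr a0 xir.
  rewrite -[oo a](addrK (proj n (heat a xi))).
  apply: le_trans (Hr_normB (HrD or (proj_Hr _ _ _)) (proj_Hr _ _ _)) _.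
  apply: lerD; first by apply: le_trans hle; rewrite lerDr.
  exact: le_trans (Hr_norm_proj n hr) hn.
(* With the drift switched off, the step only damps every coordinate. *)
- have D0 : 0 <= d * (4 * (2 + N) * Cg + Cg ^+ 2 + 2 * q).
    apply: mulr_ge0 => //; apply: addr_ge0; last exact: mulr_ge0.
    by apply: addr_ge0; [apply: mulr_ge0 => //; apply: mulr_ge0 => //; exact: addr_ge0|exact: sqr_ge0].
  apply: (@le_trans _ _ (`|y| ^+ 2)); last by rewrite lerDl.
  rewrite (normP _ wP) (normP _ yP); apply: ler_sum => k _.
  rewrite cw f0 coord0 mulr0 addr0 exprMn ler_piMl ?sqr_ge0//.
  by have /andP[e0 e1] := E1 k; rewrite exprn_ile1.
have fN : `|f| <= Cg * eta ^+ 3 by rewrite fF; exact: hF.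
have yN : Hr_norm rho y <= (2 + N) * eta.
  apply: le_trans (Hr_normB zr or) _; apply: le_trans (lerD zN oN) _.
  by rewrite mulrDl; have := ler_wpM2l N0 eta1; lra.
have e0 k : (E k * coord y k + B k * coord f k) ^+ 2 <=
    coord y k ^+ 2 + (2 * d * (coord y k * coord f k) +
    2 * (d * (2 * d) `^ rho) * (`|lam k `^ rho * coord y k| * `|coord f k|) + d ^+ 2 * coord f k ^+ 2).
  have /andP[b0 bd] := Bd k; have /andP[E0 Ek1] := E1 k.
  have h2 := decay_defect (l0 k) d0 rho01; rewrite -/(E k) -/(B k) in h2.
  have p1 : (E k * coord y k) ^+ 2 <= coord y k ^+ 2.
    by rewrite exprMn ler_piMl ?sqr_ge0// exprn_ile1.
  have p2 : (B k * coord f k) ^+ 2 <= d ^+ 2 * coord f k ^+ 2.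
    by rewrite exprMn ler_wpM2r ?sqr_ge0// lerXn2r ?nnegrE.
  have p3 : (E k * B k - d) * (coord y k * coord f k) <=
      d * (2 * d) `^ rho * (`|lam k `^ rho * coord y k| * `|coord f k|).
    apply: le_trans (ler_norm _) _; rewrite normrM.
    apply: (@le_trans _ _ (d * ((2 * d) `^ rho * lam k `^ rho) * `|coord y k * coord f k|)).
      by rewrite ler_wpM2r.
    by rewrite !normrM (ger0_norm (powR_ge0 _ _)) !mulrA.
  have -> : (E k * coord y k + B k * coord f k) ^+ 2 = (E k * coord y k) ^+ 2 +
      2 * (E k * B k * (coord y k * coord f k)) + (B k * coord f k) ^+ 2 by ring.
  have -> : E k * B k * (coord y k * coord f k) =
      d * (coord y k * coord f k) + (E k * B k - d) * (coord y k * coord f k) by ring.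
  move: p1 p2 p3; set u1 := (E k * _) ^+ 2; set u2 := (B k * _) ^+ 2.
  set u3 := (E k * B k - d) * _; set u4 := d * _ * (_ * _).
  exact: square_terms_le.
have fs : \sum_(k < n) coord f k ^+ 2 <= `|f| ^+ 2 := sum_coord_sqr_le n f.
have ys : \sum_(k < n) (lam k `^ rho * coord y k) ^+ 2 <= Hr_norm rho y ^+ 2.
  have := sum_coord_sqr_le n (opow rho y); rewrite -Hr_normE; apply: le_trans.
  by apply: ler_sum => k _; rewrite coord_opow.
have s2 : \sum_(k < n) `|lam k `^ rho * coord y k| * `|coord f k| <= (2 + N) * eta * (Cg * eta ^+ 3).
  have g0 : 0 <= (2 + N) * eta := mulr_ge0 (addr_ge0 (ler0n _ 2) N0) (le_trans ler01 eta1).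
  have g1 : 0 <= Cg * eta ^+ 3 by apply: mulr_ge0 => //; exact: exprn_ge0.
  rewrite -(@ler_pXn2r _ 2)// ?nnegrE; last 2 first.
  - by apply: sumr_ge0 => k _; exact: mulr_ge0.
  - exact: mulr_ge0.
  apply: le_trans (sum_CauchySchwarz n (fun k => `|lam k `^ rho * coord y k|) (fun k => `|coord f k|)) _.
  rewrite exprMn; apply: ler_pM.
  - by apply: sumr_ge0 => k _; exact: sqr_ge0.
  - by apply: sumr_ge0 => k _; exact: sqr_ge0.
  - under eq_bigr do rewrite real_normK ?num_real//.
    by apply: le_trans ys _; apply: lerXn2r; rewrite ?nnegrE ?Hr_norm_ge0.
  - under eq_bigr do rewrite real_normK ?num_real//.
    by apply: le_trans fs _; apply: lerXn2r; rewrite ?nnegrE.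
have s1 : \sum_(k < n) coord y k * coord f k <= q.
  by rewrite -dot_synth -/(proj n y) -yP fF.
have dr : (2 * d) `^ rho <= 2 * h `^ rho.
  apply: (@le_trans _ _ ((2 * h) `^ rho)).
    by apply: ge0_ler_powR; rewrite ?nnegrE ?mulr_ge0 ?(ltW h0)// ler_wpM2l.
  rewrite powRM// ?(ltW h0)// ler_wpM2r ?powR_ge0// -[leRHS]powRr1//; apply: ler_powR => //.
  by rewrite ler1n.
have t2 : (2 * d) `^ rho * ((2 + N) * eta * (Cg * eta ^+ 3)) <= 2 * (2 + N) * Cg.
  have g0 : 0 <= (2 + N) * Cg := mulr_ge0 (addr_ge0 (ler0n _ 2) N0) Cg0.
  have -> : (2 + N) * eta * (Cg * eta ^+ 3) = (2 + N) * Cg * eta ^+ 4 by ring.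
  apply: (@le_trans _ _ (2 * h `^ rho * ((2 + N) * Cg * eta ^+ 4))).
    by rewrite ler_wpM2r// mulr_ge0// exprn_ge0.
  have -> : 2 * h `^ rho * ((2 + N) * Cg * eta ^+ 4) = 2 * (2 + N) * Cg * (h `^ rho * eta ^+ 4) by ring.
  by rewrite ler_piMr// -mulrA mulr_ge0.
have t3 : d * `|f| ^+ 2 <= Cg ^+ 2.
  apply: (@le_trans _ _ (h * (Cg * eta ^+ 3) ^+ 2)).
    by apply: ler_pM; rewrite ?sqr_ge0//; apply: lerXn2r; rewrite ?nnegrE// mulr_ge0// exprn_ge0.
  have -> : h * (Cg * eta ^+ 3) ^+ 2 = Cg ^+ 2 * (h * eta ^+ 6) by ring.
  by rewrite ler_piMr// sqr_ge0.
rewrite (normP _ wP) (normP _ yP).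
under eq_bigr do rewrite cw.
apply: le_trans (ler_sum _ (fun (k : 'I_n) _ => e0 k)) _.
rewrite !big_split/= -!mulr_sumr lerD2l.
have t4 := ler_wpM2l d0 t3; have t5 := ler_wpM2l d0 t2; have t6 := ler_wpM2l d0 s1.
have t7 : d ^+ 2 * (\sum_(k < n) coord f k ^+ 2) <= d * (d * `|f| ^+ 2).
  by rewrite mulrA -expr2 ler_wpM2l ?sqr_ge0.
have t8 : d * (2 * d) `^ rho * (\sum_(k < n) `|lam k `^ rho * coord y k| * `|coord f k|) <=
    d * ((2 * d) `^ rho * ((2 + N) * eta * (Cg * eta ^+ 3))).
  by rewrite mulrA ler_wpM2l// mulr_ge0// powR_ge0.
rewrite -(mulrA 2 d) -(mulrA 2 (d * _)).
move: t4 t5 t6 t7 t8; rewrite !(mulrDr d).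
set A1 := d * Cg ^+ 2; set A2 := d * (2 * _ * _); set A3 := d * q.
set X3 := d ^+ 2 * (\sum_(k < n) _).
set X1 := d * (\sum_(k < n) _); set X2 := d * _ * (\sum_(k < n) _).
set X4 := d * (d * _); set X5 := d * (_ * (_ * _ * _)).
have -> : d * (4 * (2 + N) * Cg) = 2 * A2 by rewrite /A2; ring.
have -> : d * (2 * q) = 2 * A3 by rewrite /A3; ring.
exact: energy_terms_le.
Qed.

(** Full steps up to the last grid point before t, then one partial step. The sum runs over the grid
    points up to T, so the bound does not depend on t; it starts from z - oo = [proj n xi] at time
    0. *)
Lemma energy_bound (eta Cg h t T : R) (q : nat -> R) n z oo :
  0 < h <= 1 -> t \in `[0, T] ->
  `|h| `^ (- chi) = eta -> 1 <= eta -> h `^ rho * eta ^+ 4 <= 1 -> h * eta ^+ 6 <= 1 -> 0 <= Cg ->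
  (forall j, 0 <= q j) ->
  (forall s, s \in `[0, T] -> z s = proj n (z s)) ->
  (forall s, s \in `[0, T] -> oo s = proj n (oo s)) ->
  (forall j, j%:R * h <= T -> z (j%:R * h) = scheme rho chi xi F n h z oo (j%:R * h)) ->
  z t = scheme rho chi xi F n h z oo t ->
  (forall v, Hr rho v -> Hr_norm rho v <= eta -> `|F v| <= Cg * eta ^+ 3) ->
  (forall j, j%:R * h <= T -> L2dot (z (j%:R * h) - oo (j%:R * h)) (F (z (j%:R * h))) <= q j) ->
  `|z t - oo t| ^+ 2 <= `|xi| ^+ 2 +
    \sum_(i < (Num.truncn (T / h)).+1)
      h * (4 * (2 + Hr_norm rho xi) * Cg + Cg ^+ 2 + 2 * q i).
Proof.
move=> hI tI etaE eta1 he4 he6 Cg0 q0 zP oP zg zt hF hq; have /andP[h0 h1] := hI.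
set C0 := 4 * _ * Cg + Cg ^+ 2.
have C00 : 0 <= C0.
  apply: addr_ge0; last exact: sqr_ge0.
  by apply: mulr_ge0 => //; apply: mulr_ge0 => //; apply: addr_ge0 => //; exact: Hr_norm_ge0.
have b0 i : 0 <= h * (C0 + 2 * q i).
  by apply: mulr_ge0; [exact: ltW|apply: addr_ge0 => //; exact: mulr_ge0].
have /andP[t0 tT] : 0 <= t <= T by move: tI; rewrite in_itv.
have T0 : 0 <= T by exact: le_trans tT.
have gI j : j%:R * h <= T -> j%:R * h \in `[0, T].
  by move=> jT; rewrite in_itv/= jT mulr_ge0// ltW.
have grid j : j%:R * h <= T ->
    `|z (j%:R * h) - oo (j%:R * h)| ^+ 2 <= `|xi| ^+ 2 + \sum_(i < j) h * (C0 + 2 * q i).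
  elim: j => [|j IH] jT.
    rewrite big_ord0 addr0 lerXn2r ?nnegrE//; apply: norm_le_coord => k.
    have [kn|kn] := ltnP k n; last first.
      by rewrite (zP _ (gI 0 jT)) (oP _ (gI 0 jT)) -projB coord_proj ltnNge kn normr0.
    have {1}-> := zg 0 jT; rewrite mul0r coordB coord_scheme// addrK.
    rewrite mul0r oppr0 expR0 mul1r set_itv1 (_ : Rintegral _ _ _ = 0) ?addr0//.
    by rewrite /Rintegral integral_set1.
  have jT' : j%:R * h <= T by apply: le_trans jT; rewrite ler_wpM2r ?(ltW h0)// ler_nat.
  have jE : j.+1%:R * h = j%:R * h + h by rewrite -natr1 mulrDl mul1r.
  have hh : 0 <= h <= h by rewrite lexx ltW.
  apply: le_trans (energy_step hI jE hh etaE eta1 he4 he6 Cg0 (q0 j) (zP _ (gI j jT')) (oP _ (gI j jT')) (zP _ (gI _ jT)) (oP _ (gI _ jT)) (zg j jT') (zg _ jT) hF (hq j jT')) _.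
  by rewrite big_ord_recr/= addrA lerD2r; exact: IH.
have [j _ /andP[j1 j2]] := round_down_grid h0 t0.
have jT : j%:R * h <= T by exact: le_trans j1 tT.
have jN : (j.+1 <= (Num.truncn (T / h)).+1)%N.
  have T0h : 0 <= T / h by rewrite divr_ge0// ltW.
  have /andP[_ h2] := truncn_itv T0h.
  by rewrite -(ltr_nat R); apply: le_lt_trans h2; rewrite ler_pdivlMr.
have tE : t = j%:R * h + (t - j%:R * h) by rewrite addrC subrK.
have dI : 0 <= t - j%:R * h <= h by rewrite subr_ge0 j1/= lerBlDl ltW.
apply: le_trans (energy_step hI tE dI etaE eta1 he4 he6 Cg0 (q0 j) (zP _ (gI j jT)) (oP _ (gI j jT)) (zP _ tI) (oP _ tI) (zg j jT) zt hF (hq j jT)) _.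
apply: (@le_trans _ _ (`|xi| ^+ 2 + \sum_(i < j.+1) h * (C0 + 2 * q i))).
  rewrite big_ord_recr/= addrA; apply: lerD; first exact: grid.
  rewrite -/C0; apply: ler_wpM2r; last by have /andP[] := dI.
  by apply: addr_ge0 => //; exact: mulr_ge0.
rewrite lerD2l -!(big_mkord xpredT (fun i => h * (C0 + 2 * q i))).
rewrite [leRHS](big_cat_nat (n := j.+1))//= lerDl; exact: sumr_ge0.
Qed.

End energy.

(** * Gaussian integrals and independence *)

Section gaussian.
Context {R : realType}.
Local Notation leb := (@lebesgue_measure R).

(** The Radon-Nikodym derivative of [normal_prob] has the same integrals over measurable sets as the
    normal density, hence equals it a.e. *)
Lemma integral_normal_density (s : R) (f : R -> R) : measurable_fun setT f -> (forall x, 0 <= f x) ->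
  (\int[normal_prob 0 s]_x (f x)%:E = \int[leb]_x (f x * normal_pdf 0 s x)%:E)%E.
Proof.
move=> mf f0; have dom := @normal_prob_dominates R 0 s.
rewrite -(@Radon_Nikodym_SigmaFinite.change_of_variables _ _ _ _ _ dom)//; last first.
  exact/measurable_EFinP.
set g := Radon_Nikodym_SigmaFinite.f _ _.
have gi := Radon_Nikodym_SigmaFinite.f_integrable dom.
have mp : measurable_fun setT (fun x => (normal_pdf 0 s x)%:E).
  by apply/measurable_EFinP; exact: measurable_normal_pdf.
have ge : ae_eq leb setT g (fun x => (normal_pdf 0 s x)%:E).
  apply: integral_ae_eq => // A _ mA.
  by rewrite -(Radon_Nikodym_SigmaFinite.f_integral dom).
apply: ae_eq_integral => //.
- by apply: emeasurable_funM; [exact/measurable_EFinP|exact: measurable_int gi].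
- by apply/measurable_EFinP; apply: measurable_funM => //; exact: measurable_normal_pdf.
- by under [X in ae_eq _ _ _ X]eq_fun do rewrite EFinM; exact: ae_eqe_mul2l.
Qed.

(** Completing the square: e^x times the centred density is e^(s^2/2) times the density with mean
    s^2. *)
Lemma integral_expR_normal (s : R) : s != 0 ->
  (\int[normal_prob 0 s]_x (expR x)%:E = (expR (s ^+ 2 / 2))%:E)%E.
Proof.
move=> s0; rewrite (integral_normal_density _ (@measurable_expR R) (@expR_ge0 R)).
have -> : (fun x => (expR x * normal_pdf 0 s x)%:E) =
    (fun x => (expR (s ^+ 2 / 2))%:E * (normal_pdf (s ^+ 2) s x)%:E)%E.
  apply/funext => x; rewrite -EFinM !normal_pdfE// /normal_fun; congr EFin.
  rewrite mulrCA [RHS]mulrCA -!expRD; congr (_ * expR _).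
  by field.
rewrite ge0_integralZl//; last 2 first.
- by apply/measurable_EFinP; exact: measurable_normal_pdf.
- by move=> x _; rewrite lee_fin normal_pdf_ge0.
by rewrite integral_normal_pdf mule1.
Qed.

End gaussian.

Section independence.
Context d d1 d2 (Omega : measurableType d) (T1 : measurableType d1) (T2 : measurableType d2).
Context (R : realType) (P : probability Omega R).

(** The joint law is the product of the laws by uniqueness of product measures; then Tonelli. *)
Lemma independent_integralM (Y : Omega -> T1) (Z : Omega -> T2) (f : T1 -> R) (g : T2 -> R) :
  measurable_fun setT Y -> measurable_fun setT Z ->
  measurable_fun setT f -> measurable_fun setT g -> (forall x, 0 <= f x) -> (forall x, 0 <= g x) ->
  (forall A B, measurable A -> measurable B ->
     P (Y @^-1` A `&` Z @^-1` B) = (P (Y @^-1` A) * P (Z @^-1` B))%E) ->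
  (\int[P]_w (f (Y w) * g (Z w))%:E = \int[P]_w (f (Y w))%:E * \int[P]_w (g (Z w))%:E)%E.
Proof.
move=> mY mZ mf mg f0 g0 ind.
pose Y' := mfun_Sub (mem_set mY); pose Z' := mfun_Sub (mem_set mZ).
pose YZ' := mfun_Sub (mem_set (measurable_fun_pair mY mZ)).
pose phi (z : T1 * T2) := (f z.1 * g z.2)%:E.
have mphi : measurable_fun setT phi.
  by apply/measurable_EFinP; apply: measurable_funM; exact: measurableT_comp.
have phi0 z : (0 <= phi z)%E by rewrite lee_fin mulr_ge0.
transitivity (\int[distribution P YZ']_z phi z)%E.
  by rewrite ge0_integral_distribution.
transitivity (\int[(distribution P Y' \x distribution P Z')%E]_z phi z)%E.
  apply: eq_measure_integral => A mA _; apply/esym.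
  by apply: product_measure_unique => // B C mB mC; exact: ind.
rewrite fubini_tonelli1//.
under eq_integral do rewrite /fubini_F/= /phi/=.
have eZ x : (\int[distribution P Z']_y (f x * g y)%:E = (f x)%:E * \int[P]_w (g (Z w))%:E)%E.
  under eq_integral do rewrite EFinM.
  rewrite ge0_integralZl//; [|exact/measurable_EFinP|by move=> y _; rewrite lee_fin|by rewrite lee_fin].
  rewrite ge0_integral_distribution//; exact/measurable_EFinP.
under eq_integral do rewrite eZ.
rewrite ge0_integralZr//; [|exact/measurable_EFinP|by move=> y _; rewrite lee_fin|]; last first.
  by apply: integral_ge0 => w _; rewrite lee_fin.
rewrite ge0_integral_distribution//; exact/measurable_EFinP.
Qed.

Lemma integral_law (Y : Omega -> T1) (nu : {measure set T1 -> \bar R}) (f : T1 -> R) :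
  measurable_fun setT Y -> measurable_fun setT f -> (forall x, 0 <= f x) ->
  (forall B, measurable B -> P (Y @^-1` B) = nu B) ->
  (\int[P]_w (f (Y w))%:E = \int[nu]_x (f x)%:E)%E.
Proof.
move=> mY mf f0 law; pose Y' := mfun_Sub (mem_set mY).
transitivity (\int[distribution P Y']_x (f x)%:E)%E.
  rewrite ge0_integral_distribution//; exact/measurable_EFinP.
by apply: eq_measure_integral => B mB _; exact: law.
Qed.

End independence.

Lemma prob_integral_cst d (Omega : measurableType d) (R : realType) (P : probability Omega R) (c : R) :
  (\int[P]_w c%:E = c%:E)%E.
Proof. by rewrite integral_cst// [X in (_ * X)%E]probability_setT mule1. Qed.

Lemma measurable_seq_sum d (Omega : measurableType d) (R : realType) (D : set Omega) (I : eqType)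
    (l : seq I) (f : I -> Omega -> R) :
  (forall i, i \in l -> measurable_fun D (f i)) ->
  measurable_fun D (fun w => \sum_(i <- l) f i w).
Proof.
elim: l => [|i l IH] mf; first by under eq_fun do rewrite big_nil; exact: measurable_cst.
under eq_fun do rewrite big_cons; apply: measurable_funD; first by apply: mf; exact: mem_head.
by apply: IH => j jl; apply: mf; rewrite inE jl orbT.
Qed.

(** * Exponential moments of elementary stochastic integrals *)

Section wiener_integrals.
Context d (Omega : measurableType d) (R : realType) (P : probability Omega R).
Local Notation leb := (@lebesgue_measure R).
Variables (T : R) (W : R -> H R -> Omega -> R).
Hypothesis hW : cylindrical_wiener P T W.
Implicit Types (s t r : R) (u v : H R) (Phi : elem_integrand R).

Lemma cw_zero t : t \in `[0, T] -> \forall w \ae P, W t 0 w = 0.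
Proof.
move=> tI; have aeP := ae_filter_ringOfSetsType P.
have := cw_linear hW 1 0 0 tI; apply: filterS => w.
by rewrite scaler0 addr0 mul1r => h; apply: (addrI (W t 0 w)); rewrite -h addr0.
Qed.

Lemma cw_sum t (I : Type) (l : seq I) (c : I -> R) (u : I -> H R) : t \in `[0, T] ->
  \forall w \ae P, W t (\sum_(i <- l) c i *: u i) w = \sum_(i <- l) c i * W t (u i) w.
Proof.
move=> tI; have aeP := ae_filter_ringOfSetsType P.
elim: l => [|i l IH].
  have := cw_zero tI; apply: filterS => w; by rewrite !big_nil.
have := cw_linear hW (c i) (u i) (\sum_(i <- l) c i *: u i) tI.
by move: IH; apply: filterS2 => w; rewrite !big_cons => -> ->.
Qed.

Lemma measurable_increment s t v : 0 <= s <= t -> t <= T -> measurable_fun setT (increment W s t v).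
Proof.
move=> /andP[s0 st] tT; apply: measurable_funB; apply: (cw_measurable hW).
  by rewrite in_itv/= tT (le_trans s0 st).
by rewrite in_itv/= s0 (le_trans st tT).
Qed.

(** The cases s = t and v = 0 lie outside [cw_gaussian]; there the increment vanishes, in the second
    case almost surely. *)
Lemma mgf_increment s t v : 0 <= s <= t -> t <= T ->
  (\int[P]_w (expR (increment W s t v w))%:E = (expR ((t - s) * `|v| ^+ 2 / 2))%:E)%E.
Proof.
move=> /andP[s0]; rewrite le_eqVlt => /predU1P[<-|st] tT.
  under eq_integral do rewrite /increment subrr expR0.
  by rewrite prob_integral_cst subrr !mul0r expR0.
have [v0|v0] := eqVneq v 0.
  have aeP := ae_filter_ringOfSetsType P.
  have z1 := cw_zero (_ : t \in `[0, T]); have z2 := cw_zero (_ : s \in `[0, T]).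
  have {}z1 := z1 (_ : t \in `[0, T]); rewrite in_itv/= in z1.
  rewrite (@ae_eq_integral _ _ _ P setT (cst 1%E))//.
  - by rewrite prob_integral_cst v0 normr0 expr0n/= mulr0 mul0r expR0.
  - apply/measurable_EFinP; apply: measurableT_comp => //; apply: measurable_increment => //.
    by rewrite s0 ltW.
  - have {}z1 := z1 (introT andP (conj (le_trans s0 (ltW st)) tT)).
    have {}z2 : \forall w \ae P, W s 0 w = 0.
      by apply: cw_zero; rewrite in_itv/= s0 (le_trans (ltW st) tT).
    move: z1 z2; apply: filterS2 => w z1 z2 _.
    by rewrite /increment v0 z1 z2 subrr expR0.
have sg0 : Num.sqrt (t - s) * `|v| != 0.
  by rewrite mulf_neq0 ?normr_eq0// gt_eqF// sqrtr_gt0 subr_gt0.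
have mi : measurable_fun setT (increment W s t v) by apply: measurable_increment => //; rewrite s0 ltW.
rewrite (@integral_law _ _ _ (measurableTypeR R) _ P (increment W s t v)
  (normal_prob 0 (Num.sqrt (t - s) * `|v|)) (@expR R))//; last first.
  by move=> B mB; exact: (cw_gaussian hW s0 st tT v0 mB).
by rewrite integral_expR_normal// exprMn sqr_sqrtr// subr_ge0 ltW.
Qed.

Lemma mgf_independent_increment s t v (Y : Omega -> R) : 0 <= s < t -> t <= T ->
  measurable_fun setT Y -> (forall B, measurable B -> wiener_past W s (Y @^-1` B)) ->
  (\int[P]_w (expR (Y w + increment W s t v w))%:E =
   \int[P]_w (expR (Y w))%:E * (expR ((t - s) * `|v| ^+ 2 / 2))%:E)%E.
Proof.
move=> /andP[s0 st] tT mY Ypast.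
have sI : 0 <= s <= t by rewrite s0 ltW.
rewrite -(mgf_increment _ sI tT); under eq_integral do rewrite expRD.
apply: (@independent_integralM _ _ _ _ (measurableTypeR R) (measurableTypeR R) R P
  Y (increment W s t v) (@expR R) (@expR R)) => //.
- exact: measurable_increment.
- by move=> A B mA mB; apply: (cw_independent hW) => //; exact: Ypast.
Qed.

Section elementary.
Variables (psi : H R) (Phi : elem_integrand R) (t : R).
Hypothesis t0T : 0 <= t <= T.
Hypothesis hPhi : forall p, p \in Phi -> 0 <= p.1.1 <= p.1.2 /\ p.1.2 <= t.

(** The scalar product of [psi] with the elementary integral up to time r, obtained by stopping both
    end points of each interval at r. *)
Let Y r w := \sum_(p <- Phi) L2dot psi p.2.2 *
  (W (Num.min p.1.2 r) p.2.1 w - W (Num.min p.1.1 r) p.2.1 w).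

(** The adjoint of [elem_op Phi s] applied to [psi]. By the Ito isometry the integral of its squared
    norm is the variance of the integral tested with [psi]. *)
Definition adjoint_elem s : H R :=
  \sum_(p <- Phi) (\1_(`]p.1.1, p.1.2]) s * L2dot psi p.2.2) *: p.2.1.

Let minI a r : 0 <= a -> 0 <= r <= t -> Num.min a r \in `[0, T].
Proof.
move=> a0 /andP[r0 rt]; have /andP[_ tT] := t0T.
by rewrite in_itv/= le_min a0 r0/= ge_min (le_trans rt tT) orbT.
Qed.

Let measurable_Y r : 0 <= r <= t -> measurable_fun setT (Y r).
Proof.
move=> rI; rewrite /Y; apply: measurable_seq_sum => p pP.
have [/andP[a0 ab] _] := hPhi pP.
apply: measurable_funM => //; apply: measurable_funB; apply: (cw_measurable hW); apply: minI => //.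
exact: le_trans ab.
Qed.

Let past_Y r (B : set R) : 0 <= r <= t -> measurable B -> wiener_past W r (Y r @^-1` B).
Proof.
move=> rI mB; rewrite /wiener_past; set G := [set A | _].
have mW a u : 0 <= a -> measurable_fun setT (W (Num.min a r) u : g_sigma_algebraType G -> R).
  move=> a0 _ C mC; rewrite setTI; apply: sub_sigma_algebra.
  exists (Num.min a r), u, C; split => //.
  by have /andP[r0 _] := rI; rewrite le_min a0 r0 ge_min lexx orbT.
have mY : measurable_fun setT (Y r : g_sigma_algebraType G -> R).
  rewrite /Y; apply: measurable_seq_sum => p pP.
  have [/andP[a0 ab] _] := hPhi pP.
  apply: measurable_funM => //; apply: measurable_funB; apply: mW => //.
  exact: le_trans ab.
by have := mY measurableT _ mB; rewrite setTI.
Qed.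

Let weight_bound := \sum_(p <- Phi) `|L2dot psi p.2.2| * `|p.2.1|.

Lemma adjoint_elem_le s : `|adjoint_elem s| <= weight_bound.
Proof.
apply: le_trans (ler_norm_sum _ _ _) _; apply: ler_sum => p _.
rewrite normrZ ler_wpM2r// normrM ler_piMl// indicE.
by case: (_ \in _); rewrite ?normr1 ?normr0.
Qed.

Lemma measurable_adjoint_elem (D : set R) : measurable_fun D (fun s => `|adjoint_elem s| ^+ 2).
Proof.
apply: measurable_funX; apply: measurable_norm_coord => k.
have -> : (fun s => coord (adjoint_elem s) k) =
    (fun s => \sum_(p <- Phi) (\1_(`]p.1.1, p.1.2]) s * L2dot psi p.2.2) * coord p.2.1 k).
  by apply/funext => s; rewrite coord_sum; apply: eq_bigr => p _; rewrite coordZ.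
apply: measurable_seq_sum => p _; apply: measurable_funM => //; apply: measurable_funM => //.
Qed.

Let V r := \int[leb]_(s in `[0, r]) (`|adjoint_elem s| ^+ 2).

Let Q r := (\int[P]_w (expR (Y r w))%:E = (expR (V r / 2))%:E)%E.

(** No end point of [Phi] lies strictly between a and b, so the adjoint is a constant v on (a, b],
    and the growth of [Y] is almost surely the increment of W along v. It is independent of [Y a],
    so the exponential moments multiply. *)
Let Q_step a b : 0 <= a < b -> b <= t ->
  (forall p, p \in Phi -> (p.1.1 <= a \/ b <= p.1.1) /\ (p.1.2 <= a \/ b <= p.1.2)) -> Q a -> Q b.
Proof.
move=> /andP[a0 ab] bt nop; rewrite /Q => Qa.
have /andP[t0 tT] := t0T.
have aI : 0 <= a <= t by rewrite a0 (le_trans (ltW ab)).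
have bI : 0 <= b <= t by rewrite bt (le_trans a0 (ltW ab)).
(* Indicates that the interval of [p] covers (a, b]; by hypothesis it covers or misses it. *)
pose kap (p : (R * R) * (H R * H R)) : R := ((b <= p.1.2) && ~~ (b <= p.1.1))%:R.
pose v := \sum_(p <- Phi) (kap p * L2dot psi p.2.2) *: p.2.1.
have av s : s \in `]a, b] -> adjoint_elem s = v.
  rewrite in_itv/= => /andP[as_ sb]; rewrite /v /adjoint_elem.
  apply: eq_big_seq => p pP; congr ((_ * _) *: _); have [h1 h2] := nop p pP.
  rewrite indicE /kap; congr (nat_of_bool _)%:R.
  apply/idP/andP; rewrite inE/= in_itv/=.
  - move=> /andP[k1 k2]; split; first by case: h2 => // h2; have := lt_le_trans as_ (le_trans k2 h2); rewrite ltxx.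
    by rewrite -ltNge; case: h1 => h1; [exact: le_lt_trans ab|have := lt_le_trans k1 (le_trans sb h1); rewrite ltxx].
  - move=> [k1 k2]; rewrite (le_trans sb k1) andbT.
    by case: h1 => h1; [exact: le_lt_trans as_|rewrite h1 in k2].
have cross x u w : x <= a \/ b <= x ->
    W (Num.min x b) u w - W (Num.min x a) u w = (b <= x)%R%:R * (W b u w - W a u w).
  case=> hx.
    rewrite !min_l//; last exact: le_trans hx (ltW ab).
    by rewrite subrr leNgt (le_lt_trans hx ab) mul0r.
  by rewrite !min_r ?hx ?mul1r// (le_trans (ltW ab)).
have bT : b \in `[0, T] by rewrite in_itv/= (le_trans a0 (ltW ab)) (le_trans bt).
have aT : a \in `[0, T] by rewrite in_itv/= a0 (le_trans (ltW ab) (le_trans bt tT)).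
have aeP := ae_filter_ringOfSetsType P.
have Yinc : \forall w \ae P, Y b w = Y a w + increment W a b v w.
  have := cw_sum Phi (fun p => kap p * L2dot psi p.2.2) (fun p => p.2.1) bT.
  have := cw_sum Phi (fun p => kap p * L2dot psi p.2.2) (fun p => p.2.1) aT.
  apply: filterS2 => w; rewrite -/v => ea eb.
  apply/eqP; rewrite addrC -subr_eq; apply/eqP.
  rewrite /increment ea eb /Y -!sumrB; apply: eq_big_seq => p pP.
  have [h1 h2] := nop p pP; have [/andP[_ pab] _] := hPhi pP.
  have e1 := cross _ p.2.1 w h1; have e2 := cross _ p.2.1 w h2.
  have kE : kap p = (b <= p.1.2)%R%:R - (b <= p.1.1)%R%:R :> R.
    rewrite /kap; case: (boolP (b <= p.1.1)) => hb; last by rewrite andbT subr0.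
    by rewrite (le_trans hb pab) subrr.
  rewrite -!mulrBr opprD opprK addrACA [X in _ * (X + _)]addrC.
  transitivity (L2dot psi p.2.2 * ((W (Num.min p.1.2 b) p.2.1 w - W (Num.min p.1.2 a) p.2.1 w) -
      (W (Num.min p.1.1 b) p.2.1 w - W (Num.min p.1.1 a) p.2.1 w))).
    by congr (_ * _); ring.
  by rewrite e1 e2 kE; ring.
have iV r : leb.-integrable `[0, r] (EFin \o (fun s => `|adjoint_elem s| ^+ 2)).
  apply: (bounded_integrable_itv (M := weight_bound ^+ 2)); first exact: measurable_adjoint_elem.
  move=> s _; rewrite normrX normr_id; apply: lerXn2r; rewrite ?nnegrE//; last exact: adjoint_elem_le.
  by apply: le_trans (adjoint_elem_le s).
have VE : V b = V a + (b - a) * `|v| ^+ 2.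
  have := @Rintegral_itvB _ _ (BLeft 0) (BRight b) a (iV b).
  rewrite !bnd_simp => /(_ a0 (ltW ab)) split.
  rewrite /V addrC; apply/eqP; rewrite -subr_eq; apply/eqP; rewrite split.
  transitivity (\int[leb]_(s in `]a, b]) (`|v| ^+ 2)).
    by apply: eq_Rintegral => s; rewrite inE/= => sI; rewrite av.
  rewrite Rintegral_cst; last exact: measurable_itv.
  have lE : leb `]a, b]%classic = (b - a)%:E by rewrite lebesgue_measure_itv/= lte_fin ab EFinB.
  rewrite mulrC; congr (_ * _); exact: (congr1 fine lE).
have bT' : b <= T by exact: le_trans bt tT.
have abI : 0 <= a <= b by rewrite a0 ltW.
transitivity (\int[P]_w (expR (Y a w + increment W a b v w))%:E)%E.
  apply: ae_eq_integral; first exact: measurableT.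
  - apply/measurable_EFinP; apply: (measurableT_comp (@measurable_expR R)); exact: measurable_Y.
  - apply/measurable_EFinP; apply: (measurableT_comp (@measurable_expR R)).
    by apply: measurable_funD; [exact: measurable_Y|exact: measurable_increment].
  - by apply: filterS Yinc => w -> _.
have abI' : 0 <= a < b by rewrite a0.
rewrite (mgf_independent_increment v abI' bT' (measurable_Y aI) (fun B mB => past_Y aI mB)).
by rewrite Qa -EFinM -expRD VE (mulrDl (V a)).
Qed.

(* induction on the number of end points strictly between a and b *)
Let Q_interval a b : 0 <= a < b -> b <= t -> Q a -> Q b.
Proof.
pose pts := [seq p.1.1 | p <- Phi] ++ [seq p.1.2 | p <- Phi].
suff H n : forall a b, (count (fun x => (a < x < b)%R) pts < n)%N -> 0 <= a < b -> b <= t -> Q a -> Q b.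
  exact: (H _ a b (ltnSn _)).
elim: n => [|n IH] {}a {}b; first by move=> cn; exfalso; rewrite ltn0 in cn.
rewrite ltnS => cn abI bt Qa.
have /andP[a0 ab] := abI.
have [/hasP[x xP /andP[ax xb]]|/hasPn none] := boolP (has (fun x => a < x < b) pts).
  have sub (a' b' : R) : a <= a' -> b' <= b -> ~~ (a' < x < b') ->
      (count (fun y => (a' < y < b')%R) pts < count (fun y => (a < y < b)%R) pts)%N.
    move=> aa bb nx; elim: (pts) xP => // y l IHl; rewrite inE => /predU1P[<-|xl] /=.
      rewrite (negbTE nx) ax xb add0n add1n ltnS; apply: sub_count => z /andP[z1 z2].
      by rewrite (le_lt_trans aa z1) (lt_le_trans z2 bb).
    have := IHl xl; case: (boolP (a' < y < b')) => [/andP[z1 z2]|_] hl.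
      by rewrite (le_lt_trans aa z1) (lt_le_trans z2 bb) !add1n ltnS.
    by rewrite add0n; apply: leq_trans hl _; exact: leq_addl.
  have Qx : Q x.
    apply: (IH a x) => //; [|by rewrite a0|exact: le_trans (ltW xb) bt].
    by apply: leq_trans cn; apply: sub => //; [exact: ltW|rewrite ltxx andbF].
  apply: (IH x b) => //; last by rewrite xb (le_trans a0 (ltW ax)).
  by apply: leq_trans cn; apply: sub => //; [exact: ltW|rewrite ltxx].
apply: (Q_step abI bt _ Qa) => p pP; have h x : x \in pts -> x <= a \/ b <= x.
  move=> /none; rewrite negb_and -!leNgt => /orP[]; [by left|by right].
by split; apply: h; rewrite mem_cat; apply/orP; [left|right]; apply/mapP; exists p.
Qed.

(** The exponential moment of a centred Gaussian variable with the variance of the Ito isometry,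
    carried from time 0 to time t by [Q_interval]. *)
Lemma mgf_elem_integral :
  (\int[P]_w (expR (L2dot psi (elem_integral W Phi w)))%:E =
   (expR ((\int[leb]_(s in `[0, t]) (`|adjoint_elem s| ^+ 2)) / 2))%:E)%E.
Proof.
have /andP[t0 tT] := t0T.
have Q0 : Q 0.
  rewrite /Q /V set_itv1 Rintegral_set1 mul0r expR0.
  under eq_integral.
    move=> w _; rewrite /Y big_seq big1; last first.
      move=> p pP; have [/andP[p0 pab] _] := hPhi pP.
      by rewrite !min_r ?subrr ?mulr0// (le_trans p0).
    rewrite expR0; over.
  exact: prob_integral_cst.
have Qt : Q t.
  move: t0; rewrite le_eqVlt => /predU1P[<-//|t0].
  by apply: (Q_interval (a := 0)) => //; rewrite lexx.
rewrite -Qt; apply: eq_integral => w _; congr (expR _)%:E.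
rewrite /elem_integral L2dot_sumr /Y; apply: eq_big_seq => p pP.
have [/andP[p0 pab] pt] := hPhi pP.
by rewrite L2dotZr mulrC /increment !min_l// (le_trans pab).
Qed.

End elementary.
End wiener_integrals.

(** * Borel measurability of H-valued random variables *)

Section borel_measurability.
Context d (Omega : measurableType d) (R : realType).

Lemma borel_measurable_lipschitz (V : normedModType R) (Y : Omega -> V) (g : V -> R) (C : R) :
  borel_measurable Y -> (forall v w, `|g v - g w| <= C * `|v - w|) -> measurable_fun setT (g \o Y).
Proof.
move=> bY lip; have cg : continuous g.
  move=> v; apply/cvgrPdist_le => eps e0; have C1 : 0 < `|C| + 1 by rewrite ltr_pwDr.
  have e1 : 0 < eps / (`|C| + 1) by rewrite divr_gt0.
  apply: filterS (nbhsx_ballx v _ e1) => w; rewrite -ball_normE /= ltr_pdivlMr// mulrC => vw.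
  apply: le_trans (lip _ _) _; apply: le_trans (ltW vw); rewrite ler_wpM2r//.
  by apply: le_trans (ler_norm C) _; rewrite lerDl.
apply: (measurability _ (RGenOpens.measurableE R)) => _ [_ [a [b ->] <-]]; rewrite setTI.
have /continuousP co := cg; exact: (bY _ (co _ (interval_open _ _))).
Qed.

Lemma borel_measurable_contraction (V : normedModType R) (Y : Omega -> V) (g : V -> V) :
  borel_measurable Y -> (forall v w, `|g v - g w| <= `|v - w|) -> borel_measurable (g \o Y).
Proof.
move=> bY lip U oU; have cg : continuous g.
  move=> v; apply/cvgrPdist_le => eps e0.
  apply: filterS (nbhsx_ballx v _ e0) => w; rewrite -ball_normE /= => vw.
  exact: le_trans (lip _ _) (ltW vw).
have /continuousP co := cg; exact: (bY _ (co _ oU)).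
Qed.

Lemma borel_measurable_dot (Y : Omega -> H R) (u : H R) : borel_measurable Y ->
  measurable_fun setT (fun w => L2dot u (Y w) : R).
Proof.
move=> bY; apply: (borel_measurable_lipschitz (g := fun v : H R => L2dot u v : R) (C := `|u|) bY).
by move=> v w; rewrite -L2dotBr; exact: L2_CauchySchwarz.
Qed.

Lemma borel_measurable_proj (Y : Omega -> H R) n : borel_measurable Y ->
  borel_measurable (fun w => proj n (Y w)).
Proof.
by move=> bY; apply: (borel_measurable_contraction bY) => v w; rewrite -projB norm_proj.
Qed.

Lemma measurable_elem_integral_dot (P : probability Omega R) (T : R) W (Phi : elem_integrand R) (u : H R) (t : R) :
  cylindrical_wiener P T W -> t <= T ->
  (forall p, p \in Phi -> 0 <= p.1.1 <= p.1.2 /\ p.1.2 <= t) ->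
  measurable_fun setT (fun w => L2dot u (elem_integral W Phi w) : R).
Proof.
move=> hW tT hPhi.
have -> : (fun w => L2dot u (elem_integral W Phi w) : R) =
    (fun w => \sum_(p <- Phi) increment W p.1.1 p.1.2 p.2.1 w * L2dot u p.2.2).
  by apply/funext => w; rewrite L2dot_sumr; apply: eq_bigr => p _; rewrite L2dotZr.
apply: measurable_seq_sum => p pP; apply: measurable_funM => //.
have [pI pt] := hPhi p pP; apply: (measurable_increment hW) => //; exact: le_trans pt tT.
Qed.

End borel_measurability.

(** * Moments of the stochastic convolution *)

Section gaussian_moments.
Context d (Omega : measurableType d) (R : realType) (P : probability Omega R).
Local Notation leb := (@lebesgue_measure R).
Variables (T : R) (W : R -> H R -> Omega -> R).
Hypothesis hW : cylindrical_wiener P T W.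
Implicit Types (s t r : R) (u v psi : H R) (Phi : elem_integrand R).

(** A single term of the exponential series at |x|, and e^|x| <= e^x + e^(-x). *)
Lemma even_power_le_expR (x : R) m : (0 < m)%N ->
  x ^+ m.*2 <= (m.*2)`!%:R * (expR x + expR (- x)).
Proof.
case: m => // m _; have e : m.+1.*2 = (m.*2.+1).+1 by rewrite doubleS.
have f0 : 0 < (m.+1.*2)`!%:R :> R by rewrite ltr0n fact_gt0.
rewrite -ler_pdivrMl//.
have -> : x ^+ m.+1.*2 = `|x| ^+ m.+1.*2.
  by rewrite -mul2n !exprM real_normK// num_real.
rewrite mulrC e; have := expR_ge1Dxn m.*2.+1 (normr_ge0 x) => h.
apply: (@le_trans _ _ (expR `|x|)); first by apply: le_trans h; rewrite lerDr.
have [x0|x0] := ger0P x; first by rewrite lerDl expR_ge0.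
by rewrite lerDr expR_ge0.
Qed.

(** The exponential moments are used for [psi] and for its negative, whose adjoints have the same
    norm. *)
Lemma elem_moment psi Phi t (B : R) m : (0 < m)%N -> 0 <= t <= T ->
  (forall p, p \in Phi -> 0 <= p.1.1 <= p.1.2 /\ p.1.2 <= t) ->
  \int[leb]_(s in `[0, t]) (`|adjoint_elem psi Phi s| ^+ 2) <= B ->
  (\int[P]_w (L2dot psi (elem_integral W Phi w) ^+ m.*2)%:E <=
   ((m.*2)`!%:R * (2 * expR (B / 2)))%:E)%E.
Proof.
move=> m0 tI hPhi VB; have /andP[t0 tT] := tI.
set L := fun w => L2dot psi (elem_integral W Phi w) : R.
have mL : measurable_fun setT L := measurable_elem_integral_dot psi hW tT hPhi.
have mE : measurable_fun setT (fun w => (expR (L w))%:E).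
  by apply/measurable_EFinP; apply: (measurableT_comp (@measurable_expR R)).
have mEN : measurable_fun setT (fun w => (expR (- L w))%:E).
  by apply/measurable_EFinP; apply: (measurableT_comp (@measurable_expR R)); exact: measurableT_comp.
have V2 : expR ((\int[leb]_(s in `[0, t]) (`|adjoint_elem psi Phi s| ^+ 2)) / 2) <= expR (B / 2).
  by rewrite ler_expR ler_wpM2r.
have E1 : (\int[P]_w (expR (L w))%:E <= (expR (B / 2))%:E)%E.
  by rewrite (mgf_elem_integral hW psi tI hPhi) lee_fin.
have E2 : (\int[P]_w (expR (- L w))%:E <= (expR (B / 2))%:E)%E.
  have LN w : - L w = L2dot (- psi) (elem_integral W Phi w) by rewrite /L (L2dotC (- psi)) L2dotNr L2dotC.
  under eq_integral do rewrite LN.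
  rewrite (mgf_elem_integral hW (- psi) tI hPhi) lee_fin; apply: le_trans V2.
  rewrite (_ : adjoint_elem (- psi) Phi = fun s => - adjoint_elem psi Phi s); last first.
    apply/funext => s; rewrite /adjoint_elem -sumrN; apply: eq_bigr => p _.
    by rewrite -scaleNr (L2dotC (- psi)) L2dotNr (L2dotC p.2.2) mulrN.
  by under eq_Rintegral do rewrite normrN.
apply: (@le_trans _ _ (\int[P]_w ((m.*2)`!%:R%:E * ((expR (L w))%:E + (expR (- L w))%:E)))%E).
  apply: ge0_le_integral_nomeas => w _; first by rewrite lee_fin -mul2n exprM exprn_ge0// sqr_ge0.
  by rewrite -EFinD -EFinM lee_fin; exact: even_power_le_expR.
rewrite ge0_integralZl//; last 2 first.
- exact: emeasurable_funD.
- by move=> w _; rewrite adde_ge0// lee_fin expR_ge0.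
rewrite EFinM; apply: lee_wpmul2l; first by rewrite lee_fin.
rewrite ge0_integralD//.
by apply: le_trans (leeD E1 E2) _; rewrite -EFinD lee_fin -mulr2n mulr_natl.
Qed.

Lemma HS_normE (e : nat -> H R) (B : H R -> H R) : (forall k, e k.+1 = basis k) ->
  HS_norm2 e B = (\sum_(k <oo) (`|B (basis k)| ^+ 2)%:E)%E.
Proof.
move=> he; rewrite /HS_norm2 -nneseries_addn; last by move=> k; rewrite lee_fin sqr_ge0.
by apply: eq_eseriesr => k _; rewrite addn1 he.
Qed.

Section truncated_convolution.
Variables (e : nat -> H R) (n : nat) (t : R).
Hypotheses (he : forall k, e k.+1 = basis k) (t0T : 0 <= t <= T).

Let Op s (v : H R) := proj n (heat (t - s) v).

Let diff Phi s k := Op s (basis k) - elem_op Phi s (basis k).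

Let coord_adjoint psi Phi s k :
  coord (adjoint_elem psi Phi s) k = L2dot psi (elem_op Phi s (basis k)).
Proof.
rewrite coord_sum /elem_op L2dot_sumr; apply: eq_bigr => p _.
by rewrite coordZ L2dotZr /coord (L2dotC p.2.1); ring.
Qed.

Let Op_basis s k : s <= t -> Op s (basis k) = if (k < n)%N then expR (- ((t - s) * lam k)) *: basis k else 0.
Proof.
move=> st; have ts : 0 <= t - s by rewrite subr_ge0.
apply: coord_inj => i; rewrite coord_proj coord_heat// coord_basis.
have [<-|ki] := eqVneq k i; first by case: (k < n)%N; rewrite ?coordZ ?coord0 ?coord_basis ?eqxx.
by case: (k < n)%N; rewrite ?coordZ ?coord0 ?coord_basis ?(negbTE ki) !mulr0; case: (i < n)%N.
Qed.

Let measurable_diff Phi (k : nat) : measurable_fun (`[0, t] : set R) (fun s => (`|diff Phi s k| ^+ 2)%:E).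
Proof.
apply/measurable_EFinP; apply: measurable_funX; apply: measurable_norm_coord => i.
apply: (@eq_measurable_fun _ _ _ _ _ (fun s : R =>
   (if (k < n)%N then expR (- ((t - s) * lam k)) * coord (basis k) i else 0) -
   \sum_(p <- Phi) (\1_(`]p.1.1, p.1.2]) s * L2dot p.2.1 (basis k)) * coord p.2.2 i)).
  move=> s; rewrite inE/= in_itv/= => /andP[_ st].
  rewrite /diff coordB Op_basis//; congr (_ - _).
    by case: ifP; rewrite ?coordZ ?coord0.
  by rewrite /elem_op coord_sum; apply: eq_bigr => p _; rewrite coordZ.
apply: measurable_funB.
  case: (k < n)%N => //; apply: measurable_funM => //.
  apply: (measurableT_comp (@measurable_expR R)).
  by apply: measurableT_comp => //; apply: measurable_funM => //; exact: measurable_funB.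
apply: measurable_seq_sum => p _; apply: measurable_funM => //; apply: measurable_funM => //.
Qed.

(** Coordinate k of the adjoint is the scalar product of [psi] with Phi_s (basis k). Replacing Phi_s
    by the projected semigroup costs the Hilbert-Schmidt error, and the projected semigroup is
    diagonal. *)
Let adjoint_le psi Phi s : s <= t ->
  ((`|adjoint_elem psi Phi s| ^+ 2)%:E <=
   (2 * `|psi| ^+ 2)%:E * (\sum_(k <oo) (`|diff Phi s k| ^+ 2)%:E) +
   (\sum_(k < n) 2 * coord psi k ^+ 2 * expR (- ((t - s) * lam k)) ^+ 2)%:E)%E.
Proof.
move=> st.
pose m k := if (k < n)%N then 2 * coord psi k ^+ 2 * expR (- ((t - s) * lam k)) ^+ 2 else 0.
have m0 k : 0 <= m k by rewrite /m; case: ifP => // _; apply: mulr_ge0 (sqr_ge0 _); apply: mulr_ge0 (sqr_ge0 _).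
have mE : ((\sum_(k < n) 2 * coord psi k ^+ 2 * expR (- ((t - s) * lam k)) ^+ 2)%:E =
    \sum_(k <oo) (m k)%:E)%E.
  rewrite (nneseries_split 0 n); last by move=> k _; rewrite lee_fin.
  rewrite add0n [X in (_ + X)%E](_ : _ = 0%E); last first.
    apply: eseries0 => k nk _; by rewrite /m ltnNge nk.
  rewrite adde0 big_mkord -sumEFin; apply: eq_bigr => k _; by rewrite /m ltn_ord.
rewrite mE -nneseriesZl; last by move=> k _; rewrite lee_fin sqr_ge0.
rewrite -nneseriesD; last 2 first.
- by move=> k _; rewrite mule_ge0// lee_fin ?sqr_ge0// mulr_ge0 ?sqr_ge0.
- by move=> k _; rewrite lee_fin.
rewrite -parseval; apply: lee_nneseries => k _; first by rewrite lee_fin sqr_ge0.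
rewrite -EFinM -EFinD lee_fin coord_adjoint.
have -> : elem_op Phi s (basis k) = Op s (basis k) - diff Phi s k by rewrite /diff opprB addrC subrK.
rewrite L2dotBr.
have h1 : L2dot psi (diff Phi s k) ^+ 2 <= `|psi| ^+ 2 * `|diff Phi s k| ^+ 2.
  have := L2_CauchySchwarz psi (diff Phi s k).
  by rewrite -exprMn -(real_normK (num_real (L2dot _ _))); apply: lerXn2r; rewrite ?nnegrE// mulr_ge0.
have h2 : 2 * L2dot psi (Op s (basis k)) ^+ 2 = m k.
  rewrite Op_basis// /m; case: ifP => _; last by rewrite L2dot0r expr0n/= mulr0.
  by rewrite L2dotZr L2dotC -/(coord psi k) exprMn; ring.
apply: (le_trans (sqrD_le _ _)); rewrite sqrrN h2 addrC lerD2r -mulrA ler_wpM2l//.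
Qed.

(** The time integral of the squared heat kernel at lam k is at most 1/(2 lam k). Weighting squared
    coordinates by 1/lam keeps the variance bounded even when [psi] approximates a point
    evaluation. *)
Lemma adjoint_energy_le psi Phi :
  (\int[leb]_(s in `[0%R, t]) HS_norm2 e (fun x => (Op s x - elem_op Phi s x)%R) \is a fin_num)%E ->
  \int[leb]_(s in `[0, t]) (`|adjoint_elem psi Phi s| ^+ 2) <=
    2 * `|psi| ^+ 2 * fine (\int[leb]_(s in `[0%R, t]) HS_norm2 e (fun x => (Op s x - elem_op Phi s x)%R))%E +
    \sum_(k < n) coord psi k ^+ 2 / lam k.
Proof.
have /andP[t0 tT] := t0T.
have hE s : HS_norm2 e (fun x => (Op s x - elem_op Phi s x)%R) = (\sum_(k <oo) (`|diff Phi s k| ^+ 2)%:E)%E.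
  by rewrite HS_normE.
under eq_integral do rewrite hE.
move=> fin; rewrite -lee_fin.
have iA : leb.-integrable `[0, t] (EFin \o (fun s => `|adjoint_elem psi Phi s| ^+ 2)).
  pose wb := \sum_(p <- Phi) `|L2dot psi p.2.2| * `|p.2.1|.
  apply: (bounded_integrable_itv (M := wb ^+ 2)); first exact: measurable_adjoint_elem.
  move=> s _; rewrite normrX normr_id; apply: lerXn2r; rewrite ?nnegrE//; last exact: adjoint_elem_le.
  by apply: le_trans (adjoint_elem_le psi Phi s).
have -> : (\int[leb]_(s in `[0, t]) (`|adjoint_elem psi Phi s| ^+ 2))%:E =
    (\int[leb]_(s in `[0%R, t]) (`|adjoint_elem psi Phi s| ^+ 2)%:E)%E.
  by rewrite /Rintegral fineK//; exact: (@integrable_fin_num _ _ _ leb `[0, t]%classic (measurable_itv _) _ iA).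
pose G s := (\sum_(k <oo) (`|diff Phi s k| ^+ 2)%:E)%E.
pose M s := \sum_(k < n) 2 * coord psi k ^+ 2 * expR (- ((t - s) * lam k)) ^+ 2.
have G0 s : (0 <= G s)%E by apply: nneseries_ge0 => k _; rewrite lee_fin sqr_ge0.
have M0 s : 0 <= M s.
  by apply: sumr_ge0 => k _; apply: mulr_ge0 (sqr_ge0 _); apply: mulr_ge0 (sqr_ge0 _).
have mG : measurable_fun (`[0, t] : set R) G.
  apply: ge0_emeasurable_sum => // k s _ _; by rewrite lee_fin sqr_ge0.
have me k : measurable_fun (`[0, t] : set R) (fun s : R => expR (- ((t - s) * lam k)) ^+ 2).
  apply: measurable_funX; apply: (measurableT_comp (@measurable_expR R)).
  by apply: measurableT_comp => //; apply: measurable_funM => //; exact: measurable_funB.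
have mM : measurable_fun (`[0, t] : set R) M.
  by apply: measurable_sum => k; exact: measurable_funM.
have ie k : leb.-integrable `[0, t] (EFin \o (fun s : R => expR (- ((t - s) * lam k)) ^+ 2)).
  apply: (bounded_integrable_itv (M := 1)) => // s; rewrite in_itv/= => /andP[_ st].
  rewrite ger0_norm ?sqr_ge0// exprn_ile1 ?expR_ge0// expR_le1 oppr_le0 mulr_ge0 ?subr_ge0// ltW//.
  exact: lam_gt0.
apply: (@le_trans _ _ (\int[leb]_(s in `[0%R, t]) ((2 * `|psi| ^+ 2)%:E * G s + (M s)%:E))%E).
  apply: ge0_le_integral_nomeas => s; first by rewrite lee_fin sqr_ge0.
  by rewrite /= in_itv/= => /andP[_ st]; exact: adjoint_le.
have c0 : 0 <= 2 * `|psi| ^+ 2 by rewrite mulr_ge0 ?sqr_ge0.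
rewrite ge0_integralD//; last 4 first.
- by move=> s _; rewrite mule_ge0// lee_fin.
- by apply: emeasurable_funM => //; exact: measurable_cst.
- by move=> s _; rewrite lee_fin.
- exact/measurable_EFinP.
rewrite ge0_integralZl//.
rewrite EFinD (EFinM (2 * `|psi| ^+ 2)) fineK//; apply: leeD => //.
have -> : (\int[leb]_(s in `[0%R, t]) (M s)%:E = \sum_(k < n) (2 * coord psi k ^+ 2)%:E * \int[leb]_(s in `[0%R, t]) (expR (- ((t - s) * lam k)) ^+ 2)%:E)%E.
  under eq_integral do rewrite /M -sumEFin.
  rewrite ge0_integral_sum//; last 2 first.
  - by move=> k; apply/measurable_EFinP; apply: measurable_funM; [exact: measurable_cst|exact: me].
  - by move=> k s _; rewrite lee_fin; apply: mulr_ge0 (sqr_ge0 _); apply: mulr_ge0 (sqr_ge0 _).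
  apply: eq_bigr => k _; under eq_integral do rewrite EFinM.
  rewrite ge0_integralZl//; [by apply/measurable_EFinP; exact: me|].
  by rewrite lee_fin mulr_ge0 ?sqr_ge0.
rewrite -sumEFin; apply: lee_sum => k _.
have -> : (\int[leb]_(s in `[0%R, t]) (expR (- ((t - s) * lam k)) ^+ 2)%:E)%E =
   (\int[leb]_(s in `[0, t]) (expR (- ((t - s) * lam k)) ^+ 2))%:E.
  by rewrite /Rintegral fineK//; exact: (@integrable_fin_num _ _ _ leb `[0, t]%classic (measurable_itv _) _ (ie k)).
have l0 : (0 : R) < lam k := lam_gt0 k.
rewrite -EFinM lee_fin; apply: (@le_trans _ _ (2 * coord psi k ^+ 2 * (1 / (2 * lam k)))).
  by apply: ler_wpM2l; [exact: mulr_ge0 (sqr_ge0 _)|exact: heat_kernel_sqr].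
rewrite (_ : _ * _ = coord psi k ^+ 2 / lam k)//; field.
by rewrite gt_eqF.
Qed.

(** Fatou along an a.s. convergent subsequence of elementary integrals. The summand 1 absorbs 2
    |psi|^2 times the Hilbert-Schmidt error, which is at most 1 eventually. *)
Lemma stoch_moment psi (I : Omega -> H R) m : (0 < m)%N ->
  stoch_integral P W e t (fun s v => proj n (heat (t - s) v)) I ->
  (\int[P]_w (L2dot psi (I w) ^+ m.*2)%:E <=
   ((m.*2)`!%:R * (2 * expR ((1 + \sum_(k < n) coord psi k ^+ 2 / lam k) / 2)))%:E)%E.
Proof.
move=> m0 [bI [Phin [hPhi hHS hI]]]; have /andP[t0 tT] := t0T.
have mI u : measurable_fun setT (fun w => L2dot u (I w) : R) by exact: borel_measurable_dot.
have mD i : measurable_fun setT (fun w => `|I w - elem_integral W (Phin i) w| ^+ 2).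
  apply: measurable_funX; apply: measurable_norm_coord => k.
  under eq_fun do rewrite coordB; apply: measurable_funB; first exact: mI.
  exact: (measurable_elem_integral_dot (basis k) hW tT (hPhi i)).
have [phi [phi_ge phi_cv]] := ae_subseq_cvg0 measurableT mD (fun i w _ => sqr_ge0 _) hI.
have aeP := ae_filter_ringOfSetsType P.
apply: (@fatou_le _ _ _ P setT (fun i w => L2dot psi (elem_integral W (Phin (phi i)) w) ^+ m.*2)) => //.
- move=> i; apply: measurable_funX.
  exact: (measurable_elem_integral_dot psi hW tT (hPhi (phi i))).
- by move=> i w _; rewrite -mul2n exprM exprn_ge0// sqr_ge0.
- by apply: measurable_funX; exact: mI.
- by move=> w _; rewrite -mul2n exprM exprn_ge0// sqr_ge0.
- apply: filterS phi_cv => w /(_ Logic.I) cv _.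
  have c1 : L2dot psi (elem_integral W (Phin (phi i)) w) @[i --> \oo] --> L2dot psi (I w).
    apply/cvgrPdist_le => eps e0; have p1 : 0 < `|psi| + 1 by rewrite ltr_pwDr.
    have e1 : 0 < eps / (`|psi| + 1) by rewrite divr_gt0.
    have /cvgr0_norm_le/(_ _ e1) := sqr_cvg0 cv; apply: filterS => i.
    rewrite normr_id ler_pdivlMr// => h.
    rewrite -L2dotBr; apply: le_trans (L2_CauchySchwarz _ _) _.
    by apply: le_trans h; rewrite mulrC ler_wpM2l// lerDl.
  apply: (@cvg_comp _ _ _ (fun i => L2dot psi (elem_integral W (Phin (phi i)) w)) (fun y : R => y ^+ m.*2) _ _ _ c1).
  exact: exprn_continuous.
have /fine_cvgP[fn fc] := hHS.
have c0 : 0 < 2 * `|psi| ^+ 2 + 1 by rewrite ltr_wpDl// mulr_ge0 ?sqr_ge0.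
have c1 : 0 < (2 * `|psi| ^+ 2 + 1)^-1 by rewrite invr_gt0.
have /cvgr0_norm_le/(_ _ c1) small := fc.
have [N _ hN] : \forall i \near \oo, (\int[leb]_(s in `[0%R, t]) HS_norm2 e (fun x => (Op s x - elem_op (Phin i) s x)%R) \is a fin_num)%E /\
    `|fine (\int[leb]_(s in `[0%R, t]) HS_norm2 e (fun x => (Op s x - elem_op (Phin i) s x)%R))%E| <= (2 * `|psi| ^+ 2 + 1)^-1.
  by near=> i; split; near: i.
exists N => // i Ni; have [fi si] := hN (phi i) (leq_trans Ni (phi_ge i)).
apply: (elem_moment m0 t0T (hPhi (phi i))).
apply: le_trans (adjoint_energy_le psi fi) _; rewrite lerD2r.
apply: (@le_trans _ _ ((2 * `|psi| ^+ 2 + 1) * (2 * `|psi| ^+ 2 + 1)^-1)); last by rewrite divff// gt_eqF.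
apply: (@le_trans _ _ (2 * `|psi| ^+ 2 * (2 * `|psi| ^+ 2 + 1)^-1)).
  by rewrite ler_wpM2l ?mulr_ge0 ?sqr_ge0//; exact: le_trans (ler_norm _) si.
by rewrite ler_wpM2r ?(ltW c1)// lerDl.
Unshelve. all: by end_near. Qed.

(** Projecting the values of the approximating elementary integrands projects their integrals, and
    neither error increases since [proj n] is a contraction. *)
Lemma stoch_integral_proj (g : Omega -> H R) :
  stoch_integral P W e t (fun s => heat (t - s)) g ->
  stoch_integral P W e t (fun s v => proj n (heat (t - s) v)) (fun w => proj n (g w)).
Proof.
move=> [bg [Phin [hPhi hHS hg]]]; split; first exact: borel_measurable_proj.
pose pr (p : (R * R) * (H R * H R)) := (p.1, (p.2.1, proj n p.2.2)).
have proj_sum (l : elem_integrand R) (c : (R * R) * (H R * H R) -> R) :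
    proj n (\sum_(p <- l) c p *: p.2.2) = \sum_(p <- l) c p *: proj n p.2.2.
  apply: coord_inj => k; rewrite coord_proj !coord_sum; case: ifP => kn.
    by apply: eq_bigr => p _; rewrite !coordZ coord_proj kn.
  by rewrite big1// => p _; rewrite coordZ coord_proj kn mulr0.
exists (fun i => map pr (Phin i)); split.
- by move=> i _ /mapP[p pP ->]; exact: (hPhi i p pP).
- apply: (@squeeze_cvge _ _ _ _ (fun=> 0%E) _
    (fun i => \int[leb]_(s in `[0%R, t]) HS_norm2 e (fun x => (heat (t - s) x - elem_op (Phin i) s x)%R))%E) => //; last exact: cvg_cst.
  near=> i; apply/andP; split.
    apply: integral_ge0 => s _; apply: nneseries_ge0 => k _ _; by rewrite lee_fin sqr_ge0.
  apply: ge0_le_integral_nomeas => s _.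
    by apply: nneseries_ge0 => k _ _; rewrite lee_fin sqr_ge0.
  apply: lee_nneseries => k _; first by rewrite lee_fin sqr_ge0.
  rewrite lee_fin; apply: lerXn2r; rewrite ?nnegrE//.
  by rewrite /elem_op big_map -(proj_sum _ (fun p => \1_(`]p.1.1, p.1.2]) s * L2dot p.2.1 (e k))) -projB norm_proj.
- apply: (@squeeze_cvge _ _ _ _ (fun=> 0%E) _
    (fun i => \int[P]_w (`|g w - elem_integral W (Phin i) w| ^+ 2)%:E)%E) => //; last exact: cvg_cst.
  near=> i; apply/andP; split.
    by apply: integral_ge0 => w _; rewrite lee_fin sqr_ge0.
  apply: ge0_le_integral_nomeas => w _; first by rewrite lee_fin sqr_ge0.
  rewrite lee_fin; apply: lerXn2r; rewrite ?nnegrE//.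
  by rewrite /elem_integral big_map -(proj_sum _ (fun p => increment W p.1.1 p.1.2 p.2.1 w)) -projB norm_proj.
Unshelve. all: by end_near. Qed.

End truncated_convolution.
End gaussian_moments.

(** * Jensen inequalities for powers of two *)

Section convexity.
Context {R : realType}.

(** Exponents are powers of two so that the inequality for squares can be iterated. *)
Lemma sum_pow2_le n k (a : nat -> R) :
  (\sum_(i < n) a i) ^+ (2 ^ k.+1) <= n%:R ^+ (2 ^ k.+1).-1 * \sum_(i < n) a i ^+ (2 ^ k.+1).
Proof.
have sq (b : nat -> R) : (\sum_(i < n) b i) ^+ 2 <= n%:R * \sum_(i < n) b i ^+ 2.
  have := sum_sqr_le (index_iota 0 n) b; by rewrite !big_mkord size_iota subn0.
elim: k a => [|k IH] a; first by rewrite !expn1 expr1; exact: sq.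
rewrite expnS exprM.
have s0 : 0 <= \sum_(i < n) a i ^+ 2 by apply: sumr_ge0 => i _; exact: sqr_ge0.
apply: (@le_trans _ _ ((n%:R * \sum_(i < n) a i ^+ 2) ^+ (2 ^ k.+1))).
  by apply: lerXn2r; rewrite ?nnegrE ?sqr_ge0 ?mulr_ge0//; exact: sq.
rewrite exprMn; apply: (@le_trans _ _ (n%:R ^+ (2 ^ k.+1) *
    (n%:R ^+ (2 ^ k.+1).-1 * \sum_(i < n) (a i ^+ 2) ^+ (2 ^ k.+1)))).
  by rewrite ler_wpM2l ?exprn_ge0//; exact: (IH (fun i => a i ^+ 2)).
rewrite mulrA -exprD (_ : 2 ^ k.+1 + (2 ^ k.+1).-1 = (2 * 2 ^ k.+1).-1)%N; last first.
  by have := expn_gt0 2 k.+1; lia.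
by under eq_bigr do rewrite -exprM.
Qed.

Lemma pow2_sum3_le k (a b c : R) :
  (a + b + c) ^+ (2 ^ k.+1) <= 3 ^+ (2 ^ k.+1) * (a ^+ (2 ^ k.+1) + b ^+ (2 ^ k.+1) + c ^+ (2 ^ k.+1)).
Proof.
have := @sum_pow2_le 3 k (fun i => nth 0 [:: a; b; c] i).
rewrite !big_ord_recr !big_ord0/= !add0r => /le_trans; apply.
have e (y : R) : 0 <= y ^+ (2 ^ k.+1) by rewrite expnS exprM exprn_ge0// sqr_ge0.
apply: ler_wpM2r; first by rewrite !addr_ge0.
by apply: ler_weXn2l; [rewrite ler1n|exact: leq_pred].
Qed.

Lemma Rintegral_pow2_le k (g : R -> R) (M : R) : measurable_fun setT g -> (forall x, `|g x| <= M) ->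
  (\int[leb01 R]_x g x) ^+ (2 ^ k) <= \int[leb01 R]_x (g x ^+ (2 ^ k)).
Proof.
elim: k g M => [|k IH] g M mg gM.
  by under [leRHS]eq_Rintegral do rewrite expn0 expr1; rewrite expn0 expr1.
rewrite expnS exprM; have m2 : measurable_fun setT (fun x => g x ^+ 2) by exact: measurable_funX.
have g2 x : `|g x ^+ 2| <= M ^+ 2.
  by rewrite normrX lerXn2r ?nnegrE// (le_trans _ (gM x)).
have l1 : (leb01 R setT < +oo)%E by exact: leb01_lty.
have i2 : 0 <= \int[leb01 R]_x (g x ^+ 2) by apply: Rintegral_ge0 => x _; exact: sqr_ge0.
apply: (@le_trans _ _ ((\int[leb01 R]_x (g x ^+ 2)) ^+ (2 ^ k))).
  apply: lerXn2r; rewrite ?nnegrE ?sqr_ge0//.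
  have := @Rintegral_sqr_le _ _ _ (leb01 R) setT measurableT l1 g M mg (fun x _ => gM x).
  by rewrite leb01_setT mul1r.
apply: le_trans (IH _ _ m2 g2) _.
by under eq_Rintegral do rewrite -exprM.
Qed.

End convexity.

(** * Pointwise values of elements of the Galerkin space *)

Section trigonometric_representative.
Context {R : realType}.
Implicit Types (v : H R) (n : nat).

(** The continuous version of an element of the range of [proj n]. By [trig_dot] its value at x is a
    scalar product with a fixed vector, so Gaussian bounds apply at every point. *)
Definition trig n v (x : R) : R := \sum_(k < n) coord v k * sine k.+1 x.

Lemma trigE n v : v = proj n v -> (v : R -> R) = trig n v %[ae leb01 R].
Proof. by move=> vP; have := synthE n (coord v); rewrite -/(proj n v) -vP. Qed.

Lemma trig_dot n v x : trig n v x = L2dot (synth n (fun k => sine k.+1 x)) v.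
Proof. by rewrite dot_synth; apply: eq_bigr => k _; rewrite mulrC. Qed.

Lemma measurable_trig n v : measurable_fun setT (trig n v).
Proof.
apply: measurable_sum => k; apply: measurable_funM => //; exact: measurable_sine.
Qed.

Lemma trig_le n v x : `|trig n v x| <= \sum_(k < n) `|coord v k| * Num.sqrt 2.
Proof.
apply: le_trans (ler_norm_sum _ _ _) _; apply: ler_sum => k _.
by rewrite normrM ler_wpM2l//; exact: sine_le.
Qed.

Lemma trig_powerE n v m : (\int[leb01 R]_x (trig n v x ^+ m)%:E)%E = (\int[leb01 R]_x (trig n v x ^+ m))%:E.
Proof.
rewrite /Rintegral fineK//; apply: integrable_fin_num => //.
apply: (bounded_integrable_leb01 (M := (\sum_(k < n) `|coord v k| * Num.sqrt 2) ^+ m)).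
  by apply: measurable_funX; exact: measurable_trig.
by move=> x; rewrite normrX lerXn2r ?nnegrE ?trig_le// (le_trans _ (trig_le n v x)).
Qed.

Lemma norm_trig n v : v = proj n v -> `|v| ^+ 2 = \int[leb01 R]_x (trig n v x ^+ 2).
Proof.
move=> vP; apply: EFin_inj; rewrite -trig_powerE.
exact: (@L2norm2_ae _ _ _ (leb01 R) v (trig n v) (measurable_trig n v) (trigE vP)).
Qed.

Lemma norm_pow2_le n v k : v = proj n v ->
  (((`|v| ^+ 2) ^+ (2 ^ k))%:E <= \int[leb01 R]_x (trig n v x ^+ (2 ^ k).*2)%:E)%E.
Proof.
move=> vP; rewrite trig_powerE lee_fin (norm_trig vP).
have mt : measurable_fun setT (fun x => trig n v x ^+ 2) by apply: measurable_funX; exact: measurable_trig.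
have bt x : `|trig n v x ^+ 2| <= (\sum_(k < n) `|coord v k| * Num.sqrt 2) ^+ 2.
  by rewrite normrX lerXn2r ?nnegrE ?trig_le// (le_trans _ (trig_le n v x)).
apply: le_trans (Rintegral_pow2_le k mt bt) _.
by under eq_Rintegral do rewrite -exprM mul2n.
Qed.

Lemma trig_pow4_le n v k :
  (((\int[leb01 R]_x (trig n v x ^+ 4)) ^+ (2 ^ k))%:E <=
   \int[leb01 R]_x (trig n v x ^+ (2 ^ k.+1).*2)%:E)%E.
Proof.
rewrite trig_powerE lee_fin.
have mt : measurable_fun setT (fun x => trig n v x ^+ 4) by apply: measurable_funX; exact: measurable_trig.
have bt x : `|trig n v x ^+ 4| <= (\sum_(k < n) `|coord v k| * Num.sqrt 2) ^+ 4.
  by rewrite normrX lerXn2r ?nnegrE ?trig_le// (le_trans _ (trig_le n v x)).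
apply: le_trans (Rintegral_pow2_le k mt bt) _.
have e : (4 * 2 ^ k = (2 ^ k.+1).*2)%N by rewrite expnS -mul2n mulnA.
by under eq_Rintegral do rewrite -exprM e.
Qed.

Lemma dissipative_trig (F : H R -> H R) (rho : R) n (z o : H R) : cubic F -> 1 / 6 < rho ->
  Hr rho z -> o = proj n o ->
  L2dot (z - o) (F z) <= 3 + 3 * \int[leb01 R]_x (trig n o x ^+ 4).
Proof.
move=> hF hrho zr oP; rewrite -lee_fin; apply: le_trans (cubic_dissipative hF hrho o zr) _.
have mt : measurable_fun setT (fun x => trig n o x ^+ 4) by apply: measurable_funX; exact: measurable_trig.
have aef := ae_filter_ringOfSetsType (leb01 R).
rewrite (@ae_eq_integral _ _ _ (leb01 R) setT (fun x => (3 * (1 + trig n o x ^+ 4))%:E))//; last 3 first.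
- by apply/measurable_EFinP; apply: measurable_funM => //; apply: measurable_funD => //; exact: measurable_power.
- by apply/measurable_EFinP; apply: measurable_funM => //; apply: measurable_funD.
- have := trigE oP; apply: filterS => x h _; by rewrite -(h Logic.I).
have -> : (fun x => (3 * (1 + trig n o x ^+ 4))%:E) =
    (fun x => (3 : R)%:E * ((1 : R)%:E + (trig n o x ^+ 4)%:E))%E.
  by apply/funext => x; rewrite -EFinD -EFinM.
have t0 x : 0 <= trig n o x ^+ 4 by rewrite exprn_even_ge0.
rewrite ge0_integralZl//; last 2 first.
- by apply: emeasurable_funD => //; exact/measurable_EFinP.
- by move=> x _; rewrite -EFinD lee_fin addr_ge0.
rewrite ge0_integralD//; last 2 first.
- by move=> x _; rewrite lee_fin.
- exact/measurable_EFinP.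
rewrite integral_cst// [X in (_ * (_ * X + _))%E]leb01_setT mule1 trig_powerE -EFinD -EFinM lee_fin.
by rewrite mulrDr mulr1.
Qed.

(** Squared sines are at most 2 and lam k >= (k + 1)(k + 2), so the sum is dominated by a
    telescoping one. This is where the moments of point values become uniform in n and x. *)
Lemma sum_inv_lam_le n x : \sum_(k < n) coord (synth n (fun k => sine k.+1 x)) k ^+ 2 / lam k <= 2 :> R.
Proof.
have t k : sine k.+1 x ^+ 2 / lam k <= 2 * (k.+1%:R^-1 - k.+2%:R^-1).
  have s2 : sine k.+1 x ^+ 2 <= 2 :> R.
    have := sine_le k.+1 x; rewrite -[X in _ -> _ <= X]sqr_sqrtr// => h.
    by rewrite -(real_normK (num_real _)); apply: lerXn2r; rewrite ?nnegrE ?sqrtr_ge0.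
  have l0 : (0 : R) < lam k := lam_gt0 k.
  have k0 : 0 < k.+1%:R * k.+2%:R :> R by rewrite mulr_gt0.
  have lk : k.+1%:R * k.+2%:R <= lam k :> R.
    rewrite /lam exprMn expr2 -mulrA ler_wpM2l//.
    have p2 := @pi_ge2 R; have : 4 <= pi ^+ 2 :> R by nra.
    have -> : k.+2%:R = k.+1%:R + 1 :> R by rewrite natr1.
    have : 1 <= k.+1%:R :> R by rewrite ler1n.
    nra.
  rewrite (_ : _ - _ = (k.+1%:R * k.+2%:R)^-1); last first.
    have -> : k.+2%:R = k.+1%:R + 1 :> R by rewrite natr1.
    have kp : 0 < k.+1%:R :> R by [].
    move: kp; move: (k.+1%:R : R) => c kp.
    have c0 : c != 0 by rewrite gt_eqF.
    have c1 : c + 1 != 0 by rewrite gt_eqF// addr_gt0.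
    by field; rewrite c0 c1.
  apply: ler_pM => //; rewrite ?sqr_ge0 ?invr_ge0 ?(ltW l0)//.
  by rewrite lef_pV2 ?posrE.
apply: (@le_trans _ _ (\sum_(k < n) 2 * (k.+1%:R^-1 - k.+2%:R^-1 : R))).
  by apply: ler_sum => k _; rewrite coord_synth ltn_ord; exact: t.
rewrite -mulr_sumr -(big_mkord xpredT (fun k => k.+1%:R^-1 - k.+2%:R^-1 : R)).
have -> : \sum_(0 <= k < n) (k.+1%:R^-1 - k.+2%:R^-1 : R) = 1 - n.+1%:R^-1.
  elim: n => [|n IH]; first by rewrite big_nil invr1 subrr.
  by rewrite big_nat_recr//= IH addrA subrK.
by rewrite ler_piMr// gerBl invr_ge0.
Qed.

End trigonometric_representative.

(** * Tonelli for a probability space times the unit interval *)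

Section unit_interval_probability.
Context {R : realType}.

(** The set function of [leb01] under its own name, so that a probability structure can be attached;
    Tonelli takes its finiteness from there. *)
Definition unit_lebesgue : set (measurableTypeR R) -> \bar R :=
  mrestr (@lebesgue_measure R) (measurable_itv `]0%R, 1%R[).

HB.instance Definition _ := Measure.on unit_lebesgue.

HB.instance Definition _ :=
  Measure_isProbability.Build _ _ R unit_lebesgue (@leb01_setT R).

Context d (Omega : measurableType d) (P : probability Omega R).

Lemma measurable_integral_leb01 (f : Omega * measurableTypeR R -> \bar R) :
  measurable_fun setT f -> (forall z, 0 <= f z)%E ->
  measurable_fun setT (fun w => \int[leb01 R]_x f (w, x))%E.
Proof. by move=> mf f0; exact: (measurable_fun_fubini_tonelli_F (m2 := unit_lebesgue) f). Qed.

Lemma fubini_leb01 (f : Omega * measurableTypeR R -> \bar R) :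
  measurable_fun setT f -> (forall z, 0 <= f z)%E ->
  (\int[P]_w \int[leb01 R]_x f (w, x) = \int[leb01 R]_x \int[P]_w f (w, x))%E.
Proof. by move=> mf f0; exact: (@fubini_tonelli _ _ _ _ _ P unit_lebesgue f). Qed.

End unit_interval_probability.

(** * From almost sure convergence to convergence in L^p *)

Section vitali.
Context d (Omega : measurableType d) (R : realType) (P : probability Omega R).

(** For K >= 1 and p + 1 <= m, Z^p is at most min(Z, K)^p + Z^m / K. The first term is treated by
    dominated convergence, the second by the moment bound. *)
Lemma Lp_cvg0 (Z : nat -> Omega -> R) (p B : R) m :
  (forall n, measurable_fun setT (Z n)) -> (forall n w, 0 <= Z n w) ->
  (\forall w \ae P, Z n w @[n --> \oo] --> (0 : R)) ->
  0 < p -> p + 1 <= m%:R -> 0 <= B ->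
  (\forall n \near \oo, (\int[P]_w (Z n w ^+ m)%:E <= B%:E)%E) ->
  (\int[P]_w (Z n w `^ p)%:E)%E @[n --> \oo] --> 0%E.
Proof.
move=> mZ Z0 cZ p0 pm B0 hB; have aeP := ae_filter_ringOfSetsType P.
have split_ (K : R) n w : 1 <= K ->
    Z n w `^ p <= Num.min (Z n w) K `^ p + K^-1 * Z n w ^+ m.
  move=> K1; have K0 : 0 < K by exact: lt_le_trans K1.
  have y0 := Z0 n w; have [yK|Ky] := lerP (Z n w) K.
    by rewrite lerDl mulr_ge0 ?exprn_ge0// invr_ge0 ltW.
  have y1 : 1 <= Z n w by exact: le_trans K1 (ltW Ky).
  apply: (@le_trans _ _ (K^-1 * Z n w ^+ m)); last by rewrite lerDr powR_ge0.
  rewrite ler_pdivlMl// -powR_mulrn//.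
  apply: (@le_trans _ _ (Z n w `^ 1 * Z n w `^ p)).
    by rewrite powRr1// ler_wpM2r ?powR_ge0// ltW.
  rewrite -powRD; last by rewrite (gt_eqF (lt_le_trans ltr01 y1)) implybT.
  by apply: ler_powR => //; rewrite addrC.
have P1 : (P setT < +oo)%E by rewrite [X in (X < _)%E]probability_setT ltry.
have mm (K : R) n : measurable_fun setT (fun w => Num.min (Z n w) K `^ p).
  by apply: (measurableT_comp (measurable_powR p)); apply: measurable_minr.
have bK (K : R) n w : 1 <= K -> `|Num.min (Z n w) K `^ p| <= K `^ p.
  move=> K1; have K0 : 0 <= K by exact: le_trans K1.
  rewrite ger0_norm ?powR_ge0//; apply: ge0_ler_powR; rewrite ?nnegrE ?(ltW p0)//.
    by rewrite le_min Z0.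
  by rewrite ge_min lexx orbT.
have im (K : R) n : 1 <= K -> P.-integrable setT (EFin \o (fun w => Num.min (Z n w) K `^ p)).
  move=> K1; apply: (@bounded_integrable _ _ _ P setT measurableT P1 _ (K `^ p)) => // w _.
  exact: bK.
have trunc_cvg (K : R) : 1 <= K ->
    \int[P]_w (Num.min (Z n w) K `^ p) @[n --> \oo] --> (0 : R).
  move=> K1; have K0 : 0 <= K by exact: le_trans K1.
  have -> : (0 : R) = \int[P]_w (cst 0 w) by rewrite Rintegral_cst// mul0r.
  apply: (Rdominated_cvg (h := cst (K `^ p)) measurableT (mm K)) => //.
  - apply: filterS cZ => w cz _; apply/cvgrPdist_le => eps e0.
    have ep : 0 < eps `^ p^-1 by exact: powR_gt0.
    have /cvgr0_norm_le/(_ _ ep) := cz; apply: filterS => n.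
    rewrite [cst 0 w]/= sub0r normrN (ger0_norm (Z0 n w)) (ger0_norm (powR_ge0 _ _)).
    move=> zn; apply: (@le_trans _ _ ((eps `^ p^-1) `^ p)).
      apply: ge0_ler_powR; rewrite ?nnegrE ?(ltW p0) ?(ltW ep) ?le_min ?Z0//.
      by rewrite ge_min zn.
    by rewrite -powRrM mulVf ?gt_eqF// powRr1// ltW.
  - apply: (@bounded_integrable _ _ _ P setT measurableT P1 _ `|K `^ p|) => //.
  - by move=> n w _; exact: bK.
have bound (K : R) n : 1 <= K -> (\int[P]_w (Z n w ^+ m)%:E <= B%:E)%E ->
    (\int[P]_w (Z n w `^ p)%:E <= (\int[P]_w (Num.min (Z n w) K `^ p) + K^-1 * B)%:E)%E.
  move=> K1 hn; have K0 : 0 <= K^-1 by rewrite invr_ge0 (le_trans _ K1).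
  apply: (@le_trans _ _ (\int[P]_w ((Num.min (Z n w) K `^ p)%:E + K^-1%:E * (Z n w ^+ m)%:E))%E).
    apply: ge0_le_integral_nomeas => w _; first by rewrite lee_fin powR_ge0.
    by rewrite -EFinM -EFinD lee_fin; exact: split_.
  have mZm : measurable_fun setT (fun w => (Z n w ^+ m)%:E).
    by apply/measurable_EFinP; exact: measurable_funX.
  rewrite ge0_integralD//; last 4 first.
  - by move=> w _; rewrite lee_fin powR_ge0.
  - by apply/measurable_EFinP; exact: mm.
  - by move=> w _; rewrite mule_ge0// lee_fin exprn_ge0.
  - by apply: emeasurable_funM => //; exact: measurable_cst.
  rewrite ge0_integralZl//; last by move=> w _; rewrite lee_fin exprn_ge0.
  rewrite EFinD EFinM; apply: leeD; last by apply: lee_wpmul2l => //; rewrite lee_fin.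
  by rewrite /Rintegral fineK//; apply: integrable_fin_num => //; exact: im.
have [N _ hN] := hB.
apply/fine_cvgP; split.
  exists N => // n nN; rewrite ge0_fin_numE; last by apply: integral_ge0 => w _; rewrite lee_fin powR_ge0.
  exact: le_lt_trans (bound 1 n (lexx _) (hN n nN)) (ltry _).
apply/cvgrPdist_le => eps e0.
(* Chosen so that B / K is at most eps / 2. *)
pose K := 1 + 2 * B / eps.
have K1 : 1 <= K by rewrite lerDl divr_ge0 ?mulr_ge0// ltW.
have Kp : 0 < K by exact: lt_le_trans K1.
have KB : K^-1 * B <= eps / 2.
  rewrite ler_pdivrMl// /K mulrDl mul1r.
  rewrite [leRHS](_ : _ = eps / 2 + B) ?lerDr ?divr_ge0 ?(ltW e0)//.
  by field; rewrite gt_eqF.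
have e2 : 0 < eps / 2 by rewrite divr_gt0.
have /cvgr0_norm_le/(_ _ e2) [N' _ hN'] := trunc_cvg K K1.
exists (N + N')%N => // n /= nN.
have n1 : (N <= n)%N by apply: leq_trans nN; exact: leq_addr.
have n2 : (N' <= n)%N by apply: leq_trans nN; exact: leq_addl.
have i0 : (0 <= \int[P]_w (Z n w `^ p)%:E)%E by apply: integral_ge0 => w _; rewrite lee_fin powR_ge0.
rewrite sub0r normrN ger0_norm ?fine_ge0//.
have bn := bound K n K1 (hN n n1).
rewrite -lee_fin fineK; last by rewrite ge0_fin_numE//; exact: le_lt_trans bn (ltry _).
apply: le_trans bn _; rewrite lee_fin [leRHS](_ : eps = eps / 2 + eps / 2); last by field.
by apply: lerD => //; apply: le_trans (ler_norm _) (hN' n n2).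
Qed.

End vitali.

Lemma double_le_sqr (R : realFieldType) (C : R) : 0 <= C -> C * 2 <= (1 + 2 * C) ^+ 2.
Proof. by move=> C0; nra. Qed.

(** * Uniform moments and strong convergence *)

Section convergence.
Context d (Omega : measurableType d) (R : realType) (P : probability Omega R).
Variables (T rho chi : R) (xi : H R) (F : H R -> H R) (e : nat -> H R) (h : nat -> R).
Variables (W : R -> H R -> Omega -> R) (XX OO : nat -> R -> Omega -> H R) (X : R -> Omega -> H R).
Hypotheses (T0 : 0 < T) (rho6 : 1 / 6 < rho) (rho4 : rho < 1 / 4).
Hypotheses (chi0 : 0 < chi) (chi_le : chi <= rho / 3 - 1 / 18) (xir : Hr rho xi).
Hypotheses (hF : cubic F) (he : forall k, e k.+1 = basis k).
Hypotheses (hh : forall n, (0 < n)%N -> 0 < h n) (hh0 : h n @[n --> \oo] --> (0 : R)).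
Hypothesis hW : cylindrical_wiener P T W.
Hypothesis bXX : forall n t, (0 < n)%N -> t \in `[0, T] -> borel_measurable (XX n t).
Hypothesis pXX : forall n t w, (0 < n)%N -> t \in `[0, T] -> XX n t w = proj n (XX n t w).
Hypothesis bOO : forall n t, (0 < n)%N -> t \in `[0, T] -> borel_measurable (OO n t).
Hypothesis pOO : forall n t w, (0 < n)%N -> t \in `[0, T] -> OO n t w = proj n (OO n t w).
Hypothesis bX : forall t, t \in `[0, T] -> borel_measurable (X t).
Hypothesis hXc : forall w, Hr_continuous_on `[0, T] rho (fun t => X t w).
Hypothesis hXeq : forall t, t \in `[0, T] -> exists2 g,
  stoch_integral P W e t (fun s => heat (t - s)) g &
  \forall w \ae P, g w = path_noise xi F (fun s => X s w) t.
Hypothesis hOOeq : forall n t, (0 < n)%N -> t \in `[0, T] ->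
  rv_class P (OO n t) = stoch_integral P W e t (fun s v => proj n (heat (t - s) v)).
Hypothesis hXXeq : forall n t, (0 < n)%N -> t \in `[0, T] -> \forall w \ae P,
  XX n t w = scheme rho chi xi F n (h n) (fun s => XX n s w) (fun s => OO n s w) t.

Let aeP := ae_filter_ringOfSetsType P.

(** The projected noise of [X] and [OO n t] belong to the same class of stochastic integrals; the
    exceptional null set depends on n and t. *)
Lemma OO_noise n t : (0 < n)%N -> t \in `[0, T] ->
  \forall w \ae P, OO n t w = proj n (path_noise xi F (fun s => X s w) t).
Proof.
move=> n0 tI; have [g gs gE] := hXeq tI.
have tT : 0 <= t <= T by move: tI; rewrite in_itv.
have := stoch_integral_proj n gs.
rewrite -(hOOeq n0 tI) => -[_]; move: gE; apply: filterS2 => w gE.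
by rewrite gE => ->.
Qed.

(** The null sets for all n, at [tau n] and at all grid points, form a countable family; outside
    their union [pathwise_cvg] applies. *)
Lemma pathwise_ae_cvg (tau : nat -> R) : (forall n, tau n \in `[0, T]) ->
  \forall w \ae P, `|X (tau n) w - XX n (tau n) w| @[n --> \oo] --> (0 : R).
Proof.
move=> tauI.
pose E n t w := XX n t w = scheme rho chi xi F n (h n) (fun s => XX n s w) (fun s => OO n s w) t /\
  OO n t w = proj n (path_noise xi F (fun s => X s w) t).
have aeE n t : (0 < n)%N -> t \in `[0, T] -> \forall w \ae P, E n t w.
  move=> n0 tI; have := OO_noise n0 tI; have := hXXeq n0 tI.
  by apply: filterS2 => w h1 h2; split.
have a1 : \forall w \ae P, forall n, (0 < n)%N -> E n (tau n) w.
  apply: ae_foralln => n; case: (posnP n) => [->|n0]; first exact: filterE.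
  by have := aeE n (tau n) n0 (tauI n); apply: filterS.
have a2 : \forall w \ae P, forall n j, (0 < n)%N -> j%:R * h n <= T -> E n (j%:R * h n) w.
  apply: ae_foralln => n; apply: ae_foralln => j.
  case: (posnP n) => [->|n0]; first exact: filterE.
  have [jT|jT] := boolP (j%:R * h n <= T); last first.
    exact: filterE.
  have jI : j%:R * h n \in `[0, T] by rewrite in_itv/= jT mulr_ge0// ltW// hh.
  by have := aeE n _ n0 jI; apply: filterS.
move: a1 a2; apply: filterS2 => w w1 w2.
apply: (@pathwise_cvg _ T rho chi xi F T0 rho6 _ chi0 hF (fun s => X s w) (hXc w) h
  (fun n s => XX n s w) (fun n s => OO n s w) tau) => //.
- by move: rho4; lra.
- by move=> n t n0 [->|[j -> jT]]; [exact: w1|exact: w2].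
Qed.

(** The bound of [stoch_moment] for point evaluations: 1 comes from that lemma, 2 from
    [sum_inv_lam_le]. *)
Let G m : R := (m.*2)`!%:R * (2 * expR ((1 + 2) / 2)).

Let J n t m w := (\int[leb01 R]_x (trig n (OO n t w) x ^+ m.*2)%:E)%E.

Let G0 m : 0 <= G m. Proof. by rewrite !mulr_ge0// expR_ge0. Qed.

Let J0 n t m w : (0 <= J n t m w)%E.
Proof. by apply: integral_ge0 => x _; rewrite lee_fin -mul2n exprM exprn_ge0// sqr_ge0. Qed.

Let measurable_trig_OO n t m : (0 < n)%N -> t \in `[0, T] ->
  measurable_fun setT (fun z : Omega * measurableTypeR R => (trig n (OO n t z.1) z.2 ^+ m.*2)%:E).
Proof.
move=> n0 tI; apply/measurable_EFinP; apply: measurable_funX.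
apply: measurable_sum => k; apply: measurable_funM.
  apply: (measurableT_comp (f := fun w => coord (OO n t w) k)) => //.
  by apply: borel_measurable_dot; exact: bOO.
by apply: (measurableT_comp (f := sine k.+1)) => //; exact: measurable_sine.
Qed.

Lemma measurable_J n t m : (0 < n)%N -> t \in `[0, T] -> measurable_fun setT (J n t m).
Proof.
move=> n0 tI; apply: (measurable_integral_leb01 (measurable_trig_OO m n0 tI)) => z.
by rewrite lee_fin -mul2n exprM exprn_ge0// sqr_ge0.
Qed.

(** Tonelli moves the expectation inside; at each x the value of [OO n t] is tested against a fixed
    vector, and [stoch_moment] applies. *)
Lemma moment_J n t m : (0 < n)%N -> (0 < m)%N -> t \in `[0, T] -> (\int[P]_w J n t m w <= (G m)%:E)%E.
Proof.
move=> n0 m0 tI; have tT : 0 <= t <= T by move: tI; rewrite in_itv.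
rewrite (fubini_leb01 P (measurable_trig_OO m n0 tI)); last first.
  by move=> z; rewrite lee_fin -mul2n exprM exprn_ge0// sqr_ge0.
apply: (@le_trans _ _ (\int[leb01 R]_x (G m)%:E)%E); last first.
  by rewrite integral_cst// [X in (_ * X)%E]leb01_setT mule1.
have OOs : stoch_integral P W e t (fun s v => proj n (heat (t - s) v)) (OO n t).
  by rewrite -(hOOeq n0 tI); split; [exact: bOO|exact: filterE].
apply: ge0_le_integral_nomeas => x _.
  by apply: integral_ge0 => w _; rewrite lee_fin -mul2n exprM exprn_ge0// sqr_ge0.
under eq_integral do rewrite trig_dot.
rewrite /=.
apply: (le_trans (stoch_moment hW he tT (synth n (fun k => sine k.+1 x)) m0 OOs)).
rewrite lee_fin ler_wpM2l// ler_wpM2l// ler_expR ler_wpM2r// lerD2l.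
exact: sum_inv_lam_le.
Qed.

Let N n := (Num.truncn (T / h n)).+1.

(** The guard makes the later bounds hold for every index, the moments of [OO] being controlled at
    times in [0,T]. *)
Let I n i w : R := if i%:R * h n <= T then \int[leb01 R]_x (trig n (OO n (i%:R * h n) w) x ^+ 4) else 0.

Let I0 n i w : 0 <= I n i w.
Proof.
rewrite /I; case: ifP => // _; apply: Rintegral_ge0 => x _.
by rewrite (exprM _ 2 2) sqr_ge0.
Qed.

Let rho1 : 0 <= rho <= 1.
Proof. by move: rho6 rho4; lra. Qed.

Let hN_le n : (0 < n)%N -> h n <= 1 -> h n * (N n)%:R <= T + 1.
Proof.
move=> n0 h1; have hn := hh n0.
have h0 : 0 <= T / h n by rewrite divr_ge0// ltW.
have := truncn_le (T / h n); rewrite h0 => hT.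
rewrite /N -natr1 mulrDr mulr1; apply: lerD => //.
by rewrite mulrC -ler_pdivlMr.
Qed.

(** With eta = h^(-chi), the bounds 4 chi <= rho and 6 chi <= 1 are what [energy_bound] asks of the
    threshold. The scheme enters only at t and at the grid points, hence almost surely. *)
Lemma energy_ae : exists2 C, 0 <= C & forall n t, (0 < n)%N -> h n <= 1 -> t \in `[0, T] ->
  \forall w \ae P, `|XX n t w - OO n t w| ^+ 2 <=
    `|xi| ^+ 2 + \sum_(i < N n) h n * (C + 6 * I n i w).
Proof.
have [C C0 hC] := cubic_growth hF rho6.
(* For eta >= 1 the growth bound gives |F v|^2 <= 2 C eta^6, and 2 C <= (1 + 2 C)^2. *)
pose Cg := 1 + 2 * C; have Cg0 : 0 <= Cg by rewrite addr_ge0// mulr_ge0.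
(* The last 6 and the factor 6 of [I] are twice the constants in the dissipativity bound 3 + 3 I. *)
exists (4 * (2 + Hr_norm rho xi) * Cg + Cg ^+ 2 + 6).
  apply: addr_ge0 => //; apply: addr_ge0; last exact: sqr_ge0.
  by apply: mulr_ge0 => //; apply: mulr_ge0 => //; apply: addr_ge0 => //; exact: Hr_norm_ge0.
move=> n t n0 h1 tI; have hn := hh n0.
have gI j : j%:R * h n <= T -> j%:R * h n \in `[0, T].
  by move=> jT; rewrite in_itv/= jT mulr_ge0// ltW.
have a2 : \forall w \ae P, forall j, j%:R * h n <= T -> XX n (j%:R * h n) w =
    scheme rho chi xi F n (h n) (fun s => XX n s w) (fun s => OO n s w) (j%:R * h n).
  apply: ae_foralln => j; have [jT|jT] := boolP (j%:R * h n <= T); last exact: filterE.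
  by have := hXXeq n0 (gI j jT); apply: filterS.
move: a2 (hXXeq n0 tI); apply: filterS2 => w wj wt.
pose eta := `|h n| `^ (- chi).
have etaE : eta = h n `^ (- chi) by rewrite /eta gtr0_norm.
have eta1 : 1 <= eta.
  rewrite etaE -[X in X <= _](powRr0 (h n)) ger_powR//; first by rewrite hn.
  by rewrite oppr_le0 ltW.
have pw k r : 0 <= r -> k%:R * chi <= r -> h n `^ r * eta ^+ k <= 1.
  move=> r0 kr; rewrite etaE -powR_mulrn ?powR_ge0// -powRrM -powRD; last by rewrite (gt_eqF hn) implybT.
  rewrite -[X in _ <= X](powRr0 (h n)) ger_powR//; first by rewrite hn.
  by rewrite mulNr subr_ge0 mulrC.
have := @energy_bound _ rho chi xi F rho1 xir eta Cg (h n) t T (fun i => 3 + 3 * I n i w) n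
  (fun s => XX n s w) (fun s => OO n s w).
move=> /(_ _ tI erefl eta1 _ _ Cg0).
have hX1 : 0 < h n <= 1 by rewrite hn.
move/(_ hX1); have e4 : h n `^ rho * eta ^+ 4 <= 1.
  by apply: pw; move: chi0 chi_le rho6 rho4; lra.
have e6 : h n * eta ^+ 6 <= 1.
  by rewrite -{1}(powRr1 (ltW hn)); apply: pw => //; move: chi0 chi_le rho6 rho4; lra.
move/(_ e4 e6); have q0 j : 0 <= 3 + 3 * I n j w by rewrite addr_ge0// mulr_ge0.
move/(_ q0 (fun s sI => pXX w n0 sI) (fun s sI => pOO w n0 sI) wj wt).
have hg v : Hr rho v -> Hr_norm rho v <= eta -> `|F v| <= Cg * eta ^+ 3.
  move=> vr ve; have N0 : 0 <= Hr_norm rho v := Hr_norm_ge0 _ _.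
  have eta0 : 0 <= eta by exact: le_trans eta1.
  have e30 : 0 <= eta ^+ 3 by exact: exprn_ge0.
  rewrite -ler_sqr ?nnegrE ?mulr_ge0//.
  apply: le_trans (hC v vr) _.
  apply: (@le_trans _ _ (C * (eta ^+ 6 + eta ^+ 6))).
    apply: ler_wpM2l => //; apply: lerD; last by rewrite lerXn2r ?nnegrE.
    apply: (@le_trans _ _ (eta ^+ 2)); first by rewrite lerXn2r ?nnegrE.
    by rewrite ler_weXn2l.
  rewrite exprMn -exprM -mulr2n -mulr_natl mulrA; apply: ler_wpM2r; first exact: exprn_ge0.
  exact: double_le_sqr.
move/(_ hg); have hq j : j%:R * h n <= T ->
    L2dot (XX n (j%:R * h n) w - OO n (j%:R * h n) w) (F (XX n (j%:R * h n) w)) <= 3 + 3 * I n j w.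
  move=> jT; rewrite /I jT; apply: (dissipative_trig hF rho6).
    by rewrite (pXX w n0 (gI j jT)); exact: proj_Hr.
  by apply: pOO => //; exact: gI.
move/(_ hq) => /le_trans; apply; rewrite lerD2l; apply: ler_sum => i _.
apply: ler_wpM2l; first exact: ltW.
by rewrite [leLHS](_ : _ = 4 * (2 + Hr_norm rho xi) * Cg + Cg ^+ 2 + 6 + 6 * I n i w)//; ring.
Qed.

Lemma measurable_norm (V : Omega -> H R) : borel_measurable V -> measurable_fun setT (fun w => `|V w|).
Proof.
move=> bV; apply: measurable_norm_coord => k.
exact: borel_measurable_dot.
Qed.

(** [energy_ae] bounds |XX|^2 by |OO|^2, a constant and an average over the grid of fourth powers of
    [OO]. Raising this to a power of two costs convexity constants only, because h times the number
    of grid points is at most T + 1. *)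
Lemma moment_XX k : exists2 K, 0 <= K & forall n t, (0 < n)%N -> h n <= 1 -> t \in `[0, T] ->
  (\int[P]_w ((`|XX n t w| ^+ 2) ^+ (2 ^ k.+1))%:E <= K%:E)%E.
Proof.
have [C1 C10 hC1] := energy_ae.
set M := (2 ^ k.+1)%N.
have M0 : (0 < M)%N by rewrite expn_gt0.
pose B0 := 2 * `|xi| ^+ 2 + 2 * ((T + 1) * C1).
have T1 : 0 <= T + 1 by rewrite addr_ge0// ltW.
have B00 : 0 <= B0 by apply: addr_ge0; apply: mulr_ge0 => //; exact: mulr_ge0.
pose K1 : R := 3 ^+ M * 2 ^+ M; pose K2 := 3 ^+ M * B0 ^+ M.
pose K3 : R := 3 ^+ M * (12 * (T + 1)) ^+ M.
have K10 : 0 <= K1 by rewrite mulr_ge0.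
have K20 : 0 <= K2 by rewrite mulr_ge0 ?exprn_ge0.
have K30 : 0 <= K3 by rewrite mulr_ge0 ?exprn_ge0 ?mulr_ge0.
exists (K1 * G M + K2 + K3 * G (2 ^ k.+2)).
  apply: addr_ge0; last exact: mulr_ge0 K30 (G0 _).
  exact: addr_ge0 (mulr_ge0 K10 (G0 _)) K20.
move=> n t n0 h1 tI; have hn := hh n0.
pose J' i w : \bar R := if i%:R * h n <= T then J n (i%:R * h n) (2 ^ k.+2) w else 0%E.
have J'0 i w : (0 <= J' i w)%E by rewrite /J'; case: ifP.
(* Times the N summands, h^M N^(M-1) becomes (h N)^M <= (T + 1)^M. *)
pose b := 3 ^+ M * ((12 * h n) ^+ M * (N n)%:R ^+ M.-1).
have b0 : 0 <= b.
  by apply: mulr_ge0 => //; apply: mulr_ge0; apply: exprn_ge0 => //; rewrite mulr_ge0// ltW.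
have gI j : j%:R * h n <= T -> j%:R * h n \in `[0, T].
  by move=> jT; rewrite in_itv/= jT mulr_ge0// ltW.
have IJ i w : ((I n i w ^+ M)%:E <= J' i w)%E.
  rewrite /I /J'; case: ifP => _; last by rewrite expr0n gt_eqF.
  exact: trig_pow4_le.
have mJ' i : measurable_fun setT (J' i).
  rewrite /J'; have [iT|iT] := boolP (i%:R * h n <= T); last exact: measurable_cst.
  by apply: measurable_J => //; exact: gI.
have iJ' i : (\int[P]_w J' i w <= (G (2 ^ k.+2))%:E)%E.
  rewrite /J'; have [iT|iT] := boolP (i%:R * h n <= T); last by rewrite integral0 lee_fin.
  by apply: moment_J => //; [rewrite expn_gt0|exact: gI].
have bound : \forall w \ae P, setT w -> (((`|XX n t w| ^+ 2) ^+ M)%:E <=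
    K1%:E * J n t M w + (K2%:E + b%:E * \sum_(i < N n) J' i w))%E.
  have := hC1 n t n0 h1 tI; apply: filterS => w en _.
  have e1 : `|XX n t w| ^+ 2 <= 2 * `|OO n t w| ^+ 2 + B0 + 12 * h n * \sum_(i < N n) I n i w.
    apply: (@le_trans _ _ (2 * `|OO n t w| ^+ 2 + 2 * `|XX n t w - OO n t w| ^+ 2)).
      have : `|XX n t w| <= `|XX n t w - OO n t w| + `|OO n t w|.
        by rewrite -{1}(subrK (OO n t w) (XX n t w)) ler_normD.
      rewrite addrC => xle.
      exact: le_trans (lerXn2r 2 (normr_ge0 _) (addr_ge0 (normr_ge0 _) (normr_ge0 _)) xle) (sqrD_le _ _).
    rewrite -addrA lerD2l; apply: (@le_trans _ _ (2 * (`|xi| ^+ 2 + \sum_(i < N n) h n * (C1 + 6 * I n i w)))).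
      exact: ler_wpM2l.
    rewrite -mulr_sumr big_split/= sumr_const card_ord -mulr_sumr.
    rewrite mulrDr -addrA lerD2l.
    set S := \sum_(i < N n) _; rewrite [leLHS](_ : _ = 2 * (h n * (N n)%:R * C1) + 12 * h n * S); last first.
      by rewrite -[C1 *+ _]mulr_natr; ring.
    by rewrite lerD2r ler_wpM2l// ler_wpM2r// hN_le.
  have s0 : 0 <= \sum_(i < N n) I n i w by apply: sumr_ge0.
  have e2 : (`|XX n t w| ^+ 2) ^+ M <= K1 * (`|OO n t w| ^+ 2) ^+ M +
      (K2 + b * \sum_(i < N n) I n i w ^+ M).
    apply: (@le_trans _ _ ((2 * `|OO n t w| ^+ 2 + B0 + 12 * h n * \sum_(i < N n) I n i w) ^+ M)).
      apply: lerXn2r; rewrite ?nnegrE ?sqr_ge0//.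
      exact: le_trans (sqr_ge0 _) e1.
    apply: le_trans (pow2_sum3_le _ _ _ _) _.
    rewrite -/M mulrDr mulrDr -addrA exprMn mulrA -/K1 -/K2 lerD2l lerD2l /b -(mulrA (3 ^+ M)).
    apply: ler_wpM2l; first exact: exprn_ge0.
    rewrite exprMn -mulrA; apply: ler_wpM2l; first by apply: exprn_ge0; rewrite mulr_ge0// ltW.
    exact: (sum_pow2_le (N n) k (fun i => I n i w)).
  apply: (@le_trans _ _ (K1 * (`|OO n t w| ^+ 2) ^+ M + (K2 + b * \sum_(i < N n) I n i w ^+ M))%:E).
    by rewrite lee_fin.
  rewrite (EFinD (K1 * _)) (EFinD K2) (EFinM K1) (EFinM b); apply: leeD.
    by apply: lee_wpmul2l; rewrite ?lee_fin//; apply: norm_pow2_le; exact: pOO.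
  apply: leeD => //; apply: lee_wpmul2l; rewrite ?lee_fin// -sumEFin.
  by apply: lee_sum => i _; exact: IJ.
have mX : measurable_fun setT (fun w => ((`|XX n t w| ^+ 2) ^+ M)%:E).
  apply/measurable_EFinP; apply: measurable_funX; apply: measurable_funX.
  by apply: measurable_norm; exact: bXX.
have mJM : measurable_fun setT (fun w => K1%:E * J n t M w)%E.
  by apply: measurable_funeM; exact: measurable_J.
have mS : measurable_fun setT (fun w => b%:E * \sum_(i < N n) J' i w)%E.
  apply: measurable_funeM; exact: emeasurable_sum.
have S0 w : (0 <= \sum_(i < N n) J' i w)%E by apply: sume_ge0.
have S10 w : (0 <= b%:E * \sum_(i < N n) J' i w)%E by rewrite mule_ge0.
have JM0 w : (0 <= K1%:E * J n t M w)%E by rewrite mule_ge0.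
have mKS : measurable_fun setT (fun w => K2%:E + b%:E * \sum_(i < N n) J' i w)%E.
  exact: emeasurable_funD.
apply: (@le_trans _ _ (\int[P]_w (K1%:E * J n t M w + (K2%:E + b%:E * \sum_(i < N n) J' i w)))%E).
  apply: ae_ge0_le_integral => //.
  - by move=> w _; rewrite adde_ge0// adde_ge0.
  - exact: emeasurable_funD.
rewrite ge0_integralD//; last by move=> w _; rewrite adde_ge0.
rewrite -(addrA (K1 * G M)) (EFinD (K1 * _)); apply: leeD.
  rewrite ge0_integralZl//; last exact: measurable_J.
  by rewrite (EFinM K1); apply: lee_wpmul2l => //; exact: moment_J.
rewrite ge0_integralD// (EFinD K2); apply: leeD.
  by rewrite prob_integral_cst.
rewrite ge0_integralZl//; last exact: emeasurable_sum.
rewrite ge0_integral_sum//.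
apply: (@le_trans _ _ (b%:E * \sum_(i < N n) (G (2 ^ k.+2))%:E)%E).
  by apply: lee_wpmul2l => //; apply: lee_sum => i _; exact: iJ'.
rewrite sumEFin sumr_const card_ord -EFinM lee_fin -[_ *+ N n]mulr_natl mulrA.
apply: ler_wpM2r => //; rewrite /b /K3 -mulrA; apply: ler_wpM2l; first exact: exprn_ge0.
rewrite -mulrA -exprSr prednK// -exprMn; apply: lerXn2r; rewrite ?nnegrE.
- by rewrite mulr_ge0// mulr_ge0// ltW.
- by rewrite mulr_ge0.
- by rewrite -mulrA ler_wpM2l// hN_le.
Qed.

Lemma h_le1 : \forall n \near \oo, h n.+1 <= 1.
Proof.
have /cvgr0_norm_le/(_ _ ltr01) [N0 _ hN0] := hh0.
exists N0 => // n /= nN; apply: le_trans (ler_norm _) (hN0 _ _).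
exact: leq_trans nN (leqnSn n).
Qed.

(** Fatou along the almost sure convergence for the constant choice [tau n] = t. *)
Lemma moment_X k : exists2 K, 0 <= K & forall t, t \in `[0, T] ->
  (\int[P]_w ((`|X t w| ^+ 2) ^+ (2 ^ k.+1))%:E <= K%:E)%E.
Proof.
have [K K0 hK] := moment_XX k; exists K => // t tI.
(* The shift skips the index 0, about which nothing is assumed. *)
pose f n w := (`|XX n.+1 t w| ^+ 2) ^+ (2 ^ k.+1).
apply: (@fatou_le _ _ _ P setT f) => //.
- move=> n; apply: measurable_funX; apply: measurable_funX; apply: measurable_norm; exact: bXX.
- by move=> n w _; rewrite /f exprn_ge0// sqr_ge0.
- by apply: measurable_funX; apply: measurable_funX; apply: measurable_norm; exact: bX.
- have := pathwise_ae_cvg (fun=> tI); apply: filterS => w cw _.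
  have c1 : `|XX n.+1 t w| @[n --> \oo] --> `|X t w|.
    apply/cvgrPdist_le => eps e0; have /cvgr0_norm_le/(_ _ e0) [N0 _ hN0] := cw.
    exists N0 => // n /= nN; apply: le_trans (ler_dist_dist _ _) _.
    have := hN0 n.+1 (leq_trans nN (leqnSn n)); by rewrite normr_id.
  apply: (@cvg_comp _ _ _ (fun n => `|XX n.+1 t w|) (fun y => (y ^+ 2) ^+ (2 ^ k.+1)) _ _ _ c1).
  apply: (@cvg_comp _ _ _ (fun y : R => y ^+ 2) (fun y => y ^+ (2 ^ k.+1)) _ (nbhs (`|X t w| ^+ 2))); exact: exprn_continuous.
- by move: h_le1; apply: filterS => n h1; exact: hK.
Qed.

Lemma Lp_cvg (tau : nat -> R) p : 0 < p -> (forall n, tau n \in `[0, T]) ->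
  (\int[P]_w (`|X (tau n) w - XX n (tau n) w| `^ p)%:E)%E @[n --> \oo] --> 0%E.
Proof.
move=> p0 tauI; rewrite -(cvg_shiftS (fun n => \int[P]_w (`|X (tau n) w - XX n (tau n) w| `^ p)%:E)%E).
(* Then the available moment order 2 M = 2^(k+2) is at least p + 1, as [Lp_cvg0] requires. *)
pose k := Num.truncn (p + 1).
have [K1 K10 hK1] := moment_XX k; have [K2 K20 hK2] := moment_X k.
set M := (2 ^ k.+1)%N in hK1 hK2.
have Mn0 : (M == 0)%N = false by rewrite expn_eq0.
pose c : R := 3 ^+ M * 2 ^+ M; have c0 : 0 <= c by rewrite mulr_ge0.
apply: (@Lp_cvg0 _ _ _ P (fun n w => `|X (tau n.+1) w - XX n.+1 (tau n.+1) w|) p (c * K2 + c * K1) (2 * M)%N) => //.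
- move=> n; apply: measurable_norm_coord => j.
  under eq_fun do rewrite coordB.
  by apply: measurable_funB; apply: borel_measurable_dot; [exact: bX|exact: bXX].
- have := pathwise_ae_cvg tauI; apply: filterS => w cw.
  by rewrite (cvg_shiftS (fun n => `|X (tau n) w - XX n (tau n) w|)).
- apply: (@le_trans _ _ (k.+1%:R)); first by apply: ltW; exact: truncnS_gt.
  by rewrite ler_nat (leq_trans (ltnW (ltn_expl k.+1 (ltnSn 1))))// leq_pmull.
- by rewrite addr_ge0// mulr_ge0.
- move: h_le1; apply: filterS => n h1.
  set a := fun w => `|X (tau n.+1) w|; set b := fun w => `|XX n.+1 (tau n.+1) w|.
  have ma : measurable_fun setT (fun w => ((a w ^+ 2) ^+ M)%:E).
    apply/measurable_EFinP; apply: measurable_funX; apply: measurable_funX; apply: measurable_norm; exact: bX.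
  have mb : measurable_fun setT (fun w => ((b w ^+ 2) ^+ M)%:E).
    apply/measurable_EFinP; apply: measurable_funX; apply: measurable_funX; apply: measurable_norm; exact: bXX.
  have e0 (y : R) : (0 <= ((y ^+ 2) ^+ M)%:E)%E by rewrite lee_fin exprn_ge0// sqr_ge0.
  apply: (@le_trans _ _ (\int[P]_w (c%:E * ((a w ^+ 2) ^+ M)%:E + c%:E * ((b w ^+ 2) ^+ M)%:E))%E).
    apply: ge0_le_integral_nomeas => w _; first by rewrite exprM.
    rewrite -!EFinM -EFinD lee_fin exprM.
    have xle : `|X (tau n.+1) w - XX n.+1 (tau n.+1) w| <= a w + b w by exact: ler_normB.
    apply: (@le_trans _ _ ((2 * a w ^+ 2 + 2 * b w ^+ 2 + 0) ^+ M)).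
      apply: lerXn2r; rewrite ?nnegrE ?sqr_ge0//.
        by rewrite addr0 addr_ge0// mulr_ge0// sqr_ge0.
      rewrite addr0; exact: le_trans (lerXn2r 2 (normr_ge0 _) (addr_ge0 (normr_ge0 _) (normr_ge0 _)) xle) (sqrD_le _ _).
    apply: le_trans (pow2_sum3_le _ _ _ _) _; rewrite -/M !exprMn expr0n Mn0 addr0.
    by rewrite /c mulrDr !mulrA.
  have cE0 (y : R) : (0 <= c%:E * ((y ^+ 2) ^+ M)%:E)%E by rewrite mule_ge0.
  rewrite ge0_integralD//; try by move=> *; exact: cE0.
  + rewrite !ge0_integralZl// EFinD (EFinM c) (EFinM c); apply: leeD; apply: lee_wpmul2l => //.
      exact: hK2.
    exact: hK1.
  + exact: measurable_funeM.
  + exact: measurable_funeM.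
Qed.

(** Convergence along every sequence of times is uniform convergence: [tau n] is taken among the
    times at which the error exceeds eps, whenever there are any. *)
Lemma strong_cvg p : 0 < p ->
  ereal_sup [set ('E_P[(fun w => `|X t w - XX n t w| `^ p)%R])%E | t in `[0%R, T]] @[n --> \oo] --> 0%E.
Proof.
move=> p0; set a := fun n t => (\int[P]_w (`|X t w - XX n t w| `^ p)%:E)%E.
have a0 n t : (0 <= a n t)%E by apply: integral_ge0 => w _; rewrite lee_fin powR_ge0.
have I00 : (0 : R) \in `[0, T] by rewrite in_itv/= lexx ltW.
have aE n t : ('E_P[(fun w => `|X t w - XX n t w| `^ p)%R])%E = a n t by rewrite unlock.
have small eps : 0 < eps -> \forall n \near \oo,
    (0 <= ereal_sup [set ('E_P[(fun w => `|X t w - XX n t w| `^ p)%R])%E | t in `[0%R, T]] <= eps%:E)%E.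
  move=> e0.
  (* If no time exceeds eps, the implication is vacuous and 0 serves. *)
  have tauP n : exists t, t \in `[0, T] /\ forall s, s \in `[0, T] -> (eps%:E < a n s)%E -> (eps%:E < a n t)%E.
    have [[s [sI hs]]|ns] := pselect (exists s, s \in `[0, T] /\ (eps%:E < a n s)%E); first by exists s.
    by exists 0; exact: (conj I00 (fun s sI hs => False_ind _ (ns (ex_intro _ s (conj sI hs))))).
  have [tau tauH] := choice tauP.
  have /fine_cvgP[f1 /cvgr0_norm_le/(_ _ e0) f2] := Lp_cvg p0 (fun n => (tauH n).1).
  move: f1 f2; apply: filterS2 => n f1 f2; apply/andP; split.
    by apply: (@le_trans _ _ (a n 0)) => //; apply: ereal_sup_ubound; exists 0 => //; exact: aE.
  apply: ge_ereal_sup => _ [t tI <-]; rewrite aE leNgt; apply/negP => /((tauH n).2 t tI).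
  apply/negP; rewrite -leNgt -[leLHS]fineK// lee_fin; exact: le_trans (ler_norm _) f2.
apply/fine_cvgP; split.
  move: (small 1 ltr01); apply: filterS => n /andP[s0 s1].
  by rewrite ge0_fin_numE//; exact: le_lt_trans s1 (ltry _).
apply/cvgrPdist_le => eps e0; move: (small eps e0); apply: filterS => n /andP[s0 s1].
rewrite /= sub0r normrN ger0_norm ?fine_ge0// -lee_fin fineK//.
by rewrite ge0_fin_numE//; exact: le_lt_trans s1 (ltry _).
Qed.

End convergence.

(** * From the hypotheses of the theorem to the setting in coordinates *)

Lemma limn_esup0_cvg (R : realType) (u : nat -> R) : (forall n, (0 < n)%N -> 0 < u n) ->
  limn_esup (fun n => (u n)%:E) = 0%E -> u n @[n --> \oo] --> (0 : R).
Proof.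
move=> u0 uE; pose v n := (u n)%:E.
have cv : esups v n @[n --> \oo] --> 0%E.
  by have := @is_cvg_esups _ v; rewrite -uE limn_esup_lim.
have uv n : (v n <= esups v n)%E by apply: ereal_sup_ubound; exists n => //=.
have c0 : v n @[n --> \oo] --> 0%E.
  apply: (@squeeze_cvge _ _ _ _ (fun=> 0%E) _ (esups v)) => //; last exact: cvg_cst.
  (* Positivity is available from index 1 on. *)
  by exists 1%N => // n n1; rewrite uv lee_fin ltW//; apply: u0.
by move: c0 => /fine_cvgP[].
Qed.

(** The H_rho norm dominates the norm of H, so the trace on H_rho of an open set of H is open in
    H_rho. *)
Lemma Hr_borel_measurable_borel d (Omega : measurableType d) (R : realType) (rho : R) (Y : Omega -> H R) :
  0 <= rho -> Hr_borel_measurable rho Y -> borel_measurable Y.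
Proof.
move=> r0 [Yr mY] U oU.
have -> : Y @^-1` U = Y @^-1` (U `&` Hr rho).
  by apply/seteqP; split=> w /=; [move=> Uw; split=> //; exact: Yr|case].
apply: mY; split=> [v []//|v [Uv vr]].
have /nbhs_ballP[eps /= e0 bU] := open_nbhs_nbhs (conj oU Uv).
exists eps => // u ur uv; split=> //; apply: bU; rewrite -ball_normE/= distrC.
apply: le_lt_trans uv; apply: norm_le_Hr => //; exact: HrB.
Qed.

Theorem corollary6p11 (R : realType) (T rho chi : R)
    (hT : 0 < T)
    (hrho : 1 / 6 < rho < 1 / 4)
    (hchi : 0 < chi <= rho / 3 - 1 / 18)
    (xi : H R) (hxi : Hr (1 / 2) xi)
    (F : H R -> H R) (e : nat -> H R) (Pn : nat -> H R -> H R) (h : nat -> R)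
    (hF : forall v : H R, Hr (1 / 6) v ->
      (F v : R -> R) = (fun x => v x - v x ^+ 3) %[ae leb01 R])
    (he : forall n, (0 < n)%N ->
      (e n : R -> R) = (fun x => Num.sqrt 2 * sin (n%:R * pi * x))
        %[ae leb01 R])
    (hPn : forall n, (0 < n)%N -> forall v : H R,
      Pn n v = \sum_(1 <= k < n.+1) L2dot (e k) v *: e k)
    (hh : forall n, (0 < n)%N -> 0 < h n <= T)
    (hh0 : limn_esup (fun n => (h n)%:E) = 0%E)
    (d : measure_display) (Omega : measurableType d) (P : probability Omega R)
    (W : R -> H R -> Omega -> R) (hW : cylindrical_wiener P T W)
    (XX OO : nat -> R -> Omega -> H R)
    (hXX : forall (n : nat) (t : R), (0 < n)%N -> t \in `[0, T] ->
      borel_measurable (XX n t) /\ forall w, range (Pn n) (XX n t w))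
    (hOO : forall (n : nat) (t : R), (0 < n)%N -> t \in `[0, T] ->
      borel_measurable (OO n t) /\ forall w, range (Pn n) (OO n t w))
    (X : R -> Omega -> H R)
    (hX : forall t : R, t \in `[0, T] -> Hr_borel_measurable rho (X t))
    (hXc : forall w, Hr_continuous_on `[0, T] rho (fun t => X t w))
    (hXeq : forall t : R, t \in `[0, T] ->
      rv_class P (X t) =
      add_class
        (rv_class P (fun w => heat t xi +
           bochner_integral lebesgue_measure `[0, t]
             (fun s : R => heat (t - s) (F (X s w)))))
        (stoch_integral P W e t (fun s : R => heat (t - s))))
    (hOOeq : forall (n : nat) (t : R), (0 < n)%N -> t \in `[0, T] ->
      rv_class P (OO n t) =
      stoch_integral P W e t (fun s v => Pn n (heat (t - s) v)))
    (hXXeq : forall (n : nat) (t : R), (0 < n)%N -> t \in `[0, T] ->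
      \forall w \ae P, XX n t w =
        Pn n (heat t xi) +
        bochner_integral lebesgue_measure `[0, t]
          (fun s : R => let s' := round_down (h n) s in
             Pn n (heat (t - s)
               ((Hr_norm rho (XX n s' w) +
                 Hr_norm rho (OO n s' w + Pn n (heat s' xi))
                   <= `|h n| `^ (- chi))%R%:R *: F (XX n s' w)))) +
        OO n t w) :
  forall p : R, 0 < p ->
    limn_esup (fun n =>
      ereal_sup [set ('E_P[(fun w => `|X t w - XX n t w| `^ p)%R])%E
                | t in `[0%R, T]]) = 0%E.
Proof.
move=> p p0; have /andP[rho6 rho4] := hrho; have /andP[chi0 chi1] := hchi.
have rho0 : 0 <= rho by apply: ltW; apply: lt_trans rho6; rewrite divr_gt0.
have xir : Hr rho xi by apply: (Hr_mono _ hxi).1; move: rho4; lra.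
have heb k : e k.+1 = basis k.
  apply/L2_eqP; have aef := ae_filter_ringOfSetsType (leb01 R).
  apply: filterS2 (he k.+1 isT) (basisE k) => x h1 h2 xT; exact: etrans (h1 xT) (esym (h2 xT)).
have PnE n : (0 < n)%N -> Pn n = proj n.
  move=> n0; apply/funext => v; rewrite hPn// big_add1 /= big_mkord /proj /synth.
  by apply: eq_bigr => k _; rewrite heb.
have rangeP n v : (0 < n)%N -> range (Pn n) v -> v = proj n v.
  move=> n0; rewrite PnE// => -[u _ <-]; apply: coord_inj => k; rewrite !coord_proj.
  by case: ifP.
have h0 n : (0 < n)%N -> 0 < h n by move=> /hh/andP[].
have bX t : t \in `[0, T] -> borel_measurable (X t).
  by move=> tI; apply: Hr_borel_measurable_borel rho0 (hX t tI).
(* [X t] lies in its own class; splitting it by the equation exhibits a version g of the stochastic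
   convolution that equals [path_noise] almost surely. *)
have hX' t : t \in `[0, T] -> exists2 g, stoch_integral P W e t (fun s => heat (t - s)) g &
    \forall w \ae P, g w = path_noise xi F (fun s => X s w) t.
  move=> tI; have : rv_class P (X t) (X t) by split; [exact: bX|exact: filterE].
  rewrite hXeq// => -[f [_ fE] [g gI fg]]; exists g => //.
  move: fE; apply: filterS => w fw; rewrite /path_noise -fg /= fw.
  rewrite /duhamel -[RHS]addrA -opprD [X in _ = X - _]addrC; exact: (esym (addrK _ _)).
have hOO' n t : (0 < n)%N -> t \in `[0, T] ->
    rv_class P (OO n t) = stoch_integral P W e t (fun s v => proj n (heat (t - s) v)).
  by move=> n0 tI; have := hOOeq n t n0 tI; rewrite (PnE n n0).
have hXX' n t : (0 < n)%N -> t \in `[0, T] -> \forall w \ae P,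
    XX n t w = scheme rho chi xi F n (h n) (fun s => XX n s w) (fun s => OO n s w) t.
  move=> n0 tI; have := hXXeq n t n0 tI; apply: filterS => w.
  by rewrite PnE.
(* The upper limit is an actual limit. *)
apply: (cvg_limn_einf_sup _).2.
exact: (strong_cvg hT rho6 rho4 chi0 chi1 xir hF heb h0 (limn_esup0_cvg h0 hh0) hW
  (fun n t n0 tI => (hXX n t n0 tI).1) (fun n t w n0 tI => rangeP n _ n0 ((hXX n t n0 tI).2 w))
  (fun n t n0 tI => (hOO n t n0 tI).1) (fun n t w n0 tI => rangeP n _ n0 ((hOO n t n0 tI).2 w))
  bX hXc hX' hOO' hXX' p0).
Qed.
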